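(* For all $n\in\mathbb{N}$ let $\mu_n\in\mathrm{L}^\infty(Q_T)$, $G_n\in\mathrm{L}^2(Q_T)$, $z_n^0\in\mathrm{L}^2(\mathbb{T}^N)$, where the $\mu_n$ are positively lower-bounded uniformly in $n$ (there is $\alpha>0$ such that $\mu_n\ge\alpha$ a.e. on $Q_T$ for all $n$), and let $z_n\in\mathrm{L}^2(Q_T)$ be the dual solution of $$\partial_t z_n-\Delta(\mu_n z_n)=G_n,\qquad z_n(0,\cdot)=z_n^0 .$$ Assume that there exist $z^0\in\mathrm{L}^2(\mathbb{T}^N)$, $G\in\mathrm{L}^2(Q_T)$ and $\mu\in\mathrm{L}^\infty(Q_T)$ such that $z_n^0\rightharpoonup z^0$ weakly in $\mathrm{L}^2(\mathbb{T}^N)$, $G_n\rightharpoonup G$ weakly in $\mathrm{L}^2(Q_T)$ and $\mu_n\to\mu$ strongly in $\mathrm{L}^1(Q_T)$. Then $(\mu_n^{1/2}z_n)_n$ and $(z_n)_n$ converge (strongly) in $\mathrm{L}^2(Q_T)$ to $\mu^{1/2}z$ and $z$ respectively, where $z$ is the dual solution of $$\partial_t z-\Delta(\mu z)=G,\qquad z(0,\cdot)=z^0 .$$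
   Context: $T>0$ and an integer $N\ge1$ are fixed, $\mathbb{T}^N$ is the flat torus, $Q_T:=[0,T)\times\mathbb{T}^N$, and $\mathscr{D}(Q_T)$ denotes the smooth functions with compact support in $[0,T)\times\mathbb{T}^N$ (they may be non-zero at $t=0$). A function $\mu$ is positively lower-bounded if $\mu\ge\alpha$ a.e. for some constant $\alpha>0$. For $\mu\in\mathrm{L}^\infty(Q_T)$ positively lower-bounded and $S\in\mathrm{L}^2(Q_T)$, $\Phi_\mu^S$ denotes the unique function in $\mathrm{L}^\infty(0,T;\mathrm{H}^1(\mathbb{T}^N))\cap\mathrm{L}^2(0,T;\mathrm{H}^2(\mathbb{T}^N))\cap\mathscr{C}^0([0,T];\mathrm{L}^2(\mathbb{T}^N))$ solving $\partial_t\Phi+\mu\Delta\Phi=S$ (an equality in $\mathrm{L}^2(Q_T)$), $\Phi(T,\cdot)=0$. Dual solution: for $\mu\in\mathrm{L}^\infty(Q_T)$ positively lower-bounded, $G\in\mathrm{L}^2(Q_T)$ and $z^0\in\mathrm{L}^2(\mathbb{T}^N)$, the dual solution of $\partial_t z-\Delta(\mu z)=G$, $z(0,\cdot)=z^0$ is the unique distributional solution of this problem, i.e. it satisfies $-\int_{Q_T}z(\partial_t\varphi+\mu\Delta\varphi)=\int_{\mathbb{T}^N}z^0\varphi(0,\cdot)+\int_{Q_T}G\varphi$ for all $\varphi\in\mathscr{D}(Q_T)$; it belongs to $\mathrm{L}^2(Q_T)$ and is characterized by $$\forall S\in\mathrm{L}^2(Q_T),\qquad -\int_{Q_T}zS=\int_{\mathbb{T}^N}z^0\,\Phi_\mu^S(0)+\int_{Q_T}G\,\Phi_\mu^S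 .$$ *)

(* Defs.v *)
From HB Require Import structures.
From mathcomp Require Import all_boot all_order all_algebra.
From mathcomp Require Import all_classical all_reals all_analysis.

Set Implicit Arguments.
Unset Strict Implicit.
Unset Printing Implicit Defensive.

Import Order.TTheory GRing.Theory Num.Theory.
Import numFieldNormedType.Exports.

Local Open Scope classical_set_scope.
Local Open Scope ring_scope.

(** The torus T^N = R^N / Z^N is handled through its fundamental domain: points
    are N-tuples of reals, and its Lebesgue measure is the N-fold product of the
    uniform measure on [0, 1], carried by the unit cube.  Elements of L^p are
    functions on R^N (resp. R x R^N), taken up to equality almost everywhere for
    that measure; their values off the cube are irrelevant.  Periodicity is only
    meaningful, and only required, for the smooth test functions. *)

Notation torus R N := (N.-tuple (measurableTypeR R)).
Notation spacetime R N := (measurableTypeR R * torus R N)%type.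

Section torus.
Context {R : realType}.

Definition tcons n (p : spacetime R n) : torus R n.+1 :=
  [the torus R n.+1 of p.1 :: p.2].

Lemma measurable_tcons n : measurable_fun [set: spacetime R n] (@tcons n).
Proof. exact: measurable_cons. Qed.

HB.instance Definition _ n := isMeasurableFun.Build _ _ _ _ (@tcons n)
  (@measurable_tcons n).

Fixpoint torus_measure (n : nat) : probability (torus R n) R :=
  match n with
  | 0 => dirac ([tuple] : torus R 0)
  | m.+1 => distribution (uniform_prob (@ltr01 R) \x torus_measure m)%E (@tcons m)
  end.

Lemma measurable_itv0T (T : R) :
  measurable (`[0%R, T[%classic : set (measurableTypeR R)).
Proof. exact: measurable_itv. Qed.

Lemma lebesgue_itv0T_lty (T : R) : (@lebesgue_measure R `[0%R, T[ < +oo)%E.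
Proof.
by rewrite lebesgue_measure_itv /=; case: ifP => _; rewrite -?EFinB ltry.
Qed.

Definition time_measure (T : R) : set (measurableTypeR R) -> \bar R :=
  mfrestr (measurable_itv0T T) (lebesgue_itv0T_lty T).

HB.instance Definition _ (T : R) := FiniteMeasure.copy (time_measure T)
  (mfrestr (measurable_itv0T T) (lebesgue_itv0T_lty T)).

(** Q_T = [0, T) x T^N *)
Definition QT_measure (T : R) (N : nat) : set (spacetime R N) -> \bar R :=
  (time_measure T \x torus_measure N)%E.
Arguments QT_measure T N _ : clear implicits.

HB.instance Definition _ (T : R) (N : nat) := Measure.copy (QT_measure T N)
  (time_measure T \x torus_measure N)%E.

Lemma QT_measure_fin (T : R) (N : nat) : fin_num_fun (QT_measure T N).
Proof.
apply: lty_fin_num_fun; rewrite -setXTT.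
apply: (@le_lt_trans _ _ (time_measure T setT * torus_measure N setT)%E).
  by rewrite le_eqVlt; apply/orP; left; apply/eqP; exact: product_measure1E.
by rewrite probability_setT mule1 -ge0_fin_numE// fin_num_measure.
Qed.

HB.instance Definition _ (T : R) (N : nat) :=
  Measure_isFinite.Build _ _ _ (QT_measure T N) (@QT_measure_fin T N).

End torus.
Arguments QT_measure {R} T N _.

Section smooth.
Context {R : realType}.

Fixpoint Ck (V : normedModType R) (k : nat) (f : V -> R) : Prop :=
  match k with
  | 0 => continuous f
  | j.+1 => (forall x, differentiable f x) /\ forall v, Ck j (fun x => 'D_v f x)
  end.

Definition smooth (V : normedModType R) (f : V -> R) : Prop :=
  forall k, Ck k f.

Context {N : nat}.
Implicit Type phi : R * 'rV[R]_N -> R.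

(** Smoothness needs the normed space 'rV_N, integration the measurable space of
    N-tuples. *)
Definition row_of_tuple (x : torus R N) : 'rV[R]_N := \row_i tnth x i.

Definition on_tuples phi (p : spacetime R N) : R :=
  phi (p.1, row_of_tuple p.2).

Definition space_dir (i : 'I_N) : R * 'rV[R]_N := (0, delta_mx 0 i).

Definition dt phi (p : R * 'rV[R]_N) : R := 'D_((1, 0) : R * 'rV[R]_N) phi p.

Definition lap phi (p : R * 'rV[R]_N) : R :=
  \sum_(i < N) 'D_(space_dir i) (fun q => 'D_(space_dir i) phi q) p.

(** D(Q_T): restrictions to [0, T) x T^N of smooth functions on R x R^N that are
    Z^N-periodic in space and vanish for t >= tau, for some tau < T; there is no
    condition at t = 0. *)
Definition test_function (T : R) phi : Prop :=
  [/\ smooth phi,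
      forall (i : 'I_N) p, phi (p + space_dir i) = phi p &
      exists2 tau : R, tau < T & forall t x, tau <= t -> phi (t, x) = 0].

End smooth.

Section dual_solution.
Context {R : realType} (T : R) {N : nat}.

(** Distributional solution in L^2(Q_T) of
      d_t z - Lap (mu z) = G,   z(0, .) = z0. *)
Definition dual_solution (mu G : spacetime R N -> R) (z0 : torus R N -> R)
    (z : spacetime R N -> R) : Prop :=
  z \in Lfun (QT_measure T N) 2%:E /\
  forall phi : R * 'rV[R]_N -> R, test_function T phi ->
    - (\int[QT_measure T N]_p
         (z p * (on_tuples (dt phi) p + mu p * on_tuples (lap phi) p))) =
    \int[torus_measure N]_x (z0 x * on_tuples phi (0, x)) +
    \int[QT_measure T N]_p (G p * on_tuples phi p).

End dual_solution.

Section convergence.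
Context d (X : measurableType d) {R : realType}.
Variable m : {measure set X -> \bar R}.

(** Strong convergence in L^p(m). *)
Definition Lcvg (p : \bar R) (f_ : nat -> X -> R) (f : X -> R) : Prop :=
  'N[m]_p[EFin \o (fun x => (f_ n x - f x)%R)]%E @[n --> \oo] --> 0%E.

(** Weak convergence in L^2(m), the dual being identified with L^2(m). *)
Definition weak_L2cvg (f_ : nat -> X -> R) (f : X -> R) : Prop :=
  forall g : X -> R, g \in Lfun m 2%:E ->
    (\int[m]_x (f_ n x * g x)) @[n --> \oo] --> \int[m]_x (f x * g x).

End convergence.

(* Main.v *)
(** In the Fourier basis [e_j] of the torus, with [- Delta e_j = lam_j e_j], the
    [j]-th coefficient [z_j(t)] of a dual solution is the primitive of
    [G_j - lam_j (mu z)_j] with initial value [z0_j]; this is seen by testing with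
    [x exp(- eps / x) e_j], [x = tau - t], a smooth approximation of [(tau - t)^+ e_j].
    Multiplying by [z_j / lam_j], summing over [lam_j <> 0] and adding the mean, of
    index [c0], by hand (Parseval) gives the energy identity
      [2 int mu z^2 = sum_j lam_j^-1 (z0_j^2 - z_j(T)^2 + 2 int G_j z_j)
                      + 2 int z_{c0} (mu z)_{c0}].
    It yields uniqueness and bounds on [z_n] in L^2; a limit [z] is then produced by the
    Riesz theorem on the range of the adjoint operator, which is dense by uniqueness.
    Under weak convergence each mode of [z_n] converges and the tail of the series is
    uniformly small because [lam_j] tends to infinity, so that the energies
    [int mu_n z_n^2] have upper limit at most [int mu z^2].  With the weak convergence of
    [mu_n^(1/2) z_n] this gives its strong convergence, and that of [z_n] follows since
    [mu_n >= alpha]. *)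

Require Import Defs.
From mathcomp Require Import all_boot all_order all_algebra.
From mathcomp Require Import all_classical all_reals all_analysis.
From mathcomp Require Import measurable_realfun ess_sup_inf ring lra.
Import Order.TTheory GRing.Theory Num.Theory.
Import numFieldNormedType.Exports.
Set Implicit Arguments.
Unset Strict Implicit.
Unset Printing Implicit Defensive.
Local Open Scope classical_set_scope.
Local Open Scope ring_scope.

(** * Hilbert spaces *)

(** The [mu_n] share a lower bound, but each has its own upper bound: convergence in L^1 provides no
    common one, so no uniform estimate may use the supremum of [mu_n], and [mu_n z_n] need not stay
    bounded in L^2. What stays bounded is [mu_n^(1/2) z_n], and products are split accordingly:
    [(mu_n - mu) z_n] is [mu_n^(1/2) - mu^(1/2)], which tends to 0 in L^2 because
    [(a^(1/2) - b^(1/2))^2 <= |a - b|], times [(mu_n^(1/2) + mu^(1/2)) z_n], which is bounded in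
    L^2. The weights [lam_j^-1] are those of the H^-1 norm, in which the Laplacian of [mu z] tested
    with [z] becomes [mu z^2]. Constants are invisible to this norm; but the mean of [z] solves an
    equation free of [mu], hence is bounded in time by the data alone. The argument is run for an
    abstract orthonormal family and an abstract class of test functions, with coefficients and test
    functions replaced by versions that are bounded everywhere. *)

Section hilbert.
Context {R : realType} {V : lmodType R} (ip : V -> V -> R).
Hypothesis ipC : forall u v, ip u v = ip v u.
Hypothesis ipDl : forall u v w, ip (u + v) w = ip u w + ip v w.
Hypothesis ipZl : forall a u v, ip (a *: u) v = a * ip u v.
Hypothesis ip_ge0 : forall u, 0 <= ip u u.
Hypothesis complete : forall u : nat -> V,
  (forall e : R, 0 < e -> exists n0, forall m n, (n0 <= m)%N -> (n0 <= n)%N ->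
    ip (u m - u n) (u m - u n) < e) ->
  exists v, ip (u n - v) (u n - v) @[n --> \oo] --> 0.

Lemma ipDr u v w : ip u (v + w) = ip u v + ip u w.
Proof. by rewrite ipC ipDl !(ipC _ u). Qed.
Lemma ipZr a u v : ip u (a *: v) = a * ip u v.
Proof. by rewrite ipC ipZl ipC. Qed.
Lemma ipNl u v : ip (- u) v = - ip u v.
Proof. by rewrite -scaleN1r ipZl mulN1r. Qed.
Lemma ipNr u v : ip u (- v) = - ip u v.
Proof. by rewrite ipC ipNl ipC. Qed.
Let ipE := (ipDl, ipDr, ipNl, ipNr, ipZl, ipZr).

(** The form is only semidefinite, since it will be applied to functions and not to classes modulo
    null sets; hence the separate case of a vector of norm 0. *)
Lemma ip_CS u v : ip u v ^+ 2 <= ip u u * ip v v.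
Proof.
have key s : 0 <= ip u u + 2 * s * ip u v + s ^+ 2 * ip v v.
  have := ip_ge0 (u + s *: v); rewrite !ipE (ipC v u) => h.
  by apply: le_trans h _; lra.
have [v0|vn0] := eqVneq (ip v v) 0.
  rewrite v0 mulr0 expr2; have [->|uv0] := eqVneq (ip u v) 0; first by rewrite mulr0.
  (* With [ip v v = 0] the expression in [key] is affine in [s]; this [s] makes it equal to
     [- 2 - ip u u], which is negative. *)
  have := key (- (1 + ip u u) / ip u v); rewrite v0.
  have -> : 2 * (- (1 + ip u u) / ip u v) * ip u v = - 2 * (1 + ip u u) by field.
  by move=> h; have := ip_ge0 u; lra.
have vp : 0 < ip v v by rewrite lt_def vn0 ip_ge0.
have := key (- ip u v / ip v v).
have -> : ip u u + 2 * (- ip u v / ip v v) * ip u v +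
   (- ip u v / ip v v) ^+ 2 * ip v v = ip u u - ip u v ^+ 2 / ip v v by field.
by rewrite subr_ge0 ler_pdivrMr.
Qed.

Lemma ip_cvgl (u : nat -> V) v w : ip (u n - v) (u n - v) @[n --> \oo] --> 0 ->
  ip (u n) w @[n --> \oo] --> ip v w.
Proof.
move=> uv; apply/subr_cvg0/norm_cvg0P.
have sq : Num.sqrt (ip (u n - v) (u n - v) * ip w w) @[n --> \oo] --> 0.
  have -> : (0 : R) = Num.sqrt (0 * ip w w) by rewrite mul0r sqrtr0.
  apply: continuous_cvg; [exact: sqrt_continuous|exact: cvgMr_tmp].
apply: (@squeeze_cvgr _ _ _ _ (cst 0) _ _ _ _ _ sq); last exact: cvg_cst.
near=> n; rewrite normr_ge0 /= -ipNl -ipDl -sqrtr_sqr ler_wsqrtr//.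
exact: ip_CS.
Unshelve. all: by end_near. Qed.

(* Minimise [ip u u - 2 l u] over [D]: by the parallelogram identity a minimising
   sequence is Cauchy, and its limit satisfies the Euler-Lagrange equation. *)
Lemma riesz (D : set V) (l : V -> R) (C : R) :
  D 0 -> (forall a u v, D u -> D v -> D (a *: u + v)) ->
  (forall a u v, D u -> D v -> l (a *: u + v) = a * l u + l v) ->
  (forall u, D u -> l u ^+ 2 <= C * ip u u) ->
  exists v, (forall e : R, 0 < e -> exists2 u, D u & ip (u - v) (u - v) < e) /\
    forall u, D u -> ip v u = l u.
Proof.
move=> D0 Dlin llin lC.
pose J u := ip u u - 2 * l u.
(* With [M = max C 0] and [a = ip u u], one has [(2 l u)^2 <= 4 M a <= (a + M + 1)^2]. The maximum
   is there because nothing makes [C] nonnegative. *)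
have JC u : D u -> - (Num.max C 0 + 1) <= J u.
  move=> Du; have := lC _ Du; have := ip_ge0 u; rewrite /J.
  set a := ip u u; set b := l u => a0 bC.
  have bM : b ^+ 2 <= Num.max C 0 * a.
    by apply: le_trans bC _; rewrite ler_wpM2r// le_max lexx.
  have M0 : 0 <= Num.max C 0 by rewrite le_max lexx orbT.
  rewrite -subr_ge0; set M := Num.max C 0 in bM M0 *.
  have := sqr_ge0 (a - M).
  have : 0 <= a + M + 1 by lra.
  have [b0|b0] := leP b 0; first lra.
  move=> h1 h2; suff : (2 * b) ^+ 2 <= (a + M + 1) ^+ 2.
    by rewrite ler_sqr ?nnegrE; lra.
  nra.
have Jinf : has_inf (J @` D).
  split; first by exists (J 0), 0.
  by exists (- (Num.max C 0 + 1)) => _ [u Du <-]; exact: JC.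
set I := inf (J @` D).
have IJ u : D u -> I <= J u.
  by move=> Du; apply: ge_inf; [case: Jinf|exists u].
have /choice[d dP] : forall n : nat, exists u, D u /\ J u < I + n.+1%:R^-1.
  move=> n; have [|_ [u Du <-] Ju] := @inf_adherent _ (J @` D) n.+1%:R^-1 _ Jinf.
    by rewrite invr_gt0 ltr0Sn.
  by exists u.
have Dd n : D (d n) by case: (dP n).
have dJ n : J (d n) < I + n.+1%:R^-1 by case: (dP n).
have cvi : (n.+1%:R^-1 : R) @[n --> \oo] --> 0 by exact: cvg_harmonic.
have par m n : ip (d m - d n) (d m - d n) <= 2 * (m.+1%:R^-1 + n.+1%:R^-1).
  have Dz a u : D u -> D (a *: u) by move=> Du; rewrite -[_ *: _]addr0; exact: Dlin.
  have lz a u : D u -> l (a *: u) = a * l u.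
    move=> Du; rewrite -[_ *: _]addr0 llin//.
    have : l (1 *: (0 : V) + 0) = l 0 by rewrite scaler0 addr0.
    by rewrite llin// mul1r -[RHS]add0r => /addIr ->; rewrite addr0.
  have := IJ _ (Dlin 2^-1 _ _ (Dd m) (Dz 2^-1 _ (Dd n))).
  rewrite /J llin ?lz; [|exact: Dd|exact: Dd|exact: Dz].
  have := dJ m; have := dJ n; rewrite /J !ipE (ipC (d n) (d m)).
  move: (n.+1%:R^-1) (m.+1%:R^-1) => p q; clear; clearbody I.
  move: I (ip (d n) (d n)) (ip (d m) (d m)) (ip (d m) (d n)) (l (d m)) (l (d n)).
  move=> {}I x y z a b; lra.
have [v dv] : exists v, ip (d n - v) (d n - v) @[n --> \oo] --> 0.
  apply: complete => e e0.
  have /cvgrPdist_lt /(_ (e / 4)) := cvi.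
  case=> [|N _ NP]; first by lra.
  exists N => m n Nm Nn; apply: le_lt_trans (par m n) _.
  have := NP _ Nm; have := NP _ Nn; rewrite /= !sub0r !normrN !ger0_norm ?invr_ge0//.
  by move: (m.+1%:R^-1) (n.+1%:R^-1) => p q; lra.
exists v; split.
  move=> e e0; have /cvgrPdist_lt /(_ e e0)[N _ /(_ N (leqnn N))] := dv.
  by rewrite /= sub0r normrN ger0_norm ?ip_ge0// => h; exists (d N).
move=> u Du.
have key s : 0 <= 2 * s * (ip v u - l u) + s ^+ 2 * ip u u.
  have cv : (2 * s * (ip (d n) u - l u) + s ^+ 2 * ip u u + n.+1%:R^-1) @[n --> \oo] -->
     2 * s * (ip v u - l u) + s ^+ 2 * ip u u + 0.
    apply: cvgD => //; apply: cvgD; last exact: cvg_cst.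
    apply: cvgMl_tmp; apply: cvgB; last exact: cvg_cst.
    exact: ip_cvgl.
  rewrite -[leRHS]addr0 -(cvg_lim _ cv)//; apply: limr_ge.
    by apply/cvg_ex; eexists; exact: cv.
  near=> n; have := IJ _ (Dlin s _ _ Du (Dd n)); have := dJ n.
  rewrite /J llin// !ipE (ipC u (d n)).
  by move: (n.+1%:R^-1); clearbody I => q; lra.
apply/eqP; rewrite -subr_eq0; apply/eqP; set x := ip v u - l u in key *.
have u0 := ip_ge0 u; set y := ip u u in key u0.
(* The minimiser of the quadratic would be [- x / y]; dividing by [1 + y] covers [y = 0] and still
   yields a negative value unless [x = 0]. *)
have := key (- x / (1 + y)).
have -> : 2 * (- x / (1 + y)) * x + (- x / (1 + y)) ^+ 2 * y =
  - (x ^+ 2 * (2 + y) / (1 + y) ^+ 2) by field; lra.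
rewrite oppr_ge0 pmulr_lle0; last by rewrite invr_gt0 exprn_gt0//; lra.
rewrite pmulr_lle0; last lra.
by move=> h; apply/eqP; rewrite -sqrf_eq0 eq_le h sqr_ge0.
Unshelve. all: by end_near. Qed.

(* Sokal's gliding hump: one of [g + r f], [g - r f] is tested by [f] at least as
   strongly as [r f]. *)
Lemma weakly_bounded (f : nat -> V) :
  (forall g, exists C, forall n, `|ip (f n) g| <= C) ->
  exists C, forall n, ip (f n) (f n) <= C.
Proof.
move=> fb; apply: contrapT => /forallNP nb.
(* The hump added at stage [k] has norm [4^-k], so norms above [16^k] let it pair with [h k] to more
   than [4^k]. *)
have /choice[s sP] : forall k : nat, exists n, (16 ^+ k) ^+ 2 < ip (f n) (f n).
  move=> k; have /existsNP[n /negP] := nb ((16 ^+ k) ^+ 2).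
  by rewrite -ltNge; exists n.
pose h k := f (s k); pose nr k : R := Num.sqrt (ip (h k) (h k)).
have nr2 k : nr k ^+ 2 = ip (h k) (h k) by rewrite sqr_sqrtr// ip_ge0.
have nrk k : 16 ^+ k < nr k.
  by rewrite -ltr_sqr ?nnegrE ?exprn_ge0 ?sqrtr_ge0// nr2; exact: sP.
have nr0 k : 0 < nr k by apply: le_lt_trans (nrk k); rewrite exprn_ge0.
pose e k := (4 ^- k / nr k) *: h k.
have ee k : ip (e k) (e k) = (4 ^- k) ^+ 2.
  by rewrite /e ipZl ipZr -nr2; field; rewrite expf_neq0//= gt_eqF.
pose step k g := if 4 ^- k * nr k <= `|ip (h k) (g + e k)| then g + e k else g - e k.
have stepP k g : 4 ^- k * nr k <= `|ip (h k) (step k g)|.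
  rewrite /step; case: ifPn => //; rewrite -ltNge.
  have -> : 4 ^- k * nr k = ip (h k) (e k).
    by rewrite /e ipZr -nr2; field; rewrite expf_neq0//= gt_eqF.
  set x := ip (h k) (e k); rewrite ipDr ipDr ipNr -/x => lt1.
  have := ler_norm (ip (h k) g + x).
  have : - (ip (h k) g - x) <= `|ip (h k) g - x| by rewrite -normrN ler_norm.
  lra.
pose fix g k := if k is k'.+1 then step k' (g k') else 0.
have gS k : ip (g k.+1 - g k) (g k.+1 - g k) = (4 ^- k) ^+ 2.
  by rewrite /= /step; case: ifP => _; rewrite addrAC subrr add0r ?ipNl ?ipNr ?opprK ee.
pose nm v : R := Num.sqrt (ip v v).
have nm2 v : nm v ^+ 2 = ip v v by rewrite sqr_sqrtr// ip_ge0.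
have nm_ge0 v : 0 <= nm v by exact: sqrtr_ge0.
have CS u v : `|ip u v| <= nm u * nm v.
  rewrite -ler_sqr ?nnegrE ?mulr_ge0// exprMn !nm2 -normrX ger0_norm ?sqr_ge0//.
  exact: ip_CS.
have tri u v : nm (u + v) <= nm u + nm v.
  rewrite -ler_sqr ?nnegrE ?addr_ge0// sqrrD !nm2 !ipE (ipC v u).
  have := CS u v; have := ler_norm (ip u v); rewrite mulr2n; lra.
have nmS k : nm (g k.+1 - g k) = 4 ^- k.
  by rewrite /nm gS sqrtr_sqr ger0_norm// invr_ge0 exprn_ge0.
have tail k n : nm (g (k + n)%N - g k) <= 4 / 3 * 4 ^- k - 4 / 3 * 4 ^- (k + n).
  elim: n => [|n IH]; first by rewrite addn0 !subrr /nm -(scale0r 0) ipZl mul0r sqrtr0.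
  rewrite -(subrKA (g (k + n)%N)); apply: le_trans (tri _ _) _.
  rewrite addnS nmS; apply: le_trans (lerD (lexx _) IH) _.
  rewrite exprS invfM; set t := 4 ^- (k + n); lra.
have tail2 k n : nm (g (k + n)%N - g k) <= 4 / 3 * 4 ^- k.
  apply: le_trans (tail k n) _; rewrite lerBlDr lerDl mulr_ge0// invr_ge0 exprn_ge0//.
have c4 : (4 ^- n : R) @[n --> \oo] --> 0.
  under eq_fun do rewrite -exprVn.
  by apply: cvg_expr; rewrite ger0_norm ?invr_ge0// invf_lt1//; lra.
have [v gv] : exists v, ip (g n - v) (g n - v) @[n --> \oo] --> 0.
  apply: complete => x x0.
  have /cvgrPdist_lt /(_ (Num.sqrt x * (3 / 8))) := c4.
  case; first by rewrite mulr_gt0 ?sqrtr_gt0//; lra.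
  move=> N _ NP; have := NP _ (leqnn N).
  rewrite /= sub0r normrN ger0_norm ?invr_ge0 ?exprn_ge0// => lt4.
  exists N => m n /subnKC <- /subnKC <-.
  rewrite -nm2 -[ltRHS](sqr_sqrtr (ltW x0)) ltr_sqr ?nnegrE ?sqrtr_ge0//.
  rewrite -(subrKA (g N)); apply: le_lt_trans (tri _ _) _.
  have -> : nm (g N - g (N + (n - N))%N) = nm (g (N + (n - N))%N - g N).
    by rewrite -opprB /nm ipNl ipNr opprK.
  have := tail2 N (m - N)%N; have := tail2 N (n - N)%N; lra.
have gvk k : nm (v - g k) <= 4 / 3 * 4 ^- k.
  apply/ler_addgt0Pl => x x0.
  have /cvgrPdist_lt /(_ (x ^+ 2))[|N _ NP] := gv; first by rewrite exprn_gt0.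
  rewrite -(subrKA (g (k + N)%N)); apply: le_trans (tri _ _) _.
  apply: lerD => //; have := NP _ (leq_addl k N).
  rewrite /= sub0r normrN ger0_norm ?ip_ge0// -nm2 ltr_sqr ?nnegrE ?(ltW x0)//.
  by rewrite /nm -opprB ipNl ipNr opprK => /ltW.
have [C Cb] := fb v.
(* All humps after stage [k] together pair with [h k] to at most [4/3 * 4^-(k+1) * nr k], a third of
   what stage [k] secured. *)
have hv k : 2 / 3 * 4 ^+ k <= C.
  apply: le_trans (Cb (s k)); rewrite -/(h k).
  have -> : v = g k.+1 + (v - g k.+1) by rewrite addrC subrK.
  have := stepP k (g k); rewrite -[step k _]/(g k.+1) ipDr.
  have := lerB_normD (ip (h k) (g k.+1)) (ip (h k) (v - g k.+1)).
  have yt : `|ip (h k) (v - g k.+1)| <= 3^-1 * (4 ^- k * nr k).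
    apply: le_trans (CS _ _) _; rewrite -[nm (h k)]/(nr k) mulrA mulrC.
    rewrite ler_wpM2r ?(ltW (nr0 k))//; apply: le_trans (gvk _) _.
    by rewrite exprS invfM mulrA ler_wpM2r ?invr_ge0 ?exprn_ge0//; lra.
  have t4 : 4 ^+ k <= 4 ^- k * nr k.
    rewrite mulrC ler_pdivlMr ?exprn_gt0// -exprMn.
    have -> : 4 * 4 = 16 :> R by ring.
    exact: ltW.
  move: yt t4; move: (4 ^- k * nr k) (4 ^+ k) => t q; lra.
have := c4 => /cvgrPdist_lt /(_ ((`|C| + 1)^-1 / 2)); case.
  by rewrite divr_gt0// invr_gt0; have := normr_ge0 C; lra.
move=> k _ /(_ _ (leqnn k)); rewrite /= sub0r normrN ger0_norm ?invr_ge0 ?exprn_ge0//.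
have C1 : 0 < `|C| + 1 by have := normr_ge0 C; lra.
rewrite -invfM ltf_pV2 ?posrE ?exprn_gt0 ?mulr_gt0// => ltk.
by have := hv k; have := ler_norm C; lra.
Unshelve. all: by end_near. Qed.

Section orthonormal.
Variable e : nat -> V.
Hypothesis e_ortho : forall i j, i != j -> ip (e i) (e j) = 0.
Hypothesis e_norm : forall j, ip (e j) (e j) = 1 \/ ip (e j) (e j) = 0.

Let dist (f : V) (c : nat -> R) J := ip (f - \sum_(j < J) c j *: e j) (f - \sum_(j < J) c j *: e j).

Let distE (f : V) (c : nat -> R) J : dist f c J = ip f f + \sum_(j < J)
  (c j ^+ 2 * ip (e j) (e j) - 2 * (c j * ip f (e j))).
Proof.
rewrite /dist; set P := \sum_(j < J) _.
have ips g : ip g P = \sum_(j < J) c j * ip g (e j).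
  rewrite /P; elim/big_rec2 : _ => [|i x y _ <-]; last by rewrite ipDr ipZr.
  by rewrite -(scale0r 0) ipZr mul0r.
have ePP : ip P P = \sum_(j < J) c j ^+ 2 * ip (e j) (e j).
  rewrite ips; apply: eq_bigr => i _.
  rewrite ipC ips (bigD1 i)//= big1 ?addr0 ?expr2 ?mulrA// => j ji.
  by rewrite e_ortho ?mulr0// eq_sym.
rewrite sumrB -mulr_sumr -ips -ePP !ipE (ipC P f); ring.
Qed.

Let e_ortho0 f j : ip (e j) (e j) = 0 -> ip f (e j) = 0.
Proof.
move=> e0; have := ip_CS f (e j); rewrite e0 mulr0 => h.
by apply/eqP; rewrite -sqrf_eq0 eq_le h sqr_ge0.
Qed.

Lemma bessel (f : V) J : \sum_(j < J) ip f (e j) ^+ 2 <= ip f f.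
Proof.
have := ip_ge0 (f - \sum_(j < J) ip f (e j) *: e j).
rewrite -/(dist f (fun j => ip f (e j)) J) distE.
rewrite (eq_bigr (fun j : 'I_J => - ip f (e j) ^+ 2)) ?sumrN ?subr_ge0// => j _.
by have [->|e0] := e_norm j; [|rewrite e0 e_ortho0//]; ring.
Qed.

(** Completing squares: the Fourier coefficients give the best approximation by the first [J]
    vectors, so any approximant, with arbitrary [c], bounds the defect in Bessel's inequality. This
    is how density of the span becomes Parseval's identity. *)
Lemma bessel_best (f : V) (c : nat -> R) J : ip f f <= \sum_(j < J) ip f (e j) ^+ 2 +
  ip (f - \sum_(j < J) c j *: e j) (f - \sum_(j < J) c j *: e j).
Proof.
rewrite -/(dist f c J) distE addrCA lerDl -big_split/=; apply: sumr_ge0 => j _.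
have [e1|e0] := e_norm j; last by rewrite e0 e_ortho0// !mulr0 expr0n/= subr0 addr0.
have -> : ip f (e j) ^+ 2 + (c j ^+ 2 * ip (e j) (e j) - 2 * (c j * ip f (e j))) =
  (c j - ip f (e j)) ^+ 2 by rewrite e1; ring.
exact: sqr_ge0.
Qed.

End orthonormal.
End hilbert.

(** * Square-integrable functions *)

Section integrable_real.
Context d (X : measurableType d) {R : realType} (m : {measure set X -> \bar R}).
Implicit Types f g h : X -> R.

Definition intg f := m.-integrable [set: X] (EFin \o f).

Lemma intg_meas f : intg f -> measurable_fun setT f.
Proof. by move=> /measurable_int /measurable_EFinP. Qed.

Lemma intgD f g : intg f -> intg g -> intg (fun x => f x + g x).
Proof. exact: integrableD. Qed.

Lemma intgZ a f : intg f -> intg (fun x => a * f x).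
Proof. exact: (@integrableZl _ _ _ m setT measurableT a (EFin \o f)). Qed.

Lemma intgN f : intg f -> intg (fun x => - f x).
Proof. exact: (@integrableN _ _ _ m setT (EFin \o f)). Qed.

Lemma intgB f g : intg f -> intg g -> intg (fun x => f x - g x).
Proof. by move=> If Ig; apply: intgD => //; exact: intgN. Qed.

Lemma intg_norm f : intg f -> intg (fun x => `|f x|).
Proof. exact: integrable_norm. Qed.

Lemma le_intg f g : measurable_fun setT f -> (forall x, `|f x| <= g x) ->
  intg g -> intg f.
Proof.
move=> mf fg; apply: le_integrable => //; first exact/measurable_EFinP.
by move=> x _; rewrite /= lee_fin (le_trans (fg x))// ler_norm.
Qed.

Lemma intg_bddM h f C : measurable_fun setT h -> (forall x, `|h x| <= C) ->
  intg f -> intg (fun x => h x * f x).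
Proof.
move=> mh hC If; apply: (@le_intg _ (fun x => C * `|f x|)).
- by apply: measurable_funM => //; exact: intg_meas.
- by move=> x; rewrite normrM ler_wpM2r.
- by apply: intgZ; exact: intg_norm.
Qed.

Lemma intg0 : intg (fun=> 0).
Proof. exact: integrable0. Qed.

Lemma intg_sum I (r : seq I) (F : I -> X -> R) : (forall i, intg (F i)) ->
  intg (fun x => \sum_(i <- r) F i x).
Proof.
move=> IF; elim: r => [|a r IH].
  by under eq_fun do rewrite big_nil; exact: intg0.
by under eq_fun do rewrite big_cons; exact: intgD.
Qed.

Lemma Rint_sum I (r : seq I) (F : I -> X -> R) : (forall i, intg (F i)) ->
  \int[m]_x (\sum_(i <- r) F i x) = \sum_(i <- r) \int[m]_x F i x.
Proof.
move=> IF; elim: r => [|a r IH].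
  rewrite big_nil; under eq_Rintegral do rewrite big_nil.
  by rewrite /Rintegral integral0.
rewrite big_cons -IH; under eq_Rintegral do rewrite big_cons.
by rewrite RintegralD//; [exact: IF|exact: intg_sum].
Qed.

Lemma ae_eq_Rint f g : measurable_fun setT f -> measurable_fun setT g ->
  {ae m, forall x, f x = g x} -> \int[m]_x f x = \int[m]_x g x.
Proof.
move=> mf mg fg; congr fine; apply: ae_eq_integral => //.
- exact/measurable_EFinP.
- exact/measurable_EFinP.
- by apply: filterS fg => x /= -> _.
Qed.

Lemma ae_eq_intg f g : measurable_fun setT g ->
  {ae m, forall x, f x = g x} -> intg f -> intg g.
Proof.
move=> mg fg If; apply/integrableP; split; first exact/measurable_EFinP.
have /integrableP[mf] := If; apply: le_lt_trans.
rewrite le_eqVlt; apply/orP; left; apply/eqP; apply: ae_eq_integral => //.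
- by apply: measurableT_comp => //; exact/measurable_EFinP.
- exact: measurableT_comp.
- by apply: filterS fg => x /= -> _.
Qed.

Lemma Rint_eq0_ae f : intg f -> (forall x, 0 <= f x) -> \int[m]_x f x = 0 ->
  {ae m, forall x, f x = 0}.
Proof.
move=> If f0 If0.
have : (\int[m]_x `|(f x)%:E| = 0)%E.
  under eq_integral => x _ do rewrite gee0_abs ?lee_fin//.
  have := integrable_fin_num measurableT If.
  by rewrite /Rintegral in If0; move/fineK => <-; rewrite If0.
move/ae_eq_integral_abs => /(_ measurableT) h.
have := h (measurable_int m If).
by apply: filterS => x /(_ I) [].
Qed.

Lemma ae_le_Rint f g : intg f -> intg g -> {ae m, forall x, f x <= g x} ->
  \int[m]_x f x <= \int[m]_x g x.
Proof.
move=> If Ig fg.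
have -> : \int[m]_x f x = \int[m]_x Num.min (f x) (g x).
  apply: ae_eq_Rint; first exact: intg_meas.
    by apply: measurable_minr; exact: intg_meas.
  by apply: filterS fg => x; case: leP.
apply: le_Rintegral => //; last by move=> x _; rewrite ge_min lexx orbT.
apply: (@le_intg _ (fun x => `|f x| + `|g x|)).
- by apply: measurable_minr; exact: intg_meas.
- by move=> x; case: (leP (f x) (g x)) => _; rewrite ?lerDl ?lerDr.
- by apply: intgD; exact: intg_norm.
Qed.

Lemma ae_le_intg f g : measurable_fun setT f -> {ae m, forall x, `|f x| <= g x} ->
  intg g -> intg f.
Proof.
move=> mf fg Ig; apply/integrableP; split; first exact/measurable_EFinP.
have /integrableP[mg] := Ig; apply: le_lt_trans.
apply: ae_ge0_le_integral => //.
- by apply: measurableT_comp => //; exact/measurable_EFinP.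
- by apply: measurableT_comp.
- by apply: filterS fg => x fgx _; rewrite /= lee_fin (le_trans fgx)// ler_norm.
Qed.

Lemma Rint_DCT (f_ : nat -> X -> R) f g :
  (forall n, measurable_fun setT (f_ n)) -> measurable_fun setT f ->
  {ae m, forall x, f_ n x @[n --> \oo] --> f x} ->
  intg g -> {ae m, forall x n, `|f_ n x| <= g x} ->
  \int[m]_x f_ n x @[n --> \oo] --> \int[m]_x f x.
Proof.
move=> mf_ mf ff Ig fg.
have [|||||If _ cv] := @dominated_convergence _ _ _ m setT measurableT
  (fun n => EFin \o f_ n) (EFin \o f) (EFin \o g).
- by move=> n; exact/measurable_EFinP.
- exact/measurable_EFinP.
- by apply: filterS ff => x fx _; apply/fine_cvgP; split => //; exact: nearW.
- exact: Ig.
- by apply: filterS fg => x fx n _; rewrite /= lee_fin.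
apply: fine_cvg; move: cv => /=; rewrite fineK//.
exact: integrable_fin_num.
Qed.

End integrable_real.
Arguments intg {d X R} m f.

Section integrable_finite.
Context d (X : measurableType d) {R : realType} (m : {finite_measure set X -> \bar R}).
Implicit Types f : X -> R.

Lemma intg_cst c : intg m (fun=> c).
Proof. exact: finite_measure_integrable_cst. Qed.

Lemma intg_bdd f C : measurable_fun setT f -> (forall x, `|f x| <= C) -> intg m f.
Proof. by move=> mf fC; apply: (le_intg mf fC); exact: intg_cst. Qed.

End integrable_finite.

Section square_integrable.
Context d (X : measurableType d) {R : realType} (m : {finite_measure set X -> \bar R}).
Implicit Types f g h : X -> R.

Definition sqint f := measurable_fun [set: X] f /\ intg m (fun x => f x ^+ 2).

Lemma sqintP f : f \in Lfun m 2%:E <-> sqint f.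
Proof.
split=> [f2|[mf /integrableP[_ f2]]].
  split; last exact: Lfun2_integrable_sqr.
  by have := sub_Lfun_mfun f2; rewrite inE.
apply/andP; split; rewrite inE//= /finite_norm unlock poweR_lty//.
apply: le_lt_trans f2; rewrite le_eqVlt; apply/orP; left; apply/eqP.
by apply: eq_integral => x _ /=; rewrite powR_mulrn// -normrX.
Qed.

Lemma sqint_meas f : sqint f -> measurable_fun setT f. Proof. by case. Qed.

Lemma sqint_sqr f : sqint f -> intg m (fun x => f x ^+ 2). Proof. by case. Qed.

Lemma intgM f g : sqint f -> sqint g -> intg m (fun x => f x * g x).
Proof.
move=> [mf f2] [mg g2].
apply: (@le_intg _ _ _ _ _ (fun x => f x ^+ 2 + g x ^+ 2)).
- exact: measurable_funM.
- move=> x; rewrite ler_norml; have := sqr_ge0 (f x - g x); have := sqr_ge0 (f x + g x).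
  by rewrite sqrrD sqrrB !mulr2n; have := sqr_ge0 (f x); have := sqr_ge0 (g x); lra.
- exact: intgD.
Qed.

Lemma sqintD f g : sqint f -> sqint g -> sqint (fun x => f x + g x).
Proof.
move=> f2 g2; split; first exact: measurable_funD (sqint_meas f2) (sqint_meas g2).
under eq_fun do rewrite sqrrD mulr2n.
apply: intgD; last exact: sqint_sqr.
apply: intgD; first exact: sqint_sqr.
by apply: intgD; exact: intgM.
Qed.

Lemma sqint_bddM h f C : measurable_fun setT h -> (forall x, `|h x| <= C) ->
  sqint f -> sqint (fun x => h x * f x).
Proof.
move=> mh hC [mf f2]; split; first exact: measurable_funM.
under eq_fun do rewrite exprMn.
apply: (@intg_bddM _ _ _ _ _ _ (C ^+ 2)) => //; first exact: measurable_funX.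
by move=> x; rewrite normrX ler_sqr ?nnegrE// (le_trans _ (hC x)).
Qed.

Lemma sqintZ a f : sqint f -> sqint (fun x => a * f x).
Proof. exact: (@sqint_bddM (fun=> a) _ `|a|). Qed.

Lemma sqintN f : sqint f -> sqint (fun x => - f x).
Proof. by move=> f2; under eq_fun do rewrite -mulN1r; exact: sqintZ. Qed.

Lemma sqintB f g : sqint f -> sqint g -> sqint (fun x => f x - g x).
Proof. by move=> f2 g2; apply: sqintD => //; exact: sqintN. Qed.

Lemma sqint_bdd f C : measurable_fun setT f -> (forall x, `|f x| <= C) -> sqint f.
Proof.
move=> mf fC; split => //; apply: (@intg_bdd _ _ _ _ _ (C ^+ 2)).
  exact: measurable_funX.
by move=> x; rewrite normrX ler_sqr ?nnegrE// (le_trans _ (fC x)).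
Qed.

Lemma sqint_cst c : sqint (fun=> c).
Proof. exact: (@sqint_bdd _ `|c|). Qed.

Lemma sqint_intg f : sqint f -> intg m f.
Proof.
move=> f2; have := intgM f2 (sqint_cst 1).
by under eq_fun do rewrite mulr1.
Qed.

Lemma ae_eq_sqint f g : measurable_fun setT g -> {ae m, forall x, f x = g x} ->
  sqint f -> sqint g.
Proof.
move=> mg fg [mf f2]; split => //; apply: ae_eq_intg f2.
  exact: measurable_funX.
by apply: filterS fg => x ->.
Qed.

Lemma Rint_sqrD f g : sqint f -> sqint g ->
  \int[m]_x ((f x + g x) ^+ 2) =
  \int[m]_x (f x ^+ 2) + 2 * \int[m]_x (f x * g x) + \int[m]_x (g x ^+ 2).
Proof.
move=> f2 g2; under eq_Rintegral do rewrite sqrrD mulr2n.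
have fg := intgM f2 g2.
rewrite RintegralD//; [|apply: intgD; [exact: sqint_sqr|exact: intgD]|exact: sqint_sqr].
rewrite RintegralD//; [|exact: sqint_sqr|exact: intgD].
by rewrite RintegralD//; ring.
Qed.

Lemma Rint_sqrB f g : sqint f -> sqint g ->
  \int[m]_x ((f x - g x) ^+ 2) =
  \int[m]_x (f x ^+ 2) - 2 * \int[m]_x (f x * g x) + \int[m]_x (g x ^+ 2).
Proof.
move=> f2 g2; rewrite Rint_sqrD//; last exact: sqintN.
under [X in _ + 2 * X]eq_Rintegral do rewrite mulrN -mulN1r.
rewrite RintegralZl//; last exact: intgM.
by under [X in _ + X]eq_Rintegral do rewrite sqrrN; ring.
Qed.

Lemma Rint_sqr_ge0 f : 0 <= \int[m]_x (f x ^+ 2).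
Proof. by apply: Rintegral_ge0 => x _; exact: sqr_ge0. Qed.

Lemma Rint_sqr_eq0 f : sqint f -> \int[m]_x (f x ^+ 2) = 0 -> {ae m, forall x, f x = 0}.
Proof.
move=> f2 f0; have := Rint_eq0_ae (sqint_sqr f2) (fun x => sqr_ge0 (f x)) f0.
by apply: filterS => x /eqP; rewrite sqrf_eq0 => /eqP.
Qed.

Let V := LfunType m (lee1n 2).

Definition L2ip (f g : V) : R := \int[m]_x (f x * g x).

Lemma LfunType_sqint (f : V) : sqint f.
Proof. by apply/sqintP; exact: LfunP. Qed.
Local Hint Resolve LfunType_sqint : core.

Definition L2of f (f2 : sqint f) : V := Lfun_Sub (lee1n 2) (proj2 (sqintP f) f2).

Lemma L2ipC (f g : V) : L2ip f g = L2ip g f.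
Proof. by apply: eq_Rintegral => x _; rewrite mulrC. Qed.

Lemma L2ipDl (f g h : V) : L2ip (f + g) h = L2ip f h + L2ip g h.
Proof.
rewrite /L2ip -RintegralD//; [|exact: intgM..].
by apply: eq_Rintegral => x _; rewrite -mulrDl.
Qed.

Lemma L2ipZl a (f g : V) : L2ip (a *: f) g = a * L2ip f g.
Proof.
rewrite /L2ip -RintegralZl//; last exact: intgM.
by apply: eq_Rintegral => x _; rewrite mulrA.
Qed.

Lemma L2ip_ge0 (f : V) : 0 <= L2ip f f.
Proof. by apply: Rintegral_ge0 => x _; rewrite -expr2 sqr_ge0. Qed.

End square_integrable.

(** * Completeness of L^2 *)

Section completeness.
Context d (X : measurableType d) {R : realType} (m : {finite_measure set X -> \bar R}).

Lemma cvg_expn (a : R) : 1 < a -> a ^- n @[n --> \oo] --> 0.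
Proof.
move=> a1; under eq_fun do rewrite -exprVn.
have a0 : 0 < a by exact: lt_trans a1.
by apply: cvg_expr; rewrite ger0_norm ?invr_ge0 ?ltW// invf_lt1.
Qed.

(** Riesz-Fischer: along a subsequence the increments are summable in L^1, hence it converges almost
    everywhere, and Fatou's lemma shows that the limit is also the limit in L^2. *)
Lemma sqint_complete (u : nat -> X -> R) : (forall n, sqint m (u n)) ->
  (forall e : R, 0 < e -> exists n0, forall i j, (n0 <= i)%N -> (n0 <= j)%N ->
     \int[m]_x ((u i x - u j x) ^+ 2) < e) ->
  exists2 v, sqint m v & \int[m]_x ((u n x - v x) ^+ 2) @[n --> \oo] --> 0.
Proof.
move=> u2 uC.
have p4 k : 0 < 4 ^- k :> R by rewrite invr_gt0 exprn_gt0.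
have p2 k : 0 < 2 ^- k :> R by rewrite invr_gt0 exprn_gt0.
have /choice[N NP] : forall k : nat, exists n0, forall i j, (n0 <= i)%N -> (n0 <= j)%N ->
     \int[m]_x ((u i x - u j x) ^+ 2) < 4 ^- k by move=> k; exact: uC.
(* The maximum over [i <= k] makes every [p n] with [n >= k] at least [N k]. *)
pose p k := (\max_(i < k.+1) N i)%N.
have Np k n : (k <= n)%N -> (N k <= p n)%N.
  by move=> kn; apply: (@leq_bigmax _ (fun i : 'I_n.+1 => N i) (Ordinal (kn : (k < n.+1)%N))).
pose w k := u (p k).
have w2 k : sqint m (w k) by exact: u2.
have wC k n : (k <= n)%N -> \int[m]_x ((w k x - w n x) ^+ 2) < 4 ^- k.
  by move=> kn; apply: NP; exact: Np.
have mw k : measurable_fun setT (w k) by exact: sqint_meas (w2 k).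
pose dw k x := `|w k x - w k.+1 x|.
have mdw k : measurable_fun setT (dw k).
  by apply: measurableT_comp => //; exact: measurable_funB.
have Idw k : intg m (dw k) by apply: intg_norm; apply: intgB; apply: sqint_intg.
pose C : R := 1 + fine (m setT).
have idw k : \int[m]_x dw k x <= C * 2 ^- k.
  (* Young's inequality with the factor [2^k] turns the bound [4^-k] on the integrated square into a
     bound of order [2^-k] on the integral. *)
  have h x : dw k x <= 2 ^+ k * (w k x - w k.+1 x) ^+ 2 + 2 ^- k.
    rewrite -[X in 2 ^+ k * X]ger0_norm ?sqr_ge0// normrX -/(dw k x).
    have d0 : 0 <= dw k x by exact: normr_ge0.
    have a0 : 0 < 2 ^+ k :> R by rewrite exprn_gt0.
    have -> : 2 ^+ k * dw k x ^+ 2 + 2 ^- k =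
       2 ^- k * ((2 ^+ k * dw k x) ^+ 2 + 1) by field; rewrite gt_eqF.
    rewrite ler_pdivlMl//; move: (_ * _) => y; have := sqr_ge0 (y - 1); nra.
  apply: le_trans.
    apply: (le_Rintegral _ (Idw k) _ (fun x _ => h x)) => //.
    by apply: intgD; [apply: intgZ; exact: sqint_sqr (sqintB (w2 _) (w2 _))|exact: intg_cst].
  rewrite RintegralD//; [|apply: intgZ; exact: sqint_sqr (sqintB (w2 _) (w2 _))|exact: intg_cst].
  rewrite RintegralZl//; last exact: sqint_sqr (sqintB (w2 _) (w2 _)).
  rewrite Rintegral_cst// /C mulrDl mul1r [X in _ + X <= _]mulrC lerD//.
  rewrite -ler_pdivlMl ?exprn_gt0// -invfM -exprMn -natrM.
  by apply: ltW; exact: wC.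
have C0 : 0 <= C by rewrite addr_ge0// fine_ge0.
pose S x : \bar R := (\sum_(k <oo) (dw k x)%:E)%E.
have dw0 k x : (0 <= (dw k x)%:E)%E by rewrite lee_fin normr_ge0.
have mS : measurable_fun setT S.
  apply: (@ge0_emeasurable_sum _ _ _ _ (fun k x => (dw k x)%:E) xpredT).
    by move=> k x _ _; exact: dw0.
  by move=> k _; exact/measurable_EFinP.
have S0 x : (0 <= S x)%E by apply: nneseries_ge0 => k _ _; exact: dw0.
have IS : m.-integrable setT S.
  apply/integrableP; split => //; apply: (@le_lt_trans _ _ (2 * C)%:E); last exact: ltry.
  under eq_integral => x _ do rewrite gee0_abs//.
  rewrite integral_nneseries//; last by move=> k; exact/measurable_EFinP.
  apply: lime_le; first by apply: is_cvg_nneseries => k _ _; exact: integral_ge0.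
  apply: nearW => n; apply: (@le_trans _ _ (2 * C - 2 * C * 2 ^- n)%:E).
    elim: n => [|n IH]; first by rewrite big_geq// expr0 invr1 mulr1 subrr.
    rewrite big_nat_recr//=; apply: le_trans (leeD2r _ IH) _.
    rewrite -(fineK (integrable_fin_num measurableT (Idw n))) -EFinD lee_fin.
    have := idw n; rewrite /Rintegral exprS invfM; lra.
  by rewrite lee_fin lerBlDr lerDl !mulr_ge0// ltW.
pose A := [set x | (S x < +oo)%E].
have mA : measurable A by rewrite -[A]setTI; exact: emeasurable_fun_infty_o.
have aeA : {ae m, forall x, A x}.
  have := integrable_ae measurableT IS; apply: filterS => x /(_ Logic.I).
  by rewrite ge0_fin_numE.
(* Cutting off to the set where the series of increments is finite makes the sequence converge at
   every point, so that its limit is measurable. *)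
pose g k x := w k x * \1_A x.
have mg k : measurable_fun setT (g k) by apply: measurable_funM.
have gw k : {ae m, forall x, w k x = g k x}.
  by apply: filterS aeA => x Ax; rewrite /g indicE mem_set// mulr1.
have cvg_g x : cvgn (g ^~ x).
  have [Ax|nAx] := pselect (A x); last first.
    rewrite (_ : g ^~ x = cst 0); first exact: is_cvg_cst.
    by apply/funext => k; rewrite /g indicE memNset// mulr0.
  have gS : g ^~ x = (fun n => w 0%N x + series (fun k => w k.+1 x - w k x) n).
    apply/funext => n; rewrite /g indicE mem_set// mulr1 /series/= telescope_sumr//.
    by rewrite addrC subrK.
  rewrite gS; apply: is_cvgD; first exact: is_cvg_cst.
  apply: normed_cvg; apply: nondecreasing_is_cvgn.
    by apply: nondecreasing_series => k _ _; exact: normr_ge0.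
  exists (fine (S x)) => _ [n _ <-] /=.
  rewrite -lee_fin fineK ?ge0_fin_numE//.
  apply: le_trans (nneseries_lim_ge n _); last by move=> k _ _; exact: dw0.
  rewrite /series/= -sumEFin lee_sum// => k _.
  by rewrite lee_fin /dw distrC.
pose v x := limn (g ^~ x).
have gv x : g n x @[n --> \oo] --> v x by exact: cvg_g.
have mv : measurable_fun setT v by apply: (@measurable_fun_cvg _ _ _ setT g) => // x _.
have g2 k : sqint m (g k) by apply: ae_eq_sqint (gw k) (w2 k).
(* Fatou along the shifted sequence [g (n + k)], all of whose terms are within [4^-k] of [g k]. *)
have fat k : (\int[m]_x ((g k x - v x) ^+ 2)%:E <= (4 ^- k)%:E)%E.
  have cv x : ((g k x - g (n + k)%N x) ^+ 2)%:E @[n --> \oo] --> ((g k x - v x) ^+ 2)%:E.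
    apply/fine_cvgP; split; first exact: nearW.
    have h : (g k x - g (n + k)%N x) @[n --> \oo] --> g k x - v x.
      apply: cvgB; first exact: cvg_cst.
      by have := gv x; rewrite -(cvg_shiftn k).
    by under eq_fun do rewrite /= expr2; rewrite /= expr2; exact: cvgM.
  rewrite (_ : \int[m]_x _ = \int[m]_x
     limn_einf (fun n => ((g k x - g (n + k)%N x) ^+ 2)%:E))%E; last first.
    apply: eq_integral => x _; rewrite is_cvg_limn_einfE.
      by apply/esym/cvg_lim.
    by apply/cvg_ex; eexists; exact: cv.
  apply: le_trans; first apply: fatou => //.
  - by move=> n; apply/measurable_EFinP; apply: measurable_funX; exact: measurable_funB.
  - by move=> n x _; rewrite lee_fin sqr_ge0.
  rewrite limn_einf_lim; apply: lime_le; first exact: is_cvg_einfs.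
  apply: nearW => n; apply: (@ereal_inf_le _ _ _).
  exists (\int[m]_x ((g k x - g (n + k)%N x) ^+ 2)%:E)%E; first by exists n => /=.
  rewrite -(fineK (integrable_fin_num measurableT (sqint_sqr (sqintB (g2 k) (g2 _))))).
  rewrite lee_fin; apply: le_trans (ltW (wC k (n + k)%N (leq_addl _ _))).
  rewrite le_eqVlt; apply/orP; left; apply/eqP; apply: ae_eq_Rint.
  - by apply: measurable_funX; exact: measurable_funB.
  - by apply: measurable_funX; exact: measurable_funB.
  - by apply: filterS2 (gw k) (gw (n + k)%N) => x -> ->.
have gv2 k : sqint m (fun x => g k x - v x).
  split; first exact: measurable_funB.
  apply/integrableP; split.
    by apply/measurable_EFinP; apply: measurable_funX; exact: measurable_funB.
  under eq_integral => x _ do rewrite gee0_abs ?lee_fin ?sqr_ge0//.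
  by apply: le_lt_trans (fat k) _; rewrite ltry.
have v2 : sqint m v.
  have := sqintB (g2 0%N) (gv2 0%N).
  by under eq_fun do rewrite opprB addrC subrK.
exists v => //; apply/cvgrPdist_lt => e e0.
have [k _ kP] : \forall k \near \oo, 4 * 4 ^- k < e.
  have := cvg_expn (_ : 1 < 4 :> R) => /(_ _)/cvgrPdist_lt h.
  have [||k _ kP] := h _ (e / 4); [by lra|by lra|].
  exists k => // n kn; have := kP _ kn; rewrite /= sub0r normrN ger0_norm; last exact: ltW.
  by move: (4 ^- n) => t; lra.
exists (N k) => // n Nn; rewrite /= sub0r normrN ger0_norm ?Rint_sqr_ge0//.
have uw : \int[m]_x ((u n x - w k x) ^+ 2) < 4 ^- k by apply: NP => //; exact: Np.
have wv : \int[m]_x ((w k x - v x) ^+ 2) <= 4 ^- k.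
  rewrite -lee_fin; apply: le_trans (fat k).
  rewrite (fineK (integrable_fin_num measurableT (sqint_sqr (sqintB (w2 k) v2)))).
  rewrite le_eqVlt; apply/orP; left; apply/eqP; apply: ae_eq_integral => //.
  - by apply/measurable_EFinP; apply: measurable_funX; exact: measurable_funB.
  - by apply/measurable_EFinP; apply: measurable_funX; exact: measurable_funB.
  - by apply: filterS (gw k) => x /= -> _.
apply: le_lt_trans (kP k (leqnn k)).
have I1 := sqint_sqr (sqintB (u2 n) (w2 k)).
have I2 := sqint_sqr (sqintB (w2 k) v2).
apply: (@le_trans _ _ (\int[m]_x (2 * (u n x - w k x) ^+ 2 + 2 * (w k x - v x) ^+ 2))).
  apply: le_Rintegral => //.
  - exact: sqint_sqr (sqintB (u2 n) v2).
  - by apply: intgD; exact: intgZ.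
  - move=> x _; move: (u n x) (w k x) (v x) => a b c.
    have := sqr_ge0 ((a - b) - (b - c)); nra.
rewrite RintegralD//; [|exact: intgZ..].
by rewrite !RintegralZl//; lra.
Qed.

Lemma LfunType2_complete (u : nat -> LfunType m (lee1n 2)) :
  (forall e : R, 0 < e -> exists n0, forall i j, (n0 <= i)%N -> (n0 <= j)%N ->
     L2ip (u i - u j) (u i - u j) < e) ->
  exists v, L2ip (u n - v) (u n - v) @[n --> \oo] --> 0.
Proof.
have E i v : L2ip (u i - v) (u i - v) = \int[m]_x ((u i x - v x) ^+ 2).
  by apply: eq_Rintegral => x _; rewrite expr2.
move=> uC; have [||v v2 uv] := @sqint_complete (fun n => u n).
- by move=> n; exact: LfunType_sqint.
- move=> e /uC[n0 nP]; exists n0 => i j i0 j0.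
  by rewrite -(E i (u j)); exact: nP.
exists (L2of v2); apply: cvg_trans uv; apply: near_eq_cvg; apply: nearW => n.
by rewrite E.
Qed.

End completeness.

Lemma measurable_ltR d (X : measurableType d) (R : realType) (f g : X -> R) :
  measurable_fun setT f -> measurable_fun setT g ->
  measurable_fun setT (fun x => (f x < g x)%R%:R : R).
Proof.
move=> mf mg; have -> : (fun x => (f x < g x)%R%:R : R) =
    (fun x => if f x < g x then 1 else 0).
  by apply/funext => x; case: ifP.
by apply: measurable_fun_ifT => //; exact: measurable_fun_ltr.
Qed.

(** * Functions with vanishing integrals over a generating pi-system *)

Section pi_system.
Context d (X : measurableType d) {R : realType} (m : {finite_measure set X -> \bar R}).

Lemma Rint_indic (f : X -> R) A : measurable A ->
  \int[m]_x (f x * \1_A x) = \int[m]_(x in A) f x.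
Proof.
move=> mA; rewrite [RHS]Rintegral_mkcond; apply: eq_Rintegral => x _.
by rewrite patchE indicE; case: ifPn => _; rewrite ?mulr1 ?mulr0.
Qed.

(** The sets over which [f] integrates to 0 are stable under complement, because the total integral
    is 0, and under countable disjoint union; Dynkin's theorem extends them to all measurable
    sets. *)
Lemma ae_eq0_pi_system (G : set (set X)) (f : X -> R) :
  @measurable _ X = <<s G >> -> setI_closed G -> intg m f ->
  \int[m]_x f x = 0 -> (forall A, G A -> \int[m]_(x in A) f x = 0) ->
  {ae m, forall x, f x = 0}.
Proof.
move=> GE GI If f0 fG.
have mf := intg_meas If.
have IA A : measurable A -> m.-integrable A (EFin \o f).
  by move=> mA; apply: integrableS If.
have all0 A : measurable A -> \int[m]_(x in A) f x = 0.
  rewrite GE.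
  move: A; apply: (@dynkin_induction _ _ G (fun A => \int[m]_(x in A) f x = 0)) => //.
    move=> S mS S0; have := f0; rewrite -(setvU S) Rintegral_setU//.
    - by rewrite S0 addr0.
    - exact: measurableC.
    - by rewrite setvU.
    - by apply/disj_setPS; rewrite setICl.
  move=> F mF tF F0; rewrite /Rintegral integral_bigcup//; last first.
    by apply: IA; exact: bigcup_measurable.
  rewrite eseries0// => k _ _.
  by rewrite -[X in X = _]fineK ?integrable_fin_num//; [|exact: IA]; rewrite [fine _]F0.
have : ae_eq m setT (EFin \o f) (cst 0%E).
  apply: integral_ae_eq => // E _ mE; rewrite integral0.
  by rewrite -[LHS]fineK ?integrable_fin_num//; [|exact: IA]; rewrite [fine _]all0.
by apply: filterS => x /(_ Logic.I) [].
Qed.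

End pi_system.

(** * Fubini's theorem for real-valued integrals *)

Section fubini_real.
Context d1 d2 (X : measurableType d1) (Y : measurableType d2) {R : realType}.
Variables (m1 : {finite_measure set X -> \bar R}) (m2 : {finite_measure set Y -> \bar R}).
Implicit Types f : X * Y -> R.

Lemma measurable_secl f x : measurable_fun setT f -> measurable_fun setT (fun y => f (x, y)).
Proof. by move=> mf; exact: measurableT_comp. Qed.

Lemma ae_intgl f : intg (m1 \x m2)%E f -> {ae m1, forall x, intg m2 (fun y => f (x, y))}.
Proof. exact: ae_integrable1. Qed.

Lemma ae_intgr f : intg (m1 \x m2)%E f -> {ae m2, forall y, intg m1 (fun x => f (x, y))}.
Proof. exact: ae_integrable2. Qed.

(** The real-valued inner integral differs from the extended one only where the latter is infinite,
    and that set is null. *)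
Lemma intg_Rfubini1 f : intg (m1 \x m2)%E f -> intg m1 (fun x => \int[m2]_y f (x, y)).
Proof.
move=> If; have IF := integrable_fubini_F If.
apply/integrableP; split.
  apply/measurable_EFinP; apply: (measurableT_comp (fine_measurable measurableT)).
  exact: measurable_int IF.
have /integrableP[mF] := IF; apply: le_lt_trans.
apply: ae_ge0_le_integral => //.
- apply: measurableT_comp => //; apply/measurable_EFinP.
  apply: (measurableT_comp (fine_measurable measurableT)).
  exact: measurable_int IF.
- exact: measurableT_comp.
- apply: filterS (integrable_ae measurableT IF) => x /(_ Logic.I) Fx _.
  by rewrite -[X in (_ <= `|X|)%E](fineK Fx).
Qed.

Lemma Rfubini1 f : intg (m1 \x m2)%E f ->
  \int[(m1 \x m2)%E]_p f p = \int[m1]_x \int[m2]_y f (x, y).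
Proof.
move=> If; rewrite /Rintegral -integral12_prod_meas1//; congr fine.
have IF := integrable_fubini_F If.
apply: ae_eq_integral => //.
- exact: measurable_int IF.
- apply/measurable_EFinP; apply: (measurableT_comp (fine_measurable measurableT)).
  exact: measurable_int IF.
- apply: filterS (integrable_ae measurableT IF) => x /(_ Logic.I) Fx _.
  by rewrite /= /Rintegral fineK.
Qed.

Lemma Rfubini2 f : intg (m1 \x m2)%E f ->
  \int[(m1 \x m2)%E]_p f p = \int[m2]_y \int[m1]_x f (x, y).
Proof.
move=> If; rewrite /Rintegral -integral21_prod_meas1//; congr fine.
have mG := measurable_fubini_G If.
apply: ae_eq_integral => //.
- apply/measurable_EFinP; exact: (measurableT_comp (fine_measurable measurableT)).
- apply: filterS (ae_intgr If) => y Iy _.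
  by rewrite /= /Rintegral fineK//; exact: integrable_fin_num Iy.
Qed.

Lemma intg_tensor (f : X -> R) (g : Y -> R) : intg m1 f -> intg m2 g ->
  intg (m1 \x m2)%E (fun p => f p.1 * g p.2).
Proof.
move=> If Ig; apply/integrable12ltyP => /=.
  apply/measurable_EFinP; apply: measurable_funM.
    by apply: measurableT_comp => //; exact: intg_meas If.
  by apply: measurableT_comp => //; exact: intg_meas Ig.
have -> : (\int[m1]_x \int[m2]_y `|(f x * g y)%:E| =
    \int[m1]_x (`|f x|%:E * \int[m2]_y `|(g y)%:E|))%E.
  apply: eq_integral => x _; under eq_integral do rewrite EFinM abseM.
  rewrite ge0_integralZl//=.
  by apply/measurable_EFinP; apply: measurableT_comp => //; exact: intg_meas Ig.
have /integrableP[_ foo] := If; have /integrableP[_ goo] := Ig.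
rewrite ge0_integralZr//=.
- by rewrite lte_mul_pinfty// ?integral_ge0// ge0_fin_numE ?integral_ge0.
- by apply/measurable_EFinP; apply: measurableT_comp => //; exact: intg_meas If.
- exact: integral_ge0.
Qed.

End fubini_real.

(** * Primitives in time *)

Section time.
Context {R : realType} (T : R).
Variable time : {finite_measure set (measurableTypeR R) -> \bar R}.
Hypothesis timeE : forall A, time A = lebesgue_measure (A `&` `[0, T[%classic).
Local Notation RR := (measurableTypeR R * measurableTypeR R)%type.
Local Notation K s t := ((s < t)%R%:R : R).

#[local] Instance ae_time_filter : Filter (nbhs (almost_everywhere time)).
Proof. exact: ae_filter_ringOfSetsType. Qed.

Lemma ae_time : {ae time, forall t, (0 <= t) && (t < T)}.
Proof.
exists (~` `[0, T[%classic); split.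
- by apply: measurableC; exact: measurable_itv.
- by rewrite timeE setICl measure0.
- by move=> t; apply: contra_not; rewrite /= in_itv.
Qed.

Lemma normK (s t : R) : `|K s t| <= 1.
Proof. by case: (s < t); rewrite ?normr0// normr1. Qed.

Lemma measurable_fstR : measurable_fun setT (fun p : RR => p.1 : R).
Proof. exact: measurable_fst. Qed.

Lemma measurable_sndR : measurable_fun setT (fun p : RR => p.2 : R).
Proof. exact: measurable_snd. Qed.

Lemma Rint_time_itv s tau : 0 <= s -> tau <= T ->
  \int[time]_t (K s t * K t tau) = Num.max 0 (tau - s).
Proof.
move=> s0 tT; have mI : measurable (`]s, tau[%classic : set (measurableTypeR R)) by exact: measurable_itv.
transitivity (\int[time]_t (\1_(`]s, tau[%classic : set (measurableTypeR R)) t)).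
  apply: eq_Rintegral => t _; rewrite indicE -natrM mulnb; congr (_%:R).
  by congr nat_of_bool; apply/idP/idP; rewrite ?inE /= ?in_itv/=.
rewrite /Rintegral integral_indic// setIT.
transitivity (fine (time `]s, tau[%classic)) => //; rewrite timeE.
have -> : (`]s, tau[%classic : set R) `&` `[0, T[%classic = `]s, tau[%classic.
  apply/setIidl => t /=; rewrite !in_itv/= => /andP[st tt].
  by rewrite (ltW (le_lt_trans s0 st)) (lt_le_trans tt).
rewrite lebesgue_measure_itv/= lte_fin; case: ltP => st/=.
  by rewrite max_r// subr_ge0 ltW.
by rewrite max_l// subr_le0.
Qed.

Section primitive.
Variables (h : R -> R) (Ih : intg time h).

(** Writing the primitive from 0 with the kernel [K s t], the indicator of [s < t], makes
    measurability in [t] and every exchange of integrals an instance of Fubini's theorem. *)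
Definition prim t := \int[time]_s (K s t * h s).

Let IF2 : intg (time \x time)%E (fun p => K p.2 p.1 * h p.2).
Proof.
apply: (@intg_bddM _ _ _ _ (fun p : RR => K p.2 p.1) _ 1).
- by apply: measurable_ltR; [exact: measurable_sndR|exact: measurable_fstR].
- by move=> p; exact: normK.
- have := intg_tensor (intg_cst time 1) Ih.
  by under eq_fun do rewrite mul1r.
Qed.

Lemma intg_prim : intg time prim.
Proof. exact: intg_Rfubini1 IF2. Qed.

Lemma intgK t : intg time (fun s => K s t * h s).
Proof.
apply: (@intg_bddM _ (measurableTypeR R) _ time (fun s => K s t) h 1) => //; first exact: measurable_ltR.
by move=> s; exact: normK.
Qed.

Lemma prim_bound t : `|prim t| <= \int[time]_s `|h s|.
Proof.
apply: le_trans; first by apply: le_normr_Rintegral => //; exact: intgK.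
apply: le_Rintegral => //.
- exact: intg_norm (intgK _).
- exact: intg_norm.
- by move=> s _; rewrite normrM ler_piMl// normK.
Qed.

(** Fubini on the region [s < t < tau]: for fixed [s >= 0] the section in [t] has length
    [(tau - s)^+]. *)
Lemma Rint_prim tau : tau <= T ->
  \int[time]_t (K t tau * prim t) = \int[time]_s (h s * Num.max 0 (tau - s)).
Proof.
move=> tT; pose F (p : RR) : R := K p.1 tau * (K p.2 p.1 * h p.2).
have IF : intg (time \x time)%E F.
  apply: (@intg_bddM _ _ _ _ (fun p : RR => K p.1 tau) _ 1) IF2.
    by apply: measurable_ltR => //; exact: measurable_fstR.
  by move=> p; exact: normK.
transitivity (\int[time]_t \int[time]_s F (t, s)).
  apply: eq_Rintegral => t _; rewrite /prim -RintegralZl//; exact: intgK.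
rewrite -Rfubini1// Rfubini2//.
apply: ae_eq_Rint.
(* The inner integral is measurable as the partial integral of [F] with its two variables
   exchanged. *)
- have := @intg_Rfubini1 _ _ _ _ _ time time (fun p => F (p.2, p.1)).
  move=> /(_ _)/intg_meas; apply.
  pose G (p : RR) : R := K p.2 tau * (K p.1 p.2 * h p.1).
  rewrite -[X in intg _ X]/G.
  apply: (@intg_bddM _ _ _ _ (fun p : RR => K p.2 tau) _ 1); first last.
  + have := intg_tensor Ih (intg_cst time 1); under eq_fun do rewrite mulr1; move=> I1.
    apply: (@intg_bddM _ _ _ _ (fun p : RR => K p.1 p.2) _ 1) I1.
      by apply: measurable_ltR; [exact: measurable_fstR|exact: measurable_sndR].
    by move=> p; exact: normK.
  + by move=> p; exact: normK.
  + by apply: measurable_ltR => //; exact: measurable_sndR.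
- apply: measurable_funM; first exact: intg_meas Ih.
  by apply: measurable_maxr => //; apply: measurable_funB.
apply: filterS ae_time => s /andP[s0 _].
rewrite -(Rint_time_itv s0 tT) -RintegralZl//; last first.
  apply: (@intg_bdd _ _ _ _ _ 1).
    by apply: measurable_funM; exact: measurable_ltR.
  by move=> t; rewrite normrM mulr_ile1// normK.
by apply: eq_Rintegral => t _; rewrite /F/=; ring.
Qed.

Lemma ae_time_neq s : {ae time, forall t, t != s}.
Proof.
exists [set s]; split => //.
  apply/eqP; rewrite eq_le measure_ge0 andbT -(lebesgue_measure_set1 s).
  rewrite timeE; by apply: le_measure; rewrite ?inE//; apply: measurableI => //; exact: measurable_itv.
by move=> t /= /negP; rewrite negbK => /eqP.
Qed.

(* Symmetrise [(\int h)^2 = \int\int h(s) h(t)] over [s < t] and [t < s]. *)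
Lemma Rint_sqr_prim : (\int[time]_t h t) ^+ 2 = 2 * \int[time]_t (h t * prim t).
Proof.
pose F (p : RR) : R := h p.1 * h p.2.
have IF : intg (time \x time)%E F by exact: intg_tensor.
pose A (p : RR) : R := K p.2 p.1 * F p.
pose B (p : RR) : R := (1 - K p.2 p.1) * F p.
have mK : measurable_fun setT (fun p : RR => K p.2 p.1).
  by apply: measurable_ltR; [exact: measurable_sndR|exact: measurable_fstR].
have IA : intg (time \x time)%E A.
  by apply: (@intg_bddM _ _ _ _ (fun p : RR => K p.2 p.1) _ 1) IF => // p; exact: normK.
have IB : intg (time \x time)%E B.
  apply: (@intg_bddM _ _ _ _ (fun p : RR => 1 - K p.2 p.1) _ 1) IF => //.
    exact: measurable_funB.
  by move=> p; case: (_ < _)%R; rewrite ?subrr ?subr0 ?normr0 ?normr1.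
have E1 : \int[(time \x time)%E]_p F p = (\int[time]_t h t) ^+ 2.
  rewrite Rfubini1// /F/= expr2 -RintegralZr//; apply: eq_Rintegral => t _.
  by rewrite RintegralZl.
have E2 : \int[(time \x time)%E]_p A p = \int[time]_t (h t * prim t).
  rewrite Rfubini1// /A/F/=; apply: eq_Rintegral => t _.
  rewrite /prim -RintegralZl//; last exact: intgK.
  by apply: eq_Rintegral => s _; ring.
have E3 : \int[(time \x time)%E]_p B p = \int[time]_t (h t * prim t).
  rewrite Rfubini2// /B/F/=; apply: eq_Rintegral => s _.
  rewrite /prim -RintegralZl//; last exact: intgK.
  apply: ae_eq_Rint.
  - apply: measurable_funM; first by apply: measurable_funB => //; exact: measurable_ltR.
    by apply: measurable_funM => //; exact: intg_meas Ih.
  - apply: measurable_funM => //; apply: measurable_funM; last exact: intg_meas Ih.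
    exact: measurable_ltR.
  (* [1 - K s t] and [K t s] differ only on the diagonal. *)
  apply: filterS (ae_time_neq s) => t ts; case: ltgtP ts => //= _ _; ring.
rewrite -E1 mulrDl mul1r -{1}E2 -E3 -RintegralD//.
by apply: eq_Rintegral => p _; rewrite /A /B; ring.
Qed.

End primitive.

Hypothesis T0 : 0 < T.

(** The hypothesis is the claim integrated over [(0, tau)], which is all that test functions can
    see. The difference of the two sides thus integrates to 0 over every half-line, and half-lines
    form a generating pi-system. *)
Lemma ae_time_eq_prim (a h : R -> R) (z : R) : intg time a -> intg time h ->
  (forall tau, 0 < tau -> tau < T -> \int[time]_t (K t tau * a t) =
     z * tau + \int[time]_s (h s * Num.max 0 (tau - s))) ->
  {ae time, forall t, a t = z + prim h t}.
Proof.
move=> Ia Ih ah; pose v t := a t - (z + prim h t).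
have IP := intg_prim Ih.
have Izp : intg time (fun t => z + prim h t) by apply: intgD => //; exact: intg_cst.
have Iv : intg time v by exact: intgB.
have v0 tau : 0 < tau -> tau < T -> \int[time]_t (K t tau * v t) = 0.
  move=> t0 tT; rewrite /v; under eq_Rintegral do rewrite mulrBr mulrDr.
  rewrite RintegralB//; [|exact: intgK|]; last first.
    by apply: intgD; [exact: (intgK (intg_cst time z))|exact: intgK].
  rewrite RintegralD//; [|exact: (intgK (intg_cst time z))|exact: intgK].
  rewrite Rint_prim ?(ltW tT)// ah//.
  have -> : \int[time]_t (K t tau * z) = z * tau.
    rewrite RintegralZr//; last first.
      by apply: (@intg_bdd _ _ _ _ _ 1); [exact: measurable_ltR|move=> s; exact: normK].
    (* The factor [K 0 t] is 1 almost everywhere; it brings the integral to the form of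
       [Rint_time_itv] with [s = 0]. *)
    have -> : \int[time]_t K t tau = \int[time]_t (K 0 t * K t tau).
      apply: ae_eq_Rint; first exact: measurable_ltR.
        by apply: measurable_funM; exact: measurable_ltR.
      apply: filterS2 ae_time (ae_time_neq 0) => t /andP[t0' _] tn0.
      have -> : 0 < t by rewrite lt_neqAle t0' andbT eq_sym; exact: tn0.
      by rewrite mul1r.
    by rewrite Rint_time_itv ?(ltW tT)// subr0 max_r ?(ltW t0)// mulrC.
  ring.
have vT : \int[time]_t v t = 0.
  (* These times increase to [T], which is itself excluded; [n.+2] keeps the first one positive. *)
  pose tau n : R := T - T / n.+2%:R.
  have cv : \int[time]_t (K t (tau n) * v t) @[n --> \oo] --> \int[time]_t v t.
    apply: (@Rint_DCT _ _ _ time (fun n t => K t (tau n) * v t) v (fun t => `|v t|)).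
    - by move=> n; exact: intg_meas (intgK Iv _).
    - exact: intg_meas Iv.
    - apply: filterS ae_time => t /andP[_ tT].
      apply: cvg_near_cst.
      have := @cvg_harmonic R => /cvgrPdist_lt /(_ ((T - t) / T)).
      rewrite divr_gt0 ?subr_gt0// => /(_ isT)[N _ NP]; exists N => // n Nn /=.
      have := NP n.+1 (leqW Nn); rewrite /= sub0r normrN ger0_norm// ltr_pdivlMr// => h1.
      by rewrite /tau (_ : t < _) ?mul1r// ltrBrDl -ltrBrDr; move: h1; rewrite mulrC.
    - exact: intg_norm.
    - by apply: nearW => t n; rewrite normrM ler_piMl// normK.
  rewrite -(cvg_lim _ cv)// (_ : (fun _ => _) = cst 0) ?lim_cst//.
  apply/funext => n; apply: v0; rewrite /tau.
    by rewrite subr_gt0 ltr_pdivrMr// ltr_pMr// ltr1n.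
  by rewrite ltrBlDr ltrDl divr_gt0.
have : {ae time, forall t, v t = 0}.
  apply: (@ae_eq0_pi_system _ (measurableTypeR R) R time (@RGenInftyO.G R) v) => //.
  - exact: RGenInftyO.measurableE.
  - move=> _ _ [x ->] [y ->]; exists (Num.min x y); apply/seteqP.
    by split => t /=; rewrite !in_itv/= lt_min => /andP.
  - move=> _ [x ->].
    have -> : \int[time]_(t in `]-oo, x[) v t = \int[time]_t (K t x * v t).
      rewrite -Rint_indic; last exact: measurable_itv.
      apply: eq_Rintegral => t _; rewrite indicE mulrC; congr (_%:R * _).
      by congr nat_of_bool; apply/idP/idP; rewrite ?inE /= ?in_itv/=.
    have [x0|x0] := leP x 0.
      transitivity (\int[time]_t (0 : R)); last by rewrite Rintegral_cst// mul0r.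
      apply: ae_eq_Rint => //; first exact: intg_meas (intgK Iv _).
      by apply: filterS ae_time => t /andP[t0 _]; rewrite ltNge (le_trans x0 t0) mul0r.
    have [xT|xT] := ltP x T; first exact: v0.
    rewrite -vT; apply: ae_eq_Rint; first exact: intg_meas (intgK Iv _).
      exact: intg_meas Iv.
    by apply: filterS ae_time => t /andP[_ tT]; rewrite (lt_le_trans tT xT) mul1r.
by apply: filterS => t /subr0_eq.
Qed.

End time.

(** * Fourier series on the torus *)

Section unit_interval.
Context {R : realType}.
Definition unit_prob := uniform_prob (@ltr01 R).

Lemma Rint_unit (f : measurableTypeR R -> R) C : measurable_fun setT f -> (forall x, `|f x| <= C) ->
  \int[unit_prob]_x f x = \int[lebesgue_measure]_(x in `[0, 1]) f x.
Proof.
move=> mf fC.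
(* The formula for the uniform law is applied to a nonnegative function, so [f] is shifted by its
   bound. *)
have mfC : measurable_fun setT (fun x => f x + C) by exact: measurable_funD.
have f0 x : 0 <= f x + C by have := fC x; rewrite ler_norml; lra.
have key : \int[unit_prob]_x (f x + C) = \int[lebesgue_measure]_(x in `[0, 1]) (f x + C).
  rewrite /Rintegral integral_uniform.
  - by rewrite subr0 invr1 mul1e.
  - exact/measurable_EFinP.
  - by move=> x; rewrite lee_fin.
have m01 : (lebesgue_measure (`[0%R, 1%R]%classic : set R) = 1)%E.
  by rewrite lebesgue_measure_itv/= lte_fin ltr01 oppr0 adde0.
have Il (g : R -> R) : measurable_fun setT g -> [bounded g x | x in `[0, 1]] ->
    lebesgue_measure.-integrable `[0%R, 1%R] (EFin \o g).
  move=> mg bg; apply: measurable_bounded_integrable => //; last exact: measurable_funS mg.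
  by have := ltry (1 : R); rewrite -[X in (X < _)%E]m01.
move: key; rewrite RintegralD//; last 2 first.
- exact: intg_bdd mf fC.
- exact: intg_cst.
rewrite RintegralD//; last 2 first.
- by apply: Il => //; exists C; split; [exact: num_real|move=> y Cy x _; exact: le_trans (fC x) (ltW Cy)].
- by apply: Il => //; exists `|C|; split; [exact: num_real|move=> y Cy x _; exact: ltW].
rewrite !Rintegral_cst// [X in _ + _ * X = _](congr1 fine (probability_setT unit_prob)).
by rewrite [X in _ = _ + _ * X](congr1 fine m01) => /addIr.
Qed.

Lemma derivable_oo_LR (F : R -> R) a b : (forall x : R, derivable F x (1 : R)) ->
  derivable_oo_LRcontinuous F a b.
Proof.
move=> dF; split => //.
  apply: cvg_at_right_filter; apply: differentiable_continuous; exact/derivable1_diffP.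
apply: cvg_at_left_filter; apply: differentiable_continuous; exact/derivable1_diffP.
Qed.

Lemma Rint_FTC (f F : R -> R) : continuous f -> (forall x : R, is_derive x (1 : R) F (f x)) ->
  \int[lebesgue_measure]_(x in `[0, 1]) f x = F 1 - F 0.
Proof.
move=> cf dF; rewrite /Rintegral (@continuous_FTC2 _ f F)//.
- exact: continuous_subspaceT.
- by apply: derivable_oo_LR => x; have [] := dF x.
- by move=> x _; rewrite derive1E derive_val.
Qed.

Lemma is_derive_scale (k x : R) : is_derive x (1 : R) (fun y => k * y) k.
Proof.
have h := is_deriveZ k (is_derive_id x (1 : R)).
by apply: is_derive_eq h _; rewrite /GRing.scale/= mulr1.
Qed.

Lemma continuous_cosM (k : R) : continuous (fun x => cos (k * x)).
Proof.
by move=> x; apply: continuous_comp; [exact: mulrl_continuous|exact: continuous_cos].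
Qed.

Lemma continuous_sinM (k : R) : continuous (fun x => sin (k * x)).
Proof.
by move=> x; apply: continuous_comp; [exact: mulrl_continuous|exact: continuous_sin].
Qed.

Lemma is_derive_cosM (k x : R) : is_derive x (1 : R) (fun y => cos (k * y)) (- (k * sin (k * x))).
Proof.
have := @is_derive1_comp _ cos (fun y => k * y) x _ _ (is_derive_cos _) (is_derive_scale k x).
by move=> h; apply: is_derive_eq h _; ring.
Qed.

Lemma is_derive_sinM (k x : R) : is_derive x (1 : R) (fun y => sin (k * y)) (k * cos (k * x)).
Proof.
have := @is_derive1_comp _ sin (fun y => k * y) x _ _ (is_derive_sin _) (is_derive_scale k x).
by move=> h; apply: is_derive_eq h _; ring.
Qed.

Lemma measurable_cosM (k : R) : measurable_fun setT (fun x : measurableTypeR R => cos (k * x)).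
Proof. by apply: continuous_measurable_fun; exact: continuous_cosM. Qed.

Lemma measurable_sinM (k : R) : measurable_fun setT (fun x : measurableTypeR R => sin (k * x)).
Proof. by apply: continuous_measurable_fun; exact: continuous_sinM. Qed.

Lemma Rint_cosM (k : R) : k != 0 -> sin k = 0 -> \int[unit_prob]_x cos (k * x) = 0.
Proof.
move=> k0 sk; rewrite (@Rint_unit _ 1) => [||x]; [|exact: measurable_cosM|exact: cos_max].
have dF x : is_derive x (1 : R) (fun x => k^-1 * sin (k * x)) (cos (k * x)).
  have h := is_deriveZ k^-1 (is_derive_sinM k x).
  by apply: is_derive_eq h _; rewrite /GRing.scale/= mulrA mulVf// mul1r.
have -> := Rint_FTC (continuous_cosM (k := k)) dF.
by rewrite mulr1 mulr0 sk sin0 subrr.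
Qed.

Lemma Rint_sinM (k : R) : cos k = 1 -> \int[unit_prob]_x sin (k * x) = 0.
Proof.
move=> ck; have [->|k0] := eqVneq k 0.
  under eq_Rintegral do rewrite mul0r sin0.
  by rewrite Rintegral_cst// mul0r.
rewrite (@Rint_unit _ 1) => [||x]; [|exact: measurable_sinM|exact: sin_max].
have dF x : is_derive x (1 : R) (fun x => - k^-1 * cos (k * x)) (sin (k * x)).
  have h := is_deriveZ (- k^-1) (is_derive_cosM k x).
  by apply: is_derive_eq h _; rewrite /GRing.scale/= mulrNN mulrA mulVf// mul1r.
have -> := Rint_FTC (continuous_sinM (k := k)) dF.
by rewrite mulr1 mulr0 ck cos0 subrr.
Qed.

Lemma sin2pin n : sin (2 * pi * n%:R) = 0 :> R.
Proof.
elim: n => [|n IH]; first by rewrite mulr0 sin0.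
have -> : n.+1%:R = n%:R + 1 :> R by rewrite natr1.
by rewrite [2 * pi * (n%:R + 1)]mulrDr mulr1 [2 * pi]mulr_natl sinD2pi -[pi *+ 2]mulr_natl.
Qed.

Lemma cos2pin n : cos (2 * pi * n%:R) = 1 :> R.
Proof.
elim: n => [|n IH]; first by rewrite mulr0 cos0.
have -> : n.+1%:R = n%:R + 1 :> R by rewrite natr1.
by rewrite [2 * pi * (n%:R + 1)]mulrDr mulr1 [2 * pi]mulr_natl cosD2pi -[pi *+ 2]mulr_natl.
Qed.

(* [trig1 (b, m)] is the normalised [sin (2 pi m x)] if [b], else [cos (2 pi m x)];
   [trig1 (true, 0)] is the zero function. *)
Definition trig1 (k : bool * nat) (x : R) : R :=
  (if k.2 == 0%N then 1 else Num.sqrt 2) *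
  (if k.1 then sin (2 * pi * k.2%:R * x) else cos (2 * pi * k.2%:R * x)).

Lemma measurable_trig1 k : measurable_fun setT (trig1 k : measurableTypeR R -> R).
Proof.
by apply: measurable_funM => //; case: k.1; [exact: measurable_sinM|exact: measurable_cosM].
Qed.

Lemma trig1_bound k x : `|trig1 k x| <= 2.
Proof.
rewrite /trig1 normrM -[leRHS]mulr1 ler_pM//; last by case: k.1; [exact: sin_max|exact: cos_max].
case: ifP => _; first by rewrite normr1; lra.
rewrite ger0_norm ?sqrtr_ge0// -[leRHS]ger0_norm// -sqrtr_sqr ler_wsqrtr//; lra.
Qed.

Lemma Rint_trig1_sum (f g : measurableTypeR R -> R) (a b c : R) :
  measurable_fun setT f -> measurable_fun setT g ->
  (forall x, `|f x| <= 1) -> (forall x, `|g x| <= 1) ->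
  \int[unit_prob]_x (c * (a * f x + b * g x)) =
    c * (a * \int[unit_prob]_x f x + b * \int[unit_prob]_x g x).
Proof.
move=> mf mg f1 g1; have If := intg_bdd unit_prob mf f1; have Ig := intg_bdd unit_prob mg g1.
rewrite RintegralZl//; last by apply: intgD; exact: intgZ.
rewrite RintegralD//; [|exact: intgZ..].
by rewrite !RintegralZl.
Qed.

Let freqB m n : sin (2 * pi * (m%:R - n%:R)) = 0 :> R.
Proof. by rewrite mulrBr sinB !sin2pin mul0r mulr0 subrr. Qed.

Let freqBc m n : cos (2 * pi * (m%:R - n%:R)) = 1 :> R.
Proof. by rewrite mulrBr cosB !sin2pin !cos2pin mulr0 addr0 mulr1. Qed.

Let IC0 (k : R) : sin (2 * pi * k) = 0 -> \int[unit_prob]_x cos (2 * pi * k * x) = (k == 0)%:R.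
Proof.
move=> sk; case: eqVneq => [->|k0].
  under eq_Rintegral do rewrite mulr0 mul0r cos0.
  by rewrite Rintegral_cst// mul1r [LHS](congr1 fine (probability_setT unit_prob)).
by apply: Rint_cosM => //; rewrite !mulf_neq0// gt_eqF// pi_gt0.
Qed.

(** Product-to-sum formulas leave the frequencies [m - n] and [m + n]: sines integrate to 0, and
    cosines integrate to 0 unless the frequency is 0. The frequencies are subtracted as reals, since
    [m - n] may be negative. The pair [(true, 0)] is excluded because it is the zero function. *)
Lemma trig1_ortho k l : \int[unit_prob]_x (trig1 k x * trig1 l x) =
  ((k == l) && (k != (true, 0%N)))%:R.
Proof.
case: k l => [b m] [b' n]; rewrite /trig1/=.
set nm : R := if m == 0%N then 1 else Num.sqrt 2; set nn : R := if n == 0%N then 1 else Num.sqrt 2.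
have pi2 : (2 * pi : R) != 0 by rewrite mulf_neq0// gt_eqF// pi_gt0.
have nat_eq0 : (m%:R + n%:R == 0 :> R) = (m == 0%N) && (n == 0%N).
  by rewrite -natrD pnatr_eq0 addn_eq0.
have nat_eq : (m%:R - n%:R == 0 :> R) = (m == n) by rewrite subr_eq0 eqr_nat.
have freqD : sin (2 * pi * (m%:R + n%:R)) = 0 :> R by rewrite -natrD sin2pin.
have freqDc : cos (2 * pi * (m%:R + n%:R)) = 1 :> R by rewrite -natrD cos2pin.
have q2 : Num.sqrt 2 * Num.sqrt 2 = 2 :> R by rewrite -expr2 sqr_sqrtr.
have mc k := @measurable_cosM k; have ms k := @measurable_sinM k.
have E (s1 s2 : R -> R) (a b1 : R) :
  (forall x, s1 x * s2 x = 2^-1 * (a * cos (2 * pi * (m%:R - n%:R) * x) +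
     b1 * cos (2 * pi * (m%:R + n%:R) * x))) ->
  \int[unit_prob]_x (nm * s1 x * (nn * s2 x)) =
   nm * nn * (2^-1 * (a * (m == n)%:R + b1 * ((m == 0%N) && (n == 0%N))%:R)).
  move=> h; rewrite -nat_eq -nat_eq0 -!IC0//.
  rewrite mulrA -Rint_trig1_sum//; [|by move=> x; exact: cos_max..].
  by apply: eq_Rintegral => x _; rewrite mulrACA h mulrA.
have ES (s1 s2 : R -> R) (a b1 : R) :
  (forall x, s1 x * s2 x = 2^-1 * (a * sin (2 * pi * (m%:R - n%:R) * x) +
     b1 * sin (2 * pi * (m%:R + n%:R) * x))) ->
  \int[unit_prob]_x (nm * s1 x * (nn * s2 x)) = 0.
  move=> h; transitivity (nm * nn * 2^-1 * (a * 0 + b1 * 0)); last by rewrite !mulr0 addr0 mulr0.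
  rewrite -[X in a * X](Rint_sinM (freqBc m n)) -[X in b1 * X](Rint_sinM freqDc).
  rewrite -Rint_trig1_sum//; [|by move=> x; exact: sin_max..].
  by apply: eq_Rintegral => x _; rewrite mulrACA h mulrA.
have eBD x : (2 * pi * (m%:R - n%:R) * x = 2 * pi * m%:R * x - 2 * pi * n%:R * x) *
   (2 * pi * (m%:R + n%:R) * x = 2 * pi * m%:R * x + 2 * pi * n%:R * x).
  by split; ring.
have mn0 : m != n -> (m == 0%N) && (n == 0%N) = false by case: (m) (n) => [|?] [|?].
case: b; case: b'.
- rewrite (E _ _ 1 (-1)); last by move=> x; rewrite !eBD cosB cosD; field.
  rewrite !xpair_eqE eqxx/= /nm /nn; have [->|mn] := eqVneq m n; last first.
    by rewrite mn0// !mulr0 addr0 !mulr0.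
  by case: eqVneq => [_|n0] /=; [field|rewrite q2; field].
- rewrite (ES _ _ 1 1)//.
  by move=> x; rewrite !eBD sinB sinD; field.
- rewrite (ES _ _ (-1) 1)//.
  by move=> x; rewrite !eBD sinB sinD; field.
- rewrite (E _ _ 1 1); last by move=> x; rewrite !eBD cosB cosD; field.
  rewrite !xpair_eqE eqxx/= andbT /nm /nn; have [->|mn] := eqVneq m n; last first.
    by rewrite mn0// !mulr0 addr0 !mulr0.
  by case: eqVneq => [_|n0] /=; [field|rewrite q2; field].
Qed.

End unit_interval.

(** * The trigonometric basis and its eigenvalues *)

Section torus_basis.
Context {R : realType}.

Lemma measurable_tnthR n (i : 'I_n) : measurable_fun setT (fun x : torus R n => tnth x i : measurableTypeR R).
Proof. exact: measurable_tnth. Qed.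

Lemma measurable_torus_prod n (f : 'I_n -> measurableTypeR R -> R) :
  (forall i, measurable_fun setT (f i)) ->
  measurable_fun setT (fun x : torus R n => \prod_(i < n) f i (tnth x i)).
Proof.
move=> mf; apply: measurable_prod => i _.
by apply: measurableT_comp => //; exact: measurable_tnthR.
Qed.

Lemma torus_prod_bound n (f : 'I_n -> measurableTypeR R -> R) C :
  (forall i x, `|f i x| <= C) -> forall x : torus R n,
  `|\prod_(i < n) f i (tnth x i)| <= C ^+ n.
Proof.
move=> fC x; rewrite normr_prod (_ : C ^+ n = \prod_(i < n) C); last by rewrite prodr_const card_ord.
by apply: ler_prod => i _; rewrite normr_ge0 fC.
Qed.

Lemma Rint_torusS n (g : torus R n.+1 -> R) C : measurable_fun setT g ->
  (forall x, `|g x| <= C) ->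
  \int[torus_measure n.+1]_x g x =
    \int[(unit_prob \x torus_measure n)%E]_p g (tcons p).
Proof.
move=> mg gC; rewrite /Rintegral; congr fine; rewrite [LHS]integral_distribution//.
- exact/measurable_EFinP.
- apply: (@intg_bdd _ _ _ _ (g \o @tcons R n) C) => //.
    by apply: measurableT_comp => //; exact: measurable_tcons.
  by move=> p; exact: gC.
Qed.

Lemma Rint_torus_prod n (f : 'I_n -> measurableTypeR R -> R) C :
  (forall i, measurable_fun setT (f i)) -> (forall i x, `|f i x| <= C) ->
  \int[torus_measure n]_x \prod_(i < n) f i (tnth x i) = \prod_(i < n) \int[unit_prob]_x f i x.
Proof.
elim: n f => [|n IH] f mf fC.
  under eq_Rintegral do rewrite big_ord0.
  by rewrite big_ord0 Rintegral_cst// mul1r [LHS](congr1 fine (probability_setT _)).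
rewrite (@Rint_torusS _ _ (C ^+ n.+1)); last first.
- exact: torus_prod_bound.
- exact: measurable_torus_prod.
pose g (x : torus R n) := \prod_(i < n) f (lift ord0 i) (tnth x i).
have mg : measurable_fun setT g by exact: (@measurable_torus_prod n (fun i => f (lift ord0 i))).
have gC x : `|g x| <= C ^+ n by apply: (@torus_prod_bound n (fun i => f (lift ord0 i))) => i y; exact: fC.
have E p : \prod_(i < n.+1) f i (tnth (tcons p) i) = f ord0 p.1 * g p.2.
  rewrite big_ord_recl tnth0; congr (_ * _); apply: eq_bigr => i _.
  by rewrite tnthS.
under eq_Rintegral do rewrite E.
have If : intg unit_prob (f ord0) by exact: intg_bdd (mf _) (fC _).
have Ig : intg (torus_measure n) g by exact: intg_bdd mg gC.
rewrite Rfubini1; last exact: intg_tensor.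
rewrite big_ord_recl -(IH (fun i => f (lift ord0 i)))// -RintegralZr//.
by apply: eq_Rintegral => x _ /=; rewrite RintegralZl.
Qed.

Context {n : nat}.
Notation freq := (n.-tuple (bool * nat)).

Definition mode (k : freq) (x : torus R n) : R := \prod_(i < n) trig1 (tnth k i) (tnth x i).

Lemma measurable_mode k : measurable_fun setT (mode k).
Proof. by apply: (@measurable_torus_prod n (fun i => trig1 (tnth k i))) => i; exact: measurable_trig1. Qed.

Lemma mode_bound k x : `|mode k x| <= 2 ^+ n.
Proof. by apply: (@torus_prod_bound n (fun i => trig1 (tnth k i))) => i y; exact: trig1_bound. Qed.

Lemma mode_ortho k l : \int[torus_measure n]_x (mode k x * mode l x) =
  ((k == l) && [forall i, tnth k i != (true, 0%N)])%:R.
Proof.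
have -> : \int[torus_measure n]_x (mode k x * mode l x) =
    \int[torus_measure n]_x \prod_(i < n) (trig1 (tnth k i) (tnth x i) * trig1 (tnth l i) (tnth x i)).
  by apply: eq_Rintegral => x _; rewrite big_split.
rewrite (@Rint_torus_prod _ (fun i y => trig1 (tnth k i) y * trig1 (tnth l i) y) (2 * 2)).
- under eq_bigr do rewrite trig1_ortho.
  have [/forallP h|] := boolP [forall i, (tnth k i == tnth l i) && (tnth k i != (true, 0%N))].
    rewrite big1 => [|i _]; last by rewrite h.
    rewrite (_ : _ && _ = true)//; apply/andP; split.
      by apply/eqP/eq_from_tnth => i; have /andP[/eqP] := h i.
    by apply/forallP => i; have /andP[_] := h i.
  rewrite negb_forall => /existsP[i hi].
  rewrite (bigD1 i)//= (negbTE hi) mul0r; case: eqP => //= kl.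
  rewrite (_ : [forall _, _] = false)//; apply/negbTE; rewrite negb_forall; apply/existsP; exists i.
  by move: hi; rewrite kl eqxx.
- by move=> i; apply: measurable_funM; exact: measurable_trig1.
- by move=> i y; rewrite normrM ler_pM// trig1_bound.
Qed.

(* Indices that encode no frequency give the zero function. *)
Definition fourier (j : nat) (x : torus R n) : R :=
  if pickle_inv j is Some k then mode k x else 0.

Lemma measurable_fourier j : measurable_fun setT (fourier j).
Proof. by rewrite /fourier; case: pickle_inv => [k|//]; exact: measurable_mode. Qed.

Lemma fourier_bound j x : `|fourier j x| <= 2 ^+ n.
Proof.
rewrite /fourier; case: pickle_inv => [k|]; first exact: mode_bound.
by rewrite normr0 exprn_ge0.
Qed.

Lemma fourier_ortho i j : i != j -> \int[torus_measure n]_x (fourier i x * fourier j x) = 0.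
Proof.
move=> ij; have zero (f : torus R n -> R) : (forall x, f x = 0) -> \int[torus_measure n]_x f x = 0.
  by move=> f0; under eq_Rintegral do rewrite f0; rewrite Rintegral_cst// mul0r.
rewrite /fourier; case Ei : pickle_inv => [k|]; last by apply: zero => x; rewrite mul0r.
case Ej : pickle_inv => [l|]; last by apply: zero => x; rewrite mulr0.
rewrite mode_ortho; case: eqP => // kl.
have := @pickle_invK freq i; have := @pickle_invK freq j.
by rewrite Ei Ej/= kl => -> ji; rewrite ji eqxx in ij.
Qed.

Lemma fourier_norm j : \int[torus_measure n]_x (fourier j x * fourier j x) = 1 \/
  \int[torus_measure n]_x (fourier j x * fourier j x) = 0.
Proof.
rewrite /fourier; case: pickle_inv => [k|]; last first.
  by right; under eq_Rintegral do rewrite mulr0; rewrite Rintegral_cst// mul0r.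
by rewrite mode_ortho; case: (_ && _); [left|right].
Qed.

(** The eigenvalue of minus the Laplacian. The value 1 at indices without frequency keeps them out
    of the kernel [lam j = 0]. *)
Definition lam (j : nat) : R :=
  if pickle_inv j is Some k then (2 * pi) ^+ 2 * (\sum_(i < n) (tnth k i : bool * nat).2 ^ 2)%:R else 1.

Definition const_index : nat := pickle [tuple of nseq n (false, 0%N)].

Lemma fourier_const x : fourier const_index x = 1.
Proof.
rewrite /fourier pickleK_inv /mode big1// => i _.
by rewrite tnth_nseq /trig1/= mul1r mulr0 mul0r cos0.
Qed.

Lemma lam_const : lam const_index = 0.
Proof.
by rewrite /lam pickleK_inv big1 ?mulr0// => i _; rewrite tnth_nseq.
Qed.

Lemma lam_ge1 j : lam j != 0 -> 1 <= lam j.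
Proof.
rewrite /lam; case: pickle_inv => // k; rewrite mulf_eq0 negb_or pnatr_eq0 -lt0n => /andP[_ s0].
have pi1 : 1 <= (2 * pi : R).
  by have := pi_ge2 R; lra.
by rewrite -[X in X <= _](mulr1 1) ler_pM// ?exprn_ege1// ?ler1n.
Qed.

(** When all frequencies are 0, an index other than [const_index] contains a sine factor
    [trig1 (true, 0)], which vanishes identically. *)
Lemma fourier_lam0 j : lam j = 0 -> j != const_index -> forall x, fourier j x = 0.
Proof.
rewrite /lam /fourier; case E : pickle_inv => [k|] // /eqP + jc x.
rewrite mulf_eq0 sqrf_eq0 mulf_eq0 pnatr_eq0/= gt_eqF ?pi_gt0//= pnatr_eq0 sum_nat_eq0 => /forallP k0.
have [i ki] : exists i, (tnth k i).1.
  apply: contrapT => /forallNP h; move: jc => /eqP; apply.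
  have := @pickle_invK freq j; rewrite E/= => <-.
  congr pickle; apply: eq_from_tnth => i; rewrite tnth_nseq.
  have /= := k0 i; rewrite expn_eq0 andbT => /eqP.
  by case: (tnth k i) (h i) => [[] m] //= _ ->.
have /= := k0 i; rewrite expn_eq0 andbT => /eqP ki2.
rewrite /mode (bigD1 i)//= /trig1 ki ki2 mulr0 mul0r sin0 mulr0 mul0r//.
Qed.

(** Only finitely many frequency tuples have all entries below [m], so their codes are bounded; any
    other tuple has an entry at least [m], whose square already exceeds [M]. The second alternative
    is for indices that encode nothing. *)
Lemma lam_cvg (M : R) : exists J, forall j, (J <= j)%N -> M <= lam j \/ forall x, fourier j x = 0.
Proof.
pose m := (Num.truncn `|M|).+1.
pose F (g : {ffun 'I_n -> bool * 'I_m}) : freq := [tuple ((g i).1, val (g i).2) | i < n].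
exists (\max_(g : {ffun 'I_n -> bool * 'I_m}) pickle (F g)).+1 => j Jj.
rewrite /fourier /lam; case E : pickle_inv => [k|]; last by right.
left; have [/forallP km|] := boolP [forall i, ((tnth k i).2 < m)%N].
  exfalso; move: Jj; have := @pickle_invK freq j; rewrite E/= => <-.
  pose g : {ffun 'I_n -> bool * 'I_m} := [ffun i => ((tnth k i).1, Ordinal (km i))].
  have -> : k = F g by apply: eq_from_tnth => i; rewrite tnth_mktuple ffunE/=; case: (tnth k i).
  by apply/negP; rewrite -leqNgt (@leq_bigmax _ (fun g => pickle (F g)) g).
rewrite negb_forall => /existsP[i]; rewrite -leqNgt => mi.
have Mm : M <= m%:R.
  by apply: le_trans (ler_norm _) _; apply: ltW; have /andP[] := truncn_itv (normr_ge0 M).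
apply: le_trans Mm _.
have pi1 : 1 <= (2 * pi : R) by have := pi_ge2 R; lra.
rewrite -[leLHS]mul1r ler_pM// ?exprn_ege1// ler_nat (bigD1 i)//=.
apply: leq_trans (leq_addr _ _); apply: (leq_trans mi).
by rewrite -{1}[(tnth k i).2]expn1 leq_pexp2l//; move: mi; case: (tnth k i).2.
Qed.

End torus_basis.

(** * The algebra of trigonometric polynomials *)

Section trig_algebra.
Context {R : realType} {n : nat}.
Implicit Types (p q : torus R n -> R).

Definition trig_span p := exists J (c : nat -> R), forall x, p x = \sum_(j < J) c j * fourier j x.

Lemma trig_span_ext p q : (forall x, p x = q x) -> trig_span p -> trig_span q.
Proof. by move=> pq [J [c pc]]; exists J, c => x; rewrite -pq. Qed.

Lemma trig_span0 : trig_span (fun=> 0).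
Proof. by exists 0%N, (fun=> 0) => x; rewrite big_ord0. Qed.

Lemma trig_spanZ a p : trig_span p -> trig_span (fun x => a * p x).
Proof.
move=> [J [c pc]]; exists J, (fun j => a * c j) => x.
by rewrite pc mulr_sumr; apply: eq_bigr => j _; rewrite mulrA.
Qed.

Lemma trig_spanD p q : trig_span p -> trig_span q -> trig_span (fun x => p x + q x).
Proof.
have wid J K (c : nat -> R) : (J <= K)%N -> forall x : torus R n, \sum_(j < J) c j * fourier j x =
    \sum_(j < K) (if (j < J)%N then c j else 0) * fourier j x.
  move=> JK x; rewrite (big_ord_widen K (fun j => c j * fourier j x))// big_mkcond.
  by apply: eq_bigr => j _; case: ifP; rewrite ?mul0r.
move=> [J [c pc]] [K [d qd]]; exists (maxn J K).
exists (fun j => (if (j < J)%N then c j else 0) + (if (j < K)%N then d j else 0)) => x.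
rewrite pc qd (wid J _ _ (leq_maxl J K)) (wid K _ _ (leq_maxr J K)) -big_split.
by apply: eq_bigr => j _; rewrite mulrDl.
Qed.

Lemma trig_span_fourier j : trig_span (fourier j).
Proof.
exists j.+1, (fun i => (i == j)%:R) => x; rewrite big_ord_recr/= eqxx mul1r big1 ?add0r// => i _.
by rewrite ltn_eqF ?mul0r.
Qed.

Lemma trig_span_mode (k : n.-tuple (bool * nat)) : trig_span (mode k).
Proof.
apply: trig_span_ext (trig_span_fourier (pickle k)) => x.
by rewrite /fourier pickleK_inv.
Qed.

Lemma trig_span1 : trig_span (fun=> 1).
Proof. by apply: trig_span_ext (trig_span_fourier (@const_index n)) => x; rewrite fourier_const. Qed.

Let wave (e : bool) (y : R) := if e then sin y else cos y.

(** Product-to-sum with the first harmonic moves the frequency [m] to [m - 1] and [m + 1]. Frequency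
    0 is treated apart, having no predecessor. *)
Lemma wave_trig1 e k : exists a1 l1 a2 l2, forall y : R,
  wave e (2 * pi * y) * trig1 k y = a1 * trig1 l1 y + a2 * trig1 l2 y.
Proof.
pose nu m : R := if m == 0%N then 1 else Num.sqrt 2.
have nu0 m : nu m != 0.
  by rewrite /nu; case: ifP => _; rewrite ?oner_neq0// sqrtr_eq0 -ltNge.
have trigE b m y : trig1 (b, m) y = nu m * wave b (2 * pi * m%:R * y) by [].
have waveE b m y : wave b (2 * pi * m%:R * y) = (nu m)^-1 * trig1 (b, m) y.
  by rewrite trigE mulrA mulVf// mul1r.
case: k => b [|m].
  exists (if b then 0 else (nu 1)^-1), (e, 1%N), 0, (e, 0%N) => y.
  have -> : trig1 (b, 0%N) y = wave b 0 by rewrite trigE mulr0 mul0r /nu mul1r.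
  rewrite mul0r addr0; case: b; first by rewrite /= sin0 mulr0 mul0r.
  by rewrite -waveE mulr1 [wave false 0]cos0 mulr1.
have key y : wave e (2 * pi * y) * wave b (2 * pi * m.+1%:R * y) =
   (if e && ~~ b then - 2^-1 else 2^-1) * wave (b (+) e) (2 * pi * m%:R * y) +
   (if e && b then - 2^-1 else 2^-1) * wave (b (+) e) (2 * pi * m.+2%:R * y).
  set u := 2 * pi * m.+1%:R * y; set v := 2 * pi * y.
  have -> : 2 * pi * m%:R * y = u - v by rewrite /u /v -[m.+1%:R]natr1; ring.
  have -> : 2 * pi * m.+2%:R * y = u + v by rewrite /u /v -[m.+2%:R]natr1; ring.
  by case: e b => [] [] /=; rewrite ?sinB ?cosB ?sinD ?cosD; field.
exists (nu m.+1 * (if e && ~~ b then - 2^-1 else 2^-1) * (nu m)^-1), (b (+) e, m).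
exists (nu m.+1 * (if e && b then - 2^-1 else 2^-1) * (nu m.+2)^-1), (b (+) e, m.+2) => y.
by rewrite trigE mulrCA key !waveE; ring.
Qed.

(* Multipliers of the span of the basis: since [1] is in the span they form an
   algebra inside it, and it suffices to multiply by first harmonics. *)
Definition trig_alg p := forall q, trig_span q -> trig_span (fun x => p x * q x).

Lemma trig_alg_span p : trig_alg p -> trig_span p.
Proof.
by move=> /(_ _ trig_span1); apply: trig_span_ext => x; rewrite mulr1.
Qed.

Lemma trig_algD p q : trig_alg p -> trig_alg q -> trig_alg (fun x => p x + q x).
Proof.
move=> pA qA r rS; apply: trig_span_ext (trig_spanD (pA r rS) (qA r rS)) => x.
by rewrite mulrDl.
Qed.

Lemma trig_algM p q : trig_alg p -> trig_alg q -> trig_alg (fun x => p x * q x).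
Proof.
move=> pA qA r rS; apply: trig_span_ext (pA _ (qA r rS)) => x.
by rewrite mulrA.
Qed.

Lemma trig_algC a : trig_alg (fun=> a).
Proof. by move=> q qS; exact: trig_spanZ. Qed.

Lemma trig_algX p m : trig_alg p -> trig_alg (fun x => p x ^+ m).
Proof.
move=> pA; elim: m => [|m IH]; first exact: trig_algC.
by under eq_fun do rewrite exprS; exact: trig_algM.
Qed.

Lemma trig_alg_wave e i : trig_alg (fun x => wave e (2 * pi * tnth x i)).
Proof.
have mk k : trig_span (fun x => wave e (2 * pi * tnth x i) * mode k x).
  pose k' l := [tuple if j == i then l else tnth k j | j < n].
  have mE l x : mode (k' l) x = trig1 l (tnth x i) *
      \prod_(j < n | j != i) trig1 (tnth k j) (tnth x j).
    rewrite /mode (bigD1 i)//= tnth_mktuple eqxx; congr (_ * _).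
    by apply: eq_bigr => j /negbTE ji; rewrite tnth_mktuple ji.
  have [a1 [l1 [a2 [l2 h]]]] := wave_trig1 e (tnth k i).
  apply: trig_span_ext (trig_spanD (trig_spanZ a1 (trig_span_mode (k' l1)))
    (trig_spanZ a2 (trig_span_mode (k' l2)))) => x.
  have -> : mode k x = trig1 (tnth k i) (tnth x i) *
      \prod_(j < n | j != i) trig1 (tnth k j) (tnth x j) by rewrite /mode (bigD1 i).
  by rewrite !mE [RHS]mulrA h; ring.
have bk j : trig_span (fun x => wave e (2 * pi * tnth x i) * fourier j x).
  rewrite /fourier; case: pickle_inv => [k|]; first exact: mk.
  by apply: trig_span_ext trig_span0 => x; rewrite mulr0.
move=> q [J [c qc]].
suff : trig_span (fun x => \sum_(j < J) c j * (wave e (2 * pi * tnth x i) * fourier j x)).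
  by apply: trig_span_ext => x; rewrite qc mulr_sumr; apply: eq_bigr => j _; ring.
elim: J {qc} => [|J IH].
  by apply: trig_span_ext trig_span0 => x; rewrite big_ord0.
apply: trig_span_ext (trig_spanD IH (trig_spanZ (c J) (bk J))) => x.
by rewrite big_ord_recr.
Qed.

Lemma trig_alg_cos i (t : R) : trig_alg (fun x => cos (2 * pi * tnth x i - t)).
Proof.
have := trig_algD (trig_algM (trig_algC (cos t)) (trig_alg_wave false i))
  (trig_algM (trig_algC (sin t)) (trig_alg_wave true i)).
by congr trig_alg; apply/funext => x; rewrite cosB/=; ring.
Qed.

Lemma measurable_trig_span p : trig_span p -> measurable_fun setT p.
Proof.
move=> [J [c pc]]; have -> : p = (fun x => \sum_(j < J) c j * fourier j x) by apply/funext.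
apply: measurable_sum => j; apply: measurable_funM => //; exact: measurable_fourier.
Qed.

End trig_algebra.

(** * Completeness of the trigonometric system *)

Section torus_complete.
Context {R : realType} {n : nat}.
Local Notation mt := (torus_measure n : probability (torus R n) R).

#[local] Instance ae_torus_filter : Filter (nbhs (almost_everywhere mt)).
Proof. exact: ae_filter_ringOfSetsType. Qed.

(** The indicator of the exceptional set is a product function with a single nontrivial factor. Its
    integral thus reduces to one variable, where the exceptional set meets [[0, 1]] within
    [{0, 1, b}]. *)
Lemma ae_unit_interval (b : R) (i : 'I_n) :
  {ae mt, forall x, [&& 0 < tnth x i, tnth x i < 1 & tnth x i != b]}.
Proof.
pose E : set (measurableTypeR R) := [set y | ~~ [&& 0 < y, y < 1 & y != b]].
have mE : measurable E.
  have -> : E = ~` (`]0, 1[%classic `\` [set b]).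
    apply/seteqP; split => y; rewrite /E/= in_itv/=.
      by move=> /negP h [/andP[y0 y1] yb]; apply: h; apply/and3P; split => //; apply/eqP.
    by move=> h; apply/negP => /and3P[y0 y1 /eqP yb]; apply: h; split => //; rewrite y0.
  apply: measurableC; apply: measurableD; first exact: measurable_itv.
  exact: measurable_set1.
have b1 (A : set (measurableTypeR R)) y : `|\1_A y : R| <= 1.
  by rewrite indicE; case: (_ \in _); rewrite ?normr1 ?normr0.
have E0 : \int[unit_prob]_y (\1_E y) = 0 :> R.
  rewrite (@Rint_unit _ _ 1)//.
  rewrite /Rintegral integral_indic//.
  suff E1 : (lebesgue_measure (E `&` `[0%R, 1%R]%classic) = 0)%E by exact: (congr1 fine E1).
  apply/eqP; rewrite eq_le measure_ge0 andbT.
  have c0 : (lebesgue_measure ([set 0%R; 1%R; b] : set R) = 0)%E.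
    by apply: countable_lebesgue_measure0; apply: finite_set_countable.
  rewrite -c0; apply: le_measure; rewrite ?inE//.
  - by apply: measurableI => //; exact: measurable_itv.
  - by apply: measurableU => //; apply: measurableU.
  move=> y [/= /negP h]; rewrite in_itv/= => /andP[y0 y1].
  have [->|yb] := eqVneq y b; first by right.
  have [->|yn0] := eqVneq y 0; first by left; left.
  have [->|yn1] := eqVneq y 1; first by left; right.
  by exfalso; apply: h; apply/and3P; split=> //; rewrite lt_neqAle ?y0 ?y1 ?andbT// eq_sym.
pose f (j : 'I_n) (y : measurableTypeR R) : R := if j == i then \1_E y else 1.
have mf j : measurable_fun setT (f j) by rewrite /f; case: (j == i); [exact: measurable_indic|exact: measurable_cst].
have f1 j y : `|f j y| <= 1 by rewrite /f; case: ifP => _; [exact: b1|rewrite normr1].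
have fE x : \prod_(j < n) f j (tnth x j) = \1_E (tnth x i).
  by rewrite (bigD1 i)//= /f eqxx big1 ?mulr1//= => j /negbTE ->.
have : {ae mt, forall x, (\1_E (tnth x i) : R) = 0}.
  apply: Rint_eq0_ae => //.
  - apply: (@intg_bdd _ _ _ _ _ 1) => //.
    by apply: measurableT_comp => //; exact: measurable_tnthR.
  - under eq_Rintegral do rewrite -fE; rewrite (@Rint_torus_prod _ _ _ 1)//.
    by rewrite (bigD1 i)//= (_ : \int[unit_prob]_x f i x = 0) ?mul0r// /f eqxx.
apply: filterS => x; rewrite indicE; case: (boolP (_ \in _)) => [_ /eqP|].
  by rewrite oner_eq0.
by rewrite notin_setE /E/= => /negP; rewrite negbK.
Qed.

(* For [q] in [[0, 1]], [(1 - q ^ m) ^ (2 ^ m)] tends to the indicator of [q < 1/2]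
   off [q = 1/2]. *)
Definition sharpen (q : R) m := (1 - q ^+ m) ^+ (2 ^ m)%N.

Lemma sharpen_itv q m : 0 <= q <= 1 -> 0 <= sharpen q m <= 1.
Proof.
move=> /andP[q0 q1]; have qm0 : 0 <= q ^+ m by exact: exprn_ge0.
have qm1 : q ^+ m <= 1 by exact: exprn_ile1.
by rewrite /sharpen exprn_ge0 ?subr_ge0//= exprn_ile1 ?subr_ge0// lerBlDr lerDl.
Qed.

Lemma bernoulli_ge (y : R) k : 0 <= y <= 1 -> 1 - k%:R * y <= (1 - y) ^+ k.
Proof.
move=> /andP[y0 y1]; elim: k => [|k IH]; first by rewrite mul0r subr0 expr0.
rewrite exprS -natr1; apply: (@le_trans _ _ ((1 - y) * (1 - k%:R * y))).
  have : 0 <= k%:R * y ^+ 2 by rewrite mulr_ge0 ?sqr_ge0.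
  nra.
by rewrite ler_wpM2l ?subr_ge0.
Qed.

Lemma bernoulli_le (y : R) k : 0 <= y <= 1 -> (1 - y) ^+ k * (1 + k%:R * y) <= 1.
Proof.
move=> /andP[y0 y1]; elim: k => [|k IH]; first by rewrite mul0r addr0 mul1r.
apply: le_trans IH; rewrite exprS -natr1 mulrAC mulrC ler_wpM2l ?exprn_ge0 ?subr_ge0//.
have : 0 <= k%:R * y ^+ 2 by rewrite mulr_ge0 ?sqr_ge0.
have := sqr_ge0 y; nra.
Qed.

(** The two Bernoulli inequalities with [y = q^m] and [k = 2^m]: their product [(2 q)^m] tends to 0
    below [1/2], where the lower bound tends to 1, and to infinity above, where the upper bound
    tends to 0. *)
Lemma cvg_sharpen q : 0 <= q <= 1 -> q != 2^-1 ->
  sharpen q m @[m --> \oo] --> ((q < 2^-1)%R%:R : R).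
Proof.
move=> q01; have /andP[q0 q1] := q01; move=> q2.
have qm m : 0 <= q ^+ m <= 1 by rewrite exprn_ge0//= exprn_ile1.
have e2 m : (2 ^ m)%N%:R * q ^+ m = (2 * q) ^+ m by rewrite natrX exprMn.
case: ltP => q12.
  have c : (1 - (2 * q) ^+ m) @[m --> \oo] --> (1 : R).
    rewrite -[X in _ --> X]subr0; apply: cvgB; first exact: cvg_cst.
    by apply: cvg_expr; rewrite ger0_norm ?mulr_ge0//; lra.
  apply: (@squeeze_cvgr _ _ _ _ _ (cst 1) _ _ _ c); last exact: cvg_cst.
  apply: nearW => m; have /andP[_ ->] := sharpen_itv m q01.
  by rewrite andbT -e2; exact: bernoulli_ge.
have q12' : 1 < 2 * q by move: q2 q12; rewrite le_eqVlt eq_sym => /negbTE -> /=; lra.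
have c : ((2 * q) ^- m) @[m --> \oo] --> (0 : R) by exact: cvg_expn.
apply: (@squeeze_cvgr _ _ _ _ (cst 0) _ _ _ _ _ c); last exact: cvg_cst.
apply: nearW => m; have /andP[-> _] /= := sharpen_itv m q01.
have p0 : 0 < (2 * q) ^+ m by rewrite exprn_gt0//; lra.
rewrite -[leRHS]mul1r ler_pdivlMr//; apply: le_trans (bernoulli_le (2 ^ m)%N (qm m)).
rewrite e2; apply: ler_wpM2l; last by lra.
by have /andP[] := sharpen_itv m q01.
Qed.

(** This replaces Stone-Weierstrass: indicators are reached directly as almost everywhere limits of
    trigonometric polynomials. Values in [[0, 1]] permit dominated convergence, and products of
    multipliers give stability under intersection. *)
Definition trig_set (B : set (torus R n)) := measurable B /\
  exists p : nat -> torus R n -> R, [/\ forall m, trig_alg (p m),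
    forall m x, 0 <= p m x <= 1 & {ae mt, forall x, p m x @[m --> \oo] --> (\1_B x : R)}].

Lemma trig_setI : setI_closed trig_set.
Proof.
move=> A B [mA [p [pA p01 pc]]] [mB [q [qA q01 qc]]].
split; first exact: measurableI.
exists (fun m x => p m x * q m x); split.
- by move=> m; exact: trig_algM.
- move=> m x; have /andP[? ?] := p01 m x; have /andP[? ?] := q01 m x.
  by rewrite mulr_ge0//= mulr_ile1.
- by apply: filterS2 pc qc => x px qx; rewrite indicI; exact: cvgM.
Qed.

Lemma trig_set_lt i (b : R) : trig_set [set x | tnth x i < b].
Proof.
have mB : measurable [set x : torus R n | tnth x i < b].
  rewrite -[X in measurable X]setTI.
  have := @measurable_tnthR R n i measurableT `]-oo, b[%classic (measurable_itv _).
  by congr (measurable (_ `&` _)); apply/seteqP; split => x /=; rewrite in_itv.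
split => //.
have [b0|b0] := leP b 0.
  exists (fun _ _ => 0); split.
  - by move=> m; exact: trig_algC.
  - by move=> m x; rewrite lexx ler01.
  - apply: filterS (ae_unit_interval 0 i) => x /and3P[x0 _ _].
    rewrite indicE memNset; first exact: cvg_cst.
    by move=> /= xb; have := lt_trans x0 (lt_le_trans xb b0); rewrite ltxx.
have [b1|b1] := leP 1 b.
  exists (fun _ _ => 1); split.
  - by move=> m; exact: trig_algC.
  - by move=> m x; rewrite ler01 lexx.
  - apply: filterS (ae_unit_interval 0 i) => x /and3P[_ x1 _].
    by rewrite indicE mem_set; [exact: cvg_cst|exact: lt_le_trans x1 b1].
(* By product-to-sum, [q = 1/2 - 1/2 sin(pi y) sin(pi (b - y))] with [y = tnth x i]: a trigonometric
   polynomial with values in [[0, 1]] which, for [0 < y < 1], is below [1/2] exactly when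
   [y < b]. *)
pose q (x : torus R n) := 2^-1 + 4^-1 * (cos (pi * b) - cos (2 * pi * tnth x i - pi * b)).
have qA : trig_alg q.
  have := trig_algD (trig_algC (2^-1 + 4^-1 * cos (pi * b)))
    (trig_algM (trig_algC (- 4^-1)) (trig_alg_cos i (pi * b))).
  by congr trig_alg; apply/funext => x; rewrite /q; ring.
have q01 x : 0 <= q x <= 1.
  rewrite /q; have := cos_max (pi * b); have := cos_max (2 * pi * tnth x i - pi * b).
  by rewrite !ler_norml; lra.
exists (fun m x => sharpen (q x) m); split.
- move=> m; apply: trig_algX.
  have := trig_algD (trig_algC 1) (trig_algM (trig_algC (-1)) (trig_algX m qA)).
  by congr trig_alg; apply/funext => x; ring.
- by move=> m x; exact: sharpen_itv.
- apply: filterS (ae_unit_interval b i) => x /and3P[x0 x1 xb].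
  set y := tnth x i in x0 x1 xb *.
  have qE : q x = 2^-1 - 2^-1 * (sin (pi * y) * sin (pi * (b - y))).
    rewrite /q -/y.
    have -> : pi * b = pi * y + pi * (b - y) by ring.
    have -> : 2 * pi * y - (pi * y + pi * (b - y)) = pi * y - pi * (b - y) by ring.
    by rewrite cosB cosD; field.
  have pi0 : 0 < pi :> R by exact: pi_gt0.
  have sy : 0 < sin (pi * y).
    by apply: sin_gt0_pi; rewrite mulr_gt0//= gtr_pMr.
  have sb : (0 < sin (pi * (b - y))) = (y < b) /\ sin (pi * (b - y)) != 0.
    have [yb|yb] := ltP y b.
      suff s0 : 0 < sin (pi * (b - y)) by rewrite s0 gt_eqF.
      by apply: sin_gt0_pi; rewrite mulr_gt0 ?subr_gt0//= gtr_pMr//; lra.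
    have yb' : b < y by rewrite lt_neqAle yb eq_sym xb.
    suff s0 : sin (pi * (b - y)) < 0 by rewrite lt_eqF// ltNge ltW.
    rewrite -opprB mulrN sinN oppr_lt0.
    by apply: sin_gt0_pi; rewrite mulr_gt0 ?subr_gt0//= gtr_pMr//; lra.
  have q2 : q x != 2^-1.
    rewrite qE -subr_eq0 addrAC subrr add0r oppr_eq0 !mulf_neq0//; last by case: sb.
    by rewrite gt_eqF.
  have -> : (\1_[set x0 | tnth x0 i < b] x : R) = (q x < 2^-1)%R%:R.
    rewrite indicE; congr (_%:R); congr nat_of_bool.
    rewrite (_ : (q x < 2^-1) = (y < b)).
      by apply/idP/idP; rewrite ?inE.
    rewrite -sb.1 qE ltrBlDr ltrDl; rewrite pmulr_rgt0 ?invr_gt0// pmulr_rgt0//.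
  exact: cvg_sharpen.
Qed.

Lemma trig_set_gen : @measurable _ (torus R n) = <<s trig_set >>.
Proof.
apply/seteqP; split; last first.
  by apply: smallest_sub => [|A []//]; exact: sigma_algebra_measurable.
have mid : measurable_fun setT (id : g_sigma_algebraType trig_set -> torus R n).
  apply/measurable_fun_tnthP => i.
  apply: (measurability _ (@RGenInftyO.measurableE R)) => _ [_ [b ->] <-].
  apply: sub_sigma_algebra; rewrite setTI.
  refine (eq_ind _ trig_set (trig_set_lt i b) _ _).
  by apply/seteqP; split => x /=; rewrite in_itv.
move=> A mA; have := mid measurableT A mA.
by rewrite setTI.
Qed.

(** Orthogonality to the basis extends to all trigonometric polynomials and then, by dominated
    convergence, to indicators of the sets in [trig_set], which generate the measurable sets. *)
Lemma torus_complete (f : torus R n -> R) : intg mt f ->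
  (forall j, \int[mt]_x (f x * fourier j x) = 0) -> {ae mt, forall x, f x = 0}.
Proof.
move=> If f0.
have Ifb j : intg mt (fun x => f x * fourier j x).
  under eq_fun do rewrite mulrC.
  by apply: (@intg_bddM _ _ _ _ _ _ (2 ^+ n)) => //;
    [exact: measurable_fourier|move=> x; exact: fourier_bound].
have fS p : trig_span p -> \int[mt]_x (f x * p x) = 0.
  move=> [J [c pc]].
  transitivity (\int[mt]_x \sum_(j < J) (c j * (f x * fourier j x))).
    apply: eq_Rintegral => x _; rewrite pc mulr_sumr; apply: eq_bigr => j _; ring.
  rewrite Rint_sum => [|j]; last exact: intgZ.
  by rewrite big1// => j _; rewrite RintegralZl//; [rewrite [X in _ * X]f0 mulr0|exact: Ifb].
apply: (ae_eq0_pi_system trig_set_gen trig_setI If).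
  by have := fS _ trig_span1; under eq_Rintegral do rewrite mulr1.
move=> A [mA [p [pA p01 pc]]]; rewrite -Rint_indic//.
have cv : \int[mt]_x (f x * p m x) @[m --> \oo] --> \int[mt]_x (f x * \1_A x).
  apply: (@Rint_DCT _ _ _ _ _ _ (fun x => `|f x|)).
  - move=> m; apply: measurable_funM; first exact: intg_meas If.
    by apply: measurable_trig_span; apply: trig_alg_span; exact: pA.
  - by apply: measurable_funM => //; exact: intg_meas If.
  - by apply: filterS pc => x px; apply: cvgMl_tmp.
  - exact: intg_norm.
  - apply: nearW => x m; have /andP[p0 p1] := p01 m x.
    by rewrite normrM ler_piMr// ger0_norm.
rewrite -(cvg_lim _ cv)// (_ : (fun _ => _) = cst 0) ?lim_cst//.
by apply/funext => m; apply: fS; exact: trig_alg_span.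
Qed.

End torus_complete.

(** * Fourier series in one factor of a product *)

Section hilbert_L2.
Context d (X : measurableType d) {R : realType} (m : {finite_measure set X -> \bar R}).

Lemma L2ip_sqr (u : LfunType m (lee1n 2)) : L2ip u u = \int[m]_x (u x ^+ 2).
Proof. by apply: eq_Rintegral => x _; rewrite expr2. Qed.

Lemma Rint_CS (f g : X -> R) : sqint m f -> sqint m g ->
  (\int[m]_x (f x * g x)) ^+ 2 <= \int[m]_x (f x ^+ 2) * \int[m]_x (g x ^+ 2).
Proof.
move=> f2 g2; have := ip_CS (@L2ipC _ _ _ m) (@L2ipDl _ _ _ m) (@L2ipZl _ _ _ m)
  (@L2ip_ge0 _ _ _ m) (L2of f2) (L2of g2).
by rewrite !L2ip_sqr.
Qed.

Lemma sqint_weakly_bounded (f : nat -> X -> R) : (forall n, sqint m (f n)) ->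
  (forall g, sqint m g -> exists C, forall n, `|\int[m]_x (f n x * g x)| <= C) ->
  exists C, forall n, \int[m]_x (f n x ^+ 2) <= C.
Proof.
move=> f2 fb; have [g|C Cb] := weakly_bounded (@L2ipC _ _ _ m) (@L2ipDl _ _ _ m) (@L2ipZl _ _ _ m)
  (@L2ip_ge0 _ _ _ m) (@LfunType2_complete _ _ _ m) (f := fun n => L2of (f2 n)).
  exact: fb (LfunType_sqint g).
by exists C => n; have := Cb n; rewrite L2ip_sqr.
Qed.

Lemma sqint_riesz (D : set (X -> R)) (l : (X -> R) -> R) (C : R) :
  D (fun=> 0) -> (forall f, D f -> sqint m f) ->
  (forall a f g, D f -> D g -> D (fun x => a * f x + g x)) ->
  (forall a f g, D f -> D g -> l (fun x => a * f x + g x) = a * l f + l g) ->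
  (forall f, D f -> l f ^+ 2 <= C * \int[m]_x (f x ^+ 2)) ->
  exists v, [/\ sqint m v,
    forall e : R, 0 < e -> exists2 f, D f & \int[m]_x ((f x - v x) ^+ 2) < e &
    forall f, D f -> \int[m]_x (v x * f x) = l f].
Proof.
move=> D0 D2 Dlin llin lC.
have [||||v [vD vl]] := riesz (@L2ipC _ _ _ m) (@L2ipDl _ _ _ m) (@L2ipZl _ _ _ m)
  (@L2ip_ge0 _ _ _ m) (@LfunType2_complete _ _ _ m)
  (D := [set u : LfunType m (lee1n 2) | D u]) (l := fun u => l u) (C := C).
- exact: D0.
- move=> a u v Du Dv; exact: (Dlin a u v Du Dv).
- move=> a u v Du Dv; exact: (llin a u v Du Dv).
- by move=> u Du; rewrite L2ip_sqr; exact: lC.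
exists v; split; first exact: LfunType_sqint.
- by move=> e /vD[u Du]; rewrite L2ip_sqr; exists u.
- by move=> f Df; rewrite -(vl (L2of (D2 _ Df))).
Qed.

End hilbert_L2.

Section parseval.
Context dY (Y : measurableType dY) {R : realType} (my : {finite_measure set Y -> \bar R}).
Variables (e : nat -> Y -> R) (B : R).
Hypothesis me : forall j, measurable_fun setT (e j).
Hypothesis eB : forall j y, `|e j y| <= B.
Hypothesis e_ortho : forall i j, i != j -> \int[my]_y (e i y * e j y) = 0.
Hypothesis e_norm : forall j, \int[my]_y (e j y * e j y) = 1 \/ \int[my]_y (e j y * e j y) = 0.
Hypothesis e_complete : forall f, intg my f ->
  (forall j, \int[my]_y (f y * e j y) = 0) -> {ae my, forall y, f y = 0}.

Lemma sqint_e j : sqint my (e j).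
Proof. exact: sqint_bdd (me j) (eB j). Qed.

Let E j := L2of (sqint_e j).
Let E_ortho i j : i != j -> L2ip (E i) (E j) = 0. Proof. exact: e_ortho. Qed.
Let E_norm j : L2ip (E j) (E j) = 1 \/ L2ip (E j) (E j) = 0. Proof. exact: e_norm. Qed.

Lemma bessel_L2 (f : Y -> R) J : sqint my f ->
  \sum_(j < J) (\int[my]_y (f y * e j y)) ^+ 2 <= \int[my]_y (f y ^+ 2).
Proof.
move=> f2; have := bessel (@L2ipC _ _ _ my) (@L2ipDl _ _ _ my) (@L2ipZl _ _ _ my)
  (@L2ip_ge0 _ _ _ my) E_ortho E_norm (L2of f2) J.
by rewrite L2ip_sqr.
Qed.

(** The Riesz representative [v] of [f] on the span lies in the closure of the span and has the
    coefficients of [f], so it equals [f] by completeness. Hence finite combinations approach [f],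
    and [bessel_best] converts this into convergence of the squared coefficients. *)
Lemma parseval_L2 (f : Y -> R) : sqint my f ->
  \sum_(j < J) (\int[my]_y (f y * e j y)) ^+ 2 @[J --> \oo] --> \int[my]_y (f y ^+ 2).
Proof.
move=> f2.
pose D := [set g : Y -> R | exists J (c : nat -> R), forall y, g y = \sum_(j < J) c j * e j y].
pose l (g : Y -> R) := \int[my]_y (f y * g y).
have D2 g : D g -> sqint my g.
  move=> [J [c /funext ->]]; elim: J => [|J IH].
    by under eq_fun do rewrite big_ord0; exact: sqint_cst.
  under eq_fun do rewrite big_ord_recr/=; apply: sqintD => //.
  exact: sqintZ (sqint_e J).
have wid J K (c : nat -> R) : (J <= K)%N -> forall y, \sum_(j < J) c j * e j y =
    \sum_(j < K) (if (j < J)%N then c j else 0) * e j y.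
  move=> JK y; rewrite (big_ord_widen K (fun j => c j * e j y))// big_mkcond.
  by apply: eq_bigr => j _; case: ifP; rewrite ?mul0r.
have [|||||v [v2 vD vl]] := @sqint_riesz _ Y R my D l (\int[my]_y (f y ^+ 2)).
- by exists 0%N, (fun=> 0) => y; rewrite big_ord0.
- exact: D2.
- move=> a g h [J [c gc]] [K [c' hc]]; exists (maxn J K).
  exists (fun j => a * (if (j < J)%N then c j else 0) + (if (j < K)%N then c' j else 0)) => y.
  rewrite gc hc (wid J _ _ (leq_maxl J K)) (wid K _ _ (leq_maxr J K)) mulr_sumr -big_split.
  by apply: eq_bigr => j _; rewrite mulrDl mulrA.
- move=> a g h Dg Dh; rewrite /l -RintegralZl//; last exact: intgM (D2 _ Dg).
  rewrite -RintegralD//; [|apply: intgZ; exact: intgM (D2 _ Dg)|exact: intgM (D2 _ Dh)].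
  by apply: eq_Rintegral => y _; ring.
- by move=> g Dg; apply: Rint_CS => //; exact: D2.
have fv : {ae my, forall y, f y - v y = 0}.
  apply: e_complete; first by apply: sqint_intg; exact: sqintB.
  move=> j; under eq_Rintegral do rewrite mulrBl.
  rewrite RintegralB//; [|exact: intgM (sqint_e j)..].
  rewrite (vl (e j)) ?subrr//.
  exists j.+1, (fun i => (i == j)%:R) => y; rewrite big_ord_recr/= eqxx mul1r big1 ?add0r// => i _.
  by rewrite ltn_eqF ?mul0r.
apply/cvgrPdist_le => x x0.
have [g [J [c gc]] gx] := vD x x0.
exists J => // K /= JK; rewrite ger0_norm; last by rewrite subr_ge0; exact: bessel_L2.
pose d (j : nat) := if (j < J)%N then c j else 0.
have gd y : g y = \sum_(j < K) d j * e j y by rewrite gc (wid J K).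
have := bessel_best (@L2ipC _ _ _ my) (@L2ipDl _ _ _ my) (@L2ipZl _ _ _ my)
  (@L2ip_ge0 _ _ _ my) E_ortho E_norm (L2of f2) d K.
rewrite (L2ip_sqr (L2of f2)).
have -> : L2ip (L2of f2 - \sum_(j < K) d j *: E j) (L2of f2 - \sum_(j < K) d j *: E j) =
    \int[my]_y ((g y - v y) ^+ 2).
  have sE y : (\sum_(j < K) d j *: E j) y = g y.
    rewrite gd; elim/big_rec2 : _ => [//|j a b _ <- ] //.
  have gm : sqint my g by apply: D2; exists J, c.
  rewrite /L2ip; apply: ae_eq_Rint.
  - by apply: measurable_funM; exact: sqint_meas (LfunType_sqint _).
  - by apply: measurable_funX; apply: measurable_funB; [exact: sqint_meas gm|exact: sqint_meas v2].
  - apply: filterS fv => y /subr0_eq fvy.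
    rewrite -expr2 -[LHS]/((f y - (\sum_(j < K) d j *: E j) y) ^+ 2) sE fvy.
    by rewrite -sqrrN opprB.
by move=> h; rewrite lerBlDl; apply: le_trans h _; rewrite lerD2l ltW.
Qed.

End parseval.

Section product_coef.
Context dX (X : measurableType dX) dY (Y : measurableType dY) {R : realType}.
Variables (mx : {finite_measure set X -> \bar R}) (my : {finite_measure set Y -> \bar R}).
Variable m : {finite_measure set (X * Y)%type -> \bar R}.
Hypothesis mE : forall A, measurable A -> m A = (mx \x my)%E A.
Variables (e : nat -> Y -> R) (B : R).
Hypothesis me : forall j, measurable_fun setT (e j).
Hypothesis eB : forall j y, `|e j y| <= B.
Hypothesis e_ortho : forall i j, i != j -> \int[my]_y (e i y * e j y) = 0.
Hypothesis e_norm : forall j, \int[my]_y (e j y * e j y) = 1 \/ \int[my]_y (e j y * e j y) = 0.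
Hypothesis e_complete : forall f, intg my f ->
  (forall j, \int[my]_y (f y * e j y) = 0) -> {ae my, forall y, f y = 0}.
Implicit Types f g : X * Y -> R.

Lemma intg_prod f : intg m f <-> intg (mx \x my)%E f.
Proof.
have E : (\int[m]_x `|(f x)%:E| = \int[(mx \x my)%E]_x `|(f x)%:E|)%E.
  by apply: eq_measure_integral => A mA _; exact: mE.
split=> /integrableP[mf foo]; apply/integrableP; split => //=.
  by rewrite -E.
by rewrite E.
Qed.

Lemma Rint_prod f : \int[m]_p f p = \int[(mx \x my)%E]_p f p.
Proof. by congr fine; apply: eq_measure_integral => A mA _; exact: mE. Qed.

Lemma Rint_iter f : intg m f -> \int[m]_p f p = \int[mx]_x \int[my]_y f (x, y).
Proof. by move=> If; rewrite Rint_prod Rfubini1//; exact/intg_prod. Qed.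

Lemma intg_iter f : intg m f -> intg mx (fun x => \int[my]_y f (x, y)).
Proof. by move=> If; apply: intg_Rfubini1; exact/intg_prod. Qed.

Lemma ae_intg_sec f : intg m f -> {ae mx, forall x, intg my (fun y => f (x, y))}.
Proof. by move=> If; apply: (ae_intgl (m1 := mx)); exact/intg_prod. Qed.

Lemma ae_sqint_sec f : sqint m f -> {ae mx, forall x, sqint my (fun y => f (x, y))}.
Proof.
move=> [mf f2]; apply: filterS (ae_intg_sec f2) => x Ix; split => //.
exact: measurable_secl.
Qed.

Lemma sqint_fst (a : X -> R) : sqint mx a -> sqint m (fun p => a p.1).
Proof.
move=> [ma a2]; split; first exact: measurableT_comp.
apply/intg_prod; have := intg_tensor a2 (intg_cst my 1).
by under eq_fun do rewrite mulr1.
Qed.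

Lemma Rint_fst (a : X -> R) : intg mx a ->
  \int[m]_p (a p.1) = (\int[mx]_x a x) * fine (my setT).
Proof.
move=> Ia; have I1 : intg m (fun p => a p.1).
  apply/intg_prod; have := intg_tensor Ia (intg_cst my 1).
  by under eq_fun do rewrite mulr1.
rewrite Rint_iter// -RintegralZr//; apply: eq_Rintegral => x _ /=.
by rewrite Rintegral_cst.
Qed.

Lemma measurable_snd_e j : measurable_fun setT (fun p : (X * Y)%type => e j p.2).
Proof. exact: measurableT_comp. Qed.

Lemma sqint_Me f j : sqint m f -> sqint m (fun p => f p * e j p.2).
Proof.
move=> f2; under eq_fun do rewrite mulrC.
by apply: (@sqint_bddM _ _ _ _ (fun p => e j p.2) f B) => //; exact: measurable_snd_e.
Qed.

Definition coef f j x := \int[my]_y (f (x, y) * e j y).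

Lemma intg_coef f j : sqint m f -> intg mx (coef f j).
Proof. by move=> f2; exact: intg_iter (sqint_intg (sqint_Me j f2)). Qed.

Lemma ae_coef_le f j : sqint m f ->
  {ae mx, forall x, coef f j x ^+ 2 <= \int[my]_y (f (x, y) ^+ 2)}.
Proof.
move=> f2; apply: filterS (ae_sqint_sec f2) => x fx2.
have := bessel_L2 me eB e_ortho e_norm j.+1 fx2.
rewrite big_ord_recr/=; apply: le_trans; rewrite lerDr sumr_ge0// => i _.
exact: sqr_ge0.
Qed.

Lemma sqint_coef f j : sqint m f -> sqint mx (coef f j).
Proof.
move=> f2; have mc := intg_meas (intg_coef j f2); split => //.
apply: (@ae_le_intg _ _ _ _ _ (fun x => \int[my]_y (f (x, y) ^+ 2))).
- exact: measurable_funX.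
- by apply: filterS (ae_coef_le j f2) => x; rewrite ger0_norm// sqr_ge0.
- exact: (intg_iter (sqint_sqr f2)).
Qed.

Lemma ae_coefD f g j a : sqint m f -> sqint m g ->
  {ae mx, forall x, coef (fun p => f p + a * g p) j x = coef f j x + a * coef g j x}.
Proof.
move=> f2 g2; apply: filterS2 (ae_sqint_sec f2) (ae_sqint_sec g2) => x fx gx.
have Ifx := intgM fx (sqint_e my me eB j); have Igx := intgM gx (sqint_e my me eB j).
rewrite /coef -RintegralZl// -RintegralD//; last exact: intgZ.
by apply: eq_Rintegral => y _; ring.
Qed.

Lemma Rint_coef f j (a : X -> R) : sqint m f -> sqint mx a ->
  \int[mx]_x (a x * coef f j x) = \int[m]_p (f p * (a p.1 * e j p.2)).
Proof.
move=> f2 a2; have fa := intgM (sqint_Me j f2) (sqint_fst a2).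
have -> : \int[m]_p (f p * (a p.1 * e j p.2)) = \int[m]_p (f p * e j p.2 * a p.1).
  by apply: eq_Rintegral => p _; ring.
rewrite Rint_iter//; apply: ae_eq_Rint.
- by apply: measurable_funM; [exact: sqint_meas a2|exact: intg_meas (intg_coef j f2)].
- exact: intg_meas (intg_iter fa).
- apply: filterS (ae_intg_sec (sqint_intg (sqint_Me j f2))) => x Ix.
  by rewrite /= RintegralZr// mulrC.
Qed.

Lemma Rint_coef_bdd f j (a : X -> R) C : sqint m f ->
  measurable_fun setT a -> (forall x, `|a x| <= C) ->
  \int[mx]_x (a x * coef f j x) = \int[m]_p (f p * (a p.1 * e j p.2)).
Proof. by move=> f2 ma aC; apply: Rint_coef => //; exact: sqint_bdd ma aC. Qed.

Lemma bessel_prod f J : sqint m f ->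
  \sum_(j < J) \int[mx]_x (coef f j x ^+ 2) <= \int[m]_p (f p ^+ 2).
Proof.
move=> f2; rewrite (Rint_iter (sqint_sqr f2)).
rewrite -(Rint_sum (index_enum 'I_J) (F := fun j x => coef f j x ^+ 2)); last first.
  by move=> j; exact: sqint_sqr (sqint_coef j f2).
apply: ae_le_Rint; [|exact: (intg_iter (sqint_sqr f2))|].
  by apply: intg_sum => j; exact: sqint_sqr (sqint_coef j f2).
apply: filterS (ae_sqint_sec f2) => x fx2.
exact: (bessel_L2 me eB e_ortho e_norm J fx2).
Qed.

(** Parseval on almost every section; by Bessel the partial sums are dominated by the squared norm
    of the section. *)
Lemma parseval_prod f : sqint m f ->
  \sum_(j < J) \int[mx]_x (coef f j x ^+ 2) @[J --> \oo] --> \int[m]_p (f p ^+ 2).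
Proof.
move=> f2; rewrite (Rint_iter (sqint_sqr f2)).
have E J : \sum_(j < J) \int[mx]_x (coef f j x ^+ 2) = \int[mx]_x \sum_(j < J) coef f j x ^+ 2.
  rewrite (Rint_sum (index_enum 'I_J) (F := fun j x => coef f j x ^+ 2))// => j.
  exact: sqint_sqr (sqint_coef j f2).
under eq_fun do rewrite E.
apply: (@Rint_DCT _ _ _ mx (fun J x => \sum_(j < J) coef f j x ^+ 2) _
  (fun x => \int[my]_y (f (x, y) ^+ 2))).
- by move=> J; apply: measurable_sum => j; exact: intg_meas (sqint_sqr (sqint_coef j f2)).
- exact: intg_meas (intg_iter (sqint_sqr f2)).
- apply: filterS (ae_sqint_sec f2) => x fx2.
  exact: (parseval_L2 me eB e_ortho e_norm e_complete fx2).
- exact: (intg_iter (sqint_sqr f2)).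
- apply: filterS (ae_sqint_sec f2) => x fx2 J.
  rewrite ger0_norm ?sumr_ge0// => [|j _]; last exact: sqr_ge0.
  exact: (bessel_L2 me eB e_ortho e_norm J fx2).
Qed.

(** Polarisation of [parseval_prod], through [f + g] and [f - g]. *)
Lemma parseval_prodM f g : sqint m f -> sqint m g ->
  \sum_(j < J) \int[mx]_x (coef f j x * coef g j x) @[J --> \oo] --> \int[m]_p (f p * g p).
Proof.
move=> f2 g2.
have s2 a : sqint m (fun p => f p + a * g p) by apply: sqintD => //; exact: sqintZ.
have E a j : \int[mx]_x (coef (fun p => f p + a * g p) j x ^+ 2) =
    \int[mx]_x (coef f j x ^+ 2) + 2 * a * \int[mx]_x (coef f j x * coef g j x)
      + a ^+ 2 * \int[mx]_x (coef g j x ^+ 2).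
  transitivity (\int[mx]_x ((coef f j x + a * coef g j x) ^+ 2)).
    apply: ae_eq_Rint.
    - exact: intg_meas (sqint_sqr (sqint_coef j (s2 a))).
    - apply: measurable_funX; apply: measurable_funD; first exact: intg_meas (intg_coef j f2).
      by apply: measurable_funM => //; exact: intg_meas (intg_coef j g2).
    - by apply: filterS (ae_coefD j a f2 g2) => x ->.
  have cf := sqint_coef j f2; have cg := sqint_coef j g2.
  rewrite Rint_sqrD//; last exact: sqintZ.
  under [X in 2 * X]eq_Rintegral do rewrite mulrCA.
  rewrite RintegralZl//; last exact: intgM.
  under [X in _ + X = _]eq_Rintegral do rewrite exprMn.
  rewrite RintegralZl//; last exact: sqint_sqr.
  by rewrite mulrA.
have F a : \int[m]_p ((f p + a * g p) ^+ 2) =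
    \int[m]_p (f p ^+ 2) + 2 * a * \int[m]_p (f p * g p) + a ^+ 2 * \int[m]_p (g p ^+ 2).
  rewrite Rint_sqrD//; last exact: sqintZ.
  under [X in 2 * X]eq_Rintegral do rewrite mulrCA.
  rewrite RintegralZl//; last exact: intgM.
  under [X in _ + X = _]eq_Rintegral do rewrite exprMn.
  rewrite RintegralZl//; last exact: sqint_sqr.
  by rewrite mulrA.
have cv : (4^-1 * (\sum_(j < J) \int[mx]_x (coef (fun p => f p + 1 * g p) j x ^+ 2) -
    \sum_(j < J) \int[mx]_x (coef (fun p => f p + (-1) * g p) j x ^+ 2))) @[J --> \oo] -->
  4^-1 * (\int[m]_p ((f p + 1 * g p) ^+ 2) - \int[m]_p ((f p + (-1) * g p) ^+ 2)).
  by apply: cvgMl_tmp; apply: cvgB; exact: parseval_prod.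
rewrite (_ : \int[m]_p (f p * g p) = 4^-1 *
  (\int[m]_p ((f p + 1 * g p) ^+ 2) - \int[m]_p ((f p + (-1) * g p) ^+ 2))); last first.
  by rewrite !F; move: (\int[m]_p _) (\int[m]_p _) (\int[m]_p _) => u v w; field.
apply: cvg_trans cv; apply: near_eq_cvg; apply: nearW => J.
rewrite -sumrB mulr_sumr; apply: eq_bigr => j _; rewrite !E.
by move: (\int[mx]_x _) (\int[mx]_x _) (\int[mx]_x _) => u v w; field.
Qed.

End product_coef.

(** * The evolution equation, mode by mode *)

Lemma cvg_sum_ord (R : realType) (f : nat -> nat -> R) (a : nat -> R) J :
  (forall j, f j n @[n --> \oo] --> a j) ->
  \sum_(j < J) f j n @[n --> \oo] --> \sum_(j < J) a j.
Proof.
move=> fa; elim: J => [|J IH].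
  by under eq_fun do rewrite big_ord0; rewrite big_ord0; exact: cvg_cst.
by under eq_fun do rewrite big_ord_recr/=; rewrite big_ord_recr/=; apply: cvgD.
Qed.

Lemma measurable_sqrtr d (X : measurableType d) (R : realType) (f : X -> R) :
  measurable_fun setT f -> measurable_fun setT (fun x => Num.sqrt (f x)).
Proof.
move=> mf; apply: (measurableT_comp (f := @Num.sqrt R)) => //.
by apply: continuous_measurable_fun; exact: sqrt_continuous.
Qed.

(** * Limits of products in L^2 *)

Section L2_limits.
Context d (X : measurableType d) {R : realType} (m : {finite_measure set X -> \bar R}).
Implicit Types f g : X -> R.

Lemma sqrt_cvg0 (u : nat -> R) : (forall n, 0 <= u n) -> u n @[n --> \oo] --> 0 ->
  Num.sqrt (u n) @[n --> \oo] --> 0.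
Proof.
move=> u0 uc; have -> : (0 : R) = Num.sqrt 0 by rewrite sqrtr0.
by apply: continuous_cvg => //; exact: sqrt_continuous.
Qed.

Lemma Rint_CS_sqrt f g : sqint m f -> sqint m g ->
  `|\int[m]_x (f x * g x)| <= Num.sqrt (\int[m]_x (f x ^+ 2) * \int[m]_x (g x ^+ 2)).
Proof. by move=> f2 g2; rewrite -sqrtr_sqr ler_wsqrtr//; exact: Rint_CS. Qed.

Lemma cvg0_CS (f g : nat -> X -> R) C : (forall n, sqint m (f n)) -> (forall n, sqint m (g n)) ->
  (forall n, \int[m]_x (f n x ^+ 2) <= C) ->
  \int[m]_x (g n x ^+ 2) @[n --> \oo] --> 0 ->
  \int[m]_x (f n x * g n x) @[n --> \oo] --> 0.
Proof.
move=> f2 g2 fC gc; apply/norm_cvg0P.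
have C0 : 0 <= C by apply: le_trans (fC 0%N); exact: Rint_sqr_ge0.
have h : Num.sqrt (C * \int[m]_x (g n x ^+ 2)) @[n --> \oo] --> 0.
  apply: sqrt_cvg0; first by move=> n; rewrite mulr_ge0// Rint_sqr_ge0.
  by rewrite -(mulr0 C); exact: cvgMl_tmp.
apply: (@squeeze_cvgr _ _ _ _ (cst 0) _ _ _ _ _ h); last exact: cvg_cst.
apply: nearW => n; rewrite normr_ge0/=; apply: le_trans (Rint_CS_sqrt (f2 n) (g2 n)) _.
by rewrite ler_wsqrtr// ler_wpM2r// Rint_sqr_ge0.
Qed.

Definition trunc (k : nat) f x := if `|f x| <= k%:R then f x else 0.

Lemma measurable_trunc k f : measurable_fun setT f -> measurable_fun setT (trunc k f).
Proof.
move=> mf; apply: measurable_fun_ifT => //.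
by apply: measurable_fun_ler => //; exact: measurableT_comp.
Qed.

Lemma trunc_bound k f x : `|trunc k f x| <= k%:R.
Proof. by rewrite /trunc; case: ifP => // _; rewrite normr0. Qed.

Lemma cvg_trunc f : sqint m f -> \int[m]_x ((f x - trunc k f x) ^+ 2) @[k --> \oo] --> 0.
Proof.
move=> f2; have mf := sqint_meas f2.
have -> : (0 : R) = \int[m]_x (0 : R) by rewrite Rintegral_cst// mul0r.
apply: (@Rint_DCT _ _ _ _ _ _ (fun x => f x ^+ 2)) => //.
- move=> k; apply: measurable_funX; apply: measurable_funB => //.
  exact: measurable_trunc.
- apply: nearW => x; apply: cvg_near_cst.
  exists (Num.truncn `|f x|).+1 => // k /= fk.
  rewrite /trunc ifT ?subrr ?expr0n//.
  have /andP[_ /ltW h] := truncn_itv (normr_ge0 (f x)).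
  by apply: le_trans h _; rewrite ler_nat.
- exact: sqint_sqr.
- apply: nearW => x k; rewrite ger0_norm ?sqr_ge0// /trunc; case: ifP => _.
    by rewrite subrr expr0n sqr_ge0.
  by rewrite subr0.
Qed.

(** Truncations of [g] are bounded and approach it in L^2; as [v] is bounded in L^2, the error is
    uniform in [n]. *)
Lemma weak0_bdd (v : nat -> X -> R) C : (forall n, sqint m (v n)) ->
  (forall n, \int[m]_x (v n x ^+ 2) <= C) ->
  (forall (psi : X -> R) k, measurable_fun setT psi -> (forall x, `|psi x| <= k) ->
     \int[m]_x (v n x * psi x) @[n --> \oo] --> 0) ->
  forall g, sqint m g -> \int[m]_x (v n x * g x) @[n --> \oo] --> 0.
Proof.
move=> v2 vC vpsi g g2; have mg := sqint_meas g2.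
have C0 : 0 <= C by apply: le_trans (vC 0%N); exact: Rint_sqr_ge0.
apply/cvgrPdist_lt => x x0.
have h : Num.sqrt (C * \int[m]_x ((g x - trunc k g x) ^+ 2)) @[k --> \oo] --> 0.
  apply: sqrt_cvg0; first by move=> k; rewrite mulr_ge0// Rint_sqr_ge0.
  by rewrite -(mulr0 C); apply: cvgMl_tmp; exact: cvg_trunc.
have /cvgrPdist_lt /(_ (x / 2)) := h; case; first by rewrite divr_gt0.
move=> k _ /(_ k (leqnn k)); rewrite /= sub0r normrN ger0_norm ?sqrtr_ge0// => kx.
have mt := measurable_trunc k mg.
have tb := trunc_bound k g.
have t2 : sqint m (trunc k g) by exact: sqint_bdd mt tb.
have /cvgrPdist_lt /(_ (x / 2)) := vpsi _ _ mt tb; case; first by rewrite divr_gt0.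
move=> n0 _ n0P; exists n0 => // n nn; have := n0P n nn; rewrite /= !sub0r !normrN => h1.
have -> : \int[m]_x (v n x * g x) = \int[m]_x (v n x * trunc k g x) +
    \int[m]_x (v n x * (g x - trunc k g x)).
  rewrite -RintegralD//; [|exact: intgM (v2 n) t2|exact: intgM (v2 n) (sqintB g2 t2)].
  by apply: eq_Rintegral => y _; ring.
apply: le_lt_trans (ler_normD _ _) _; rewrite [ltRHS]splitr; apply: ltr_leD => //.
apply: le_trans (ltW kx); apply: le_trans (Rint_CS_sqrt (v2 n) (sqintB g2 t2)) _.
by rewrite ler_wsqrtr// ler_wpM2r// Rint_sqr_ge0.
Qed.

(** Replacing [g] by a truncation [c], one has [(h g)^2 <= 2 h^2 (g - c)^2 + 2 c^2 h^2]: the first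
    term is small because [h] is uniformly bounded, the second because [c] is bounded and [h] tends
    to 0 in L^2. *)
Lemma cvg0_sqrM (h : nat -> X -> R) H g : (forall n, measurable_fun setT (h n)) ->
  (forall n x, `|h n x| <= H) -> \int[m]_x (h n x ^+ 2) @[n --> \oo] --> 0 ->
  sqint m g -> \int[m]_x ((h n x * g x) ^+ 2) @[n --> \oo] --> 0.
Proof.
move=> mh hH h0 g2; have mg := sqint_meas g2.
apply/cvgrPdist_lt => x x0.
have c1 : 2 * H ^+ 2 * \int[m]_x ((g x - trunc k g x) ^+ 2) @[k --> \oo] --> 0.
  by rewrite -(mulr0 (2 * H ^+ 2)); apply: cvgMl_tmp; exact: cvg_trunc.
have /cvgrPdist_lt /(_ (x / 2)) := c1; case; first by rewrite divr_gt0.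
move=> k _ /(_ k (leqnn k)) /=; rewrite sub0r normrN ger0_norm; last first.
  by apply: mulr_ge0; [apply: mulr_ge0 => //; exact: sqr_ge0|exact: Rint_sqr_ge0].
move=> kx.
have mt := measurable_trunc k mg.
have tb := trunc_bound k g.
have t2 : sqint m (trunc k g) by exact: sqint_bdd mt tb.
have h2 n : sqint m (h n) by exact: sqint_bdd (mh n) (hH n).
have c2 : 2 * k%:R ^+ 2 * \int[m]_x (h n x ^+ 2) @[n --> \oo] --> 0.
  by rewrite -(mulr0 (2 * k%:R ^+ 2)); exact: cvgMl_tmp.
have /cvgrPdist_lt /(_ (x / 2)) := c2; case; first by rewrite divr_gt0.
move=> n0 _ n0P; exists n0 => // n nn; have := n0P n nn; rewrite /= !sub0r !normrN.
have k0 : 0 <= 2 * k%:R ^+ 2 * \int[m]_x (h n x ^+ 2).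
  by apply: mulr_ge0; [apply: mulr_ge0 => //; exact: sqr_ge0|exact: Rint_sqr_ge0].
rewrite (ger0_norm k0) ger0_norm ?Rint_sqr_ge0//.
move=> h1; rewrite [ltRHS]splitr; apply: le_lt_trans (ltrD kx h1).
have gt2 := sqintB g2 t2.
rewrite -!RintegralZl//; [|exact: sqint_sqr..].
rewrite -RintegralD//; [|exact: intgZ (sqint_sqr _)..].
apply: le_Rintegral => //.
- exact: sqint_sqr (sqint_bddM (mh n) (hH n) g2).
- by apply: intgD; exact: intgZ (sqint_sqr _).
move=> y _; have : h n y ^+ 2 <= H ^+ 2.
  by rewrite -[leLHS]real_normK ?num_real// ler_sqr ?nnegrE ?(le_trans _ (hH n y))// hH.
have : trunc k g y ^+ 2 <= k%:R ^+ 2.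
  by rewrite -[leLHS]real_normK ?num_real// ler_sqr ?nnegrE// trunc_bound.
move: (h n y) (g y) (trunc k g y) => a b c l1 l2.
have q1 : a ^+ 2 * (b - c) ^+ 2 <= H ^+ 2 * (b - c) ^+ 2 by rewrite ler_wpM2r ?sqr_ge0.
have q2 : c ^+ 2 * a ^+ 2 <= k%:R ^+ 2 * a ^+ 2 by rewrite ler_wpM2r ?sqr_ge0.
apply: (@le_trans _ _ (2 * (a ^+ 2 * (b - c) ^+ 2) + 2 * (c ^+ 2 * a ^+ 2))); last by lra.
rewrite -subr_ge0 (_ : _ - _ = (a * (b - c) - a * c) ^+ 2) ?sqr_ge0//.
by ring.
Qed.

End L2_limits.

(** * Smooth approximation of the positive part *)

Section cutoff.
Context {R : realType}.

(** Uniformly in [eps], it stays below the positive part of [x] and its derivative [dramp] stays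
    below 1, which supplies the dominating functions when [eps] tends to 0. *)
Definition ramp (eps x : R) : R := if 0 < x then x * expR (- eps / x) else 0.
Definition dramp (eps x : R) : R := if 0 < x then (1 + eps / x) * expR (- eps / x) else 0.

Lemma measurable_if_pos (f : R -> R) : (forall x, 0 < x -> {for x, continuous f}) ->
  measurable_fun [set: R] (fun x => if 0 < x then f x else 0).
Proof.
move=> cf; have -> : (fun x => if 0 < x then f x else 0) = f \_ `]0, +oo[%classic.
  apply/funext => x; rewrite patchE; case: ifPn => x0.
    by rewrite mem_set//= in_itv/= x0.
  by rewrite memNset//= in_itv/= andbT; exact/negP.
have mI : measurable (`]0, +oo[%classic : set R) by [].
apply/(measurable_restrictT f mI).
apply: open_continuous_measurable_fun; first exact: interval_open.
by move=> x; rewrite inE/= in_itv/= andbT; exact: cf.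
Qed.

Let continuous_exp_div (eps x : R) : 0 < x -> {for x, continuous (fun y : R => expR (- eps / y))}.
Proof.
move=> x0; apply: continuous_comp; last exact: continuous_expR.
by apply: cvgMl_tmp; apply: inv_continuous; rewrite gt_eqF.
Qed.

Lemma measurable_ramp eps : measurable_fun setT (ramp eps : measurableTypeR R -> R).
Proof.
apply: measurable_if_pos => x x0; apply: cvgM; first exact: cvg_id.
exact: continuous_exp_div.
Qed.

Lemma measurable_dramp eps : measurable_fun setT (dramp eps : measurableTypeR R -> R).
Proof.
apply: measurable_if_pos => x x0; apply: cvgM; last exact: continuous_exp_div.
apply: cvgD; first exact: cvg_cst.
by apply: cvgMl_tmp; apply: inv_continuous; rewrite gt_eqF.
Qed.

Lemma ramp_bound eps x : 0 <= eps -> `|ramp eps x| <= Num.max 0 x.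
Proof.
move=> e0; rewrite /ramp; case: ifPn => [x0|]; last by rewrite normr0 le_max lexx.
rewrite ger0_norm ?mulr_ge0 ?expR_ge0 ?(ltW x0)// le_max ler_piMr ?orbT ?(ltW x0)//.
by rewrite -expR0 ler_expR mulNr oppr_le0 divr_ge0// ltW.
Qed.

(** With [y = eps / x] this is [1 + y <= exp y]. *)
Lemma dramp_bound eps x : 0 <= eps -> `|dramp eps x| <= 1.
Proof.
move=> e0; rewrite /dramp; case: ifPn => [x0|]; last by rewrite normr0.
have ex : 0 <= eps / x by rewrite divr_ge0// ltW.
rewrite ger0_norm; last by rewrite mulr_ge0 ?expR_ge0// addr_ge0.
rewrite mulNr expRN ler_pdivrMr ?expR_gt0// mul1r.
exact: expR_ge1Dx.
Qed.

Let cvg_div x : (- (n.+1%:R^-1 : R) / x) @[n --> \oo] --> (0 : R).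
Proof.
have -> : (0 : R) = - 0 * x^-1 by rewrite oppr0 mul0r.
by apply: cvgMr_tmp; apply: cvgN; exact: cvg_harmonic.
Qed.

Let cvg_exp x : expR (- (n.+1%:R^-1 : R) / x) @[n --> \oo] --> (1 : R).
Proof.
rewrite -[X in _ --> X]expR0; apply: continuous_cvg; last exact: cvg_div.
exact: continuous_expR.
Qed.

Lemma cvg_ramp x : ramp n.+1%:R^-1 x @[n --> \oo] --> Num.max 0 x.
Proof.
rewrite /ramp; case: ltP => x0; last exact: cvg_cst.
by rewrite -[X in _ --> X]mulr1; apply: cvgMl_tmp; exact: cvg_exp.
Qed.

Lemma cvg_dramp x : dramp n.+1%:R^-1 x @[n --> \oo] --> ((0 < x)%R%:R : R).
Proof.
rewrite /dramp; case: ltP => x0; last exact: cvg_cst.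
rewrite -[X in _ --> X](mulr1 1); apply: cvgM; last exact: cvg_exp.
rewrite -[X in _ --> X]addr0; apply: cvgD; first exact: cvg_cst.
have -> : (0 : R) = 0 * x^-1 by rewrite mul0r.
by apply: cvgMr_tmp; exact: cvg_harmonic.
Qed.

End cutoff.

Section evolution.
Context {R : realType} (T : R).
Local Notation X := (measurableTypeR R).
Context dY (Y : measurableType dY).
Variables (time : {finite_measure set X -> \bar R}) (my : {finite_measure set Y -> \bar R}).
Variable m : {finite_measure set (X * Y)%type -> \bar R}.
Hypothesis T_gt0 : 0 < T.
Hypothesis timeE : forall A, time A = lebesgue_measure (A `&` `[0, T[%classic).
Hypothesis my1 : my setT = 1%E.
Hypothesis mE : forall A, measurable A -> m A = (time \x my)%E A.

Variables (e : nat -> Y -> R) (B : R).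
Hypothesis me : forall j, measurable_fun setT (e j).
Hypothesis eB : forall j y, `|e j y| <= B.
Hypothesis e_ortho : forall i j, i != j -> \int[my]_y (e i y * e j y) = 0.
Hypothesis e_norm : forall j, \int[my]_y (e j y * e j y) = 1 \/ \int[my]_y (e j y * e j y) = 0.
Hypothesis e_complete : forall f, intg my f ->
  (forall j, \int[my]_y (f y * e j y) = 0) -> {ae my, forall y, f y = 0}.

Variables (lam : nat -> R) (c0 : nat).
Hypothesis e_c0 : forall y, e c0 y = 1.
Hypothesis lam_c0 : lam c0 = 0.
Hypothesis lam_eq0 : forall j, lam j = 0 -> j != c0 -> forall y, e j y = 0.
Hypothesis lam_ge1 : forall j, lam j != 0 -> 1 <= lam j.
Hypothesis lam_oo : forall M, exists J, forall j, (J <= j)%N -> M <= lam j \/ forall y, e j y = 0.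

Local Notation K s t := ((s < t)%R%:R : R).
Local Notation coef := (coef my e).

#[local] Instance ae_time_filter' : Filter (nbhs (almost_everywhere time)).
Proof. exact: ae_filter_ringOfSetsType. Qed.

(* Test functions, with their time derivative, their Laplacian and their initial value. *)
Variables (I : Type) (P : set I).
Variables (tphi tdphi tlphi : I -> X * Y -> R) (tphi0 : I -> Y -> R).
Hypothesis tphi_meas : forall i, P i -> [/\ measurable_fun setT (tphi i), measurable_fun setT (tdphi i),
  measurable_fun setT (tlphi i) & measurable_fun setT (tphi0 i)].
Hypothesis tphi_bdd : forall i, P i -> exists C, [/\ forall p, `|tphi i p| <= C, forall p, `|tdphi i p| <= C,
  forall p, `|tlphi i p| <= C & forall y, `|tphi0 i y| <= C].
Hypothesis tphi_lin : forall a i j, P i -> P j -> exists2 k, P k &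
  [/\ forall p, tphi k p = a * tphi i p + tphi j p, forall p, tdphi k p = a * tdphi i p + tdphi j p,
      forall p, tlphi k p = a * tlphi i p + tlphi j p & forall y, tphi0 k y = a * tphi0 i y + tphi0 j y].
(** Equalities hold almost everywhere only, because the functions substituted for [tphi] are cut off
    outside the fundamental box to make them bounded. *)
Hypothesis tphi_ramp : forall eps tau j, 0 < eps -> 0 < tau -> tau < T -> exists2 i, P i &
  [/\ {ae m, forall p, tphi i p = ramp eps (tau - p.1) * e j p.2},
      {ae m, forall p, tdphi i p = - dramp eps (tau - p.1) * e j p.2},
      {ae m, forall p, tlphi i p = - lam j * (ramp eps (tau - p.1) * e j p.2)} &
      {ae my, forall y, tphi0 i y = ramp eps tau * e j y}].

Definition sol (mu G : X * Y -> R) (z0 : Y -> R) (z : X * Y -> R) :=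
  forall i, P i ->
    - (\int[m]_p (z p * (tdphi i p + mu p * tlphi i p))) =
    \int[my]_y (z0 y * tphi0 i y) + \int[m]_p (G p * tphi i p).

Definition ze (z0 : Y -> R) j := \int[my]_y (z0 y * e j y).

(** * Energy identity and a priori estimate for one solution *)

Section modes.
Variables (mu G z : X * Y -> R) (z0 : Y -> R) (M : R).
Hypothesis mmu : measurable_fun setT mu.
Hypothesis muM : forall p, `|mu p| <= M.
Hypothesis G2 : sqint m G.
Hypothesis z2 : sqint m z.
Hypothesis z02 : sqint my z0.
Hypothesis zsol : sol mu G z0 z.

Let b p := mu p * z p.

Lemma sqint_muz : sqint m b.
Proof. exact: sqint_bddM mmu muM z2. Qed.

Definition src j t := coef G j t - lam j * coef b j t.

Let c2 f j := @sqint_coef _ _ _ _ _ _ _ _ mE _ _ me eB e_ortho e_norm f j.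

Lemma sqint_src j : sqint time (src j).
Proof. by apply: sqintB; [exact: c2|apply: sqintZ; apply: c2; exact: sqint_muz]. Qed.

Let sqint_ramp eps tau : 0 <= eps -> tau <= T -> sqint time (fun t => ramp eps (tau - t)).
Proof.
move=> e0 tT; have mr : measurable_fun setT (fun t : X => ramp eps (tau - t)).
  apply: (measurableT_comp (measurable_ramp eps)).
  by apply: measurable_funB.
split => //; apply: (@ae_le_intg _ _ _ _ _ (fun=> T ^+ 2)); last exact: intg_cst.
  exact: measurable_funX.
apply: filterS (ae_time timeE) => t /andP[t0 tT'].
rewrite normrX ler_sqr ?nnegrE ?(ltW T_gt0)//.
by apply: le_trans (ramp_bound _ e0) _; rewrite ge_max (ltW T_gt0)/=; lra.
Qed.

Lemma modes_ramp eps tau j : 0 < eps -> 0 < tau -> tau < T ->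
  \int[time]_t (dramp eps (tau - t) * coef z j t) =
  ze z0 j * ramp eps tau + \int[time]_t (ramp eps (tau - t) * src j t).
Proof.
move=> e0 t0 tT; have [i Pi [i1 i2 i3 i4]] := tphi_ramp j e0 t0 tT.
have [m1 m2 m3 m4] := tphi_meas Pi.
have sr : sqint time (fun t => ramp eps (tau - t)) by apply: sqint_ramp; exact: ltW.
have mdr : measurable_fun setT (fun t : X => dramp eps (tau - t)).
  by apply: (measurableT_comp (measurable_dramp eps)); exact: measurable_funB.
have sdr : sqint time (fun t => dramp eps (tau - t)).
  by apply: (@sqint_bdd _ _ _ _ _ 1) => // t; exact: dramp_bound (ltW e0).
have b2 := sqint_muz.
have te (a : X -> R) : sqint time a -> sqint m (fun p => a p.1 * e j p.2).
  by move=> a2; exact: (sqint_Me me eB j (sqint_fst mE a2)).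
have := zsol Pi.
have -> : \int[m]_p (z p * (tdphi i p + mu p * tlphi i p)) =
    \int[m]_p (- (z p * (dramp eps (tau - p.1) * e j p.2)) -
      lam j * (b p * (ramp eps (tau - p.1) * e j p.2))).
  apply: ae_eq_Rint.
  - apply: measurable_funM; first exact: sqint_meas z2.
    by apply: measurable_funD => //; exact: measurable_funM.
  - apply: measurable_funB.
      by apply: measurableT_comp => //; exact: intg_meas (intgM z2 (te _ sdr)).
    by apply: measurable_funM => //; exact: intg_meas (intgM b2 (te _ sr)).
  - by apply: filterS2 i2 i3 => p -> ->; rewrite /b; ring.
rewrite RintegralB//; [|exact: intgN (intgM z2 (te _ sdr))|exact: intgZ (intgM b2 (te _ sr))].
rewrite RintegralZl//; last exact: intgM b2 (te _ sr).
have -> : \int[m]_p (- (z p * (dramp eps (tau - p.1) * e j p.2))) =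
    - \int[time]_t (dramp eps (tau - t) * coef z j t).
  rewrite (Rint_coef mE me eB j z2 sdr).
  rewrite -mulN1r -RintegralZl//; last exact: intgM z2 (te _ sdr).
  by apply: eq_Rintegral => p _; rewrite mulN1r.
have -> : \int[m]_p (G p * tphi i p) = \int[time]_t (ramp eps (tau - t) * coef G j t).
  rewrite (Rint_coef mE me eB j G2 sr); apply: ae_eq_Rint.
  - by apply: measurable_funM => //; exact: sqint_meas G2.
  - exact: intg_meas (intgM G2 (te _ sr)).
  - by apply: filterS i1 => p ->.
have -> : \int[my]_y (z0 y * tphi0 i y) = ze z0 j * ramp eps tau.
  rewrite /ze -RintegralZr//; last exact: intgM z02 (sqint_e my me eB j).
  apply: ae_eq_Rint.
  - by apply: measurable_funM => //; exact: sqint_meas z02.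
  - by apply: measurable_funM => //; exact: intg_meas (intgM z02 (sqint_e my me eB j)).
  - by apply: filterS i4 => y ->; ring.
rewrite -(Rint_coef mE me eB j b2 sr).
rewrite opprB opprK => h; transitivity (ze z0 j * ramp eps tau +
   (\int[time]_t (ramp eps (tau - t) * coef G j t) -
    lam j * \int[time]_t (ramp eps (tau - t) * coef b j t))); first by rewrite addrA -h [RHS]addrC addKr.
congr (_ + _).
rewrite /src; under [RHS]eq_Rintegral do rewrite mulrBr.
rewrite RintegralB//; [|exact: intgM sr (c2 j G2)|exact: intgM sr (sqintZ _ (c2 j b2))].
under [X in _ = _ - X]eq_Rintegral do rewrite mulrCA.
by rewrite RintegralZl//; exact: intgM sr (c2 j b2).
Qed.

(** As [eps] tends to 0, [dramp] tends to the indicator of [t < tau] and [ramp] to [(tau - t)^+];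
    what [modes_ramp] becomes is the hypothesis of [ae_time_eq_prim]. *)
Lemma modes_eq j : {ae time, forall t, coef z j t = ze z0 j + prim time (src j) t}.
Proof.
have b2 := sqint_muz; have Iz := sqint_intg (c2 j z2); have Is := sqint_intg (sqint_src j).
apply: (ae_time_eq_prim timeE T_gt0 Iz Is) => tau t0 tT.
have mt : measurable_fun setT (fun t : X => tau - t) by exact: measurable_funB.
have cl : \int[time]_t (dramp n.+1%:R^-1 (tau - t) * coef z j t) @[n --> \oo] -->
    \int[time]_t (K t tau * coef z j t).
  apply: (@Rint_DCT _ X _ time (fun n t => dramp n.+1%:R^-1 (tau - t) * coef z j t)
    (fun t => K t tau * coef z j t) (fun t => `|coef z j t|)).
  - move=> n; apply: measurable_funM; last exact: intg_meas Iz.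
    exact: (measurableT_comp (measurable_dramp _)).
  - by apply: measurable_funM; [exact: measurable_ltR|exact: intg_meas Iz].
  - apply: nearW => t; apply: cvgMr_tmp; rewrite -subr_gt0; exact: cvg_dramp.
  - exact: intg_norm.
  - apply: nearW => t n; rewrite normrM ler_piMl//; apply: dramp_bound.
    by rewrite invr_ge0.
have cr : \int[time]_t (ramp n.+1%:R^-1 (tau - t) * src j t) @[n --> \oo] -->
    \int[time]_t (src j t * Num.max 0 (tau - t)).
  apply: (@Rint_DCT _ X _ time (fun n t => ramp n.+1%:R^-1 (tau - t) * src j t)
    (fun t => src j t * Num.max 0 (tau - t)) (fun t => T * `|src j t|)).
  - move=> n; apply: measurable_funM; last exact: intg_meas Is.
    exact: (measurableT_comp (measurable_ramp _)).
  - by apply: measurable_funM; [exact: intg_meas Is|exact: measurable_maxr].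
  - apply: nearW => t; rewrite mulrC; apply: cvgMr_tmp; exact: cvg_ramp.
  - by apply: intgZ; exact: intg_norm.
  - apply: filterS (ae_time timeE) => t /andP[t0' _] n; rewrite normrM ler_wpM2r//.
    apply: le_trans; first by apply: ramp_bound; rewrite invr_ge0.
    by rewrite ge_max (ltW T_gt0)/=; lra.
have cz : (ze z0 j * ramp n.+1%:R^-1 tau +
    \int[time]_t (ramp n.+1%:R^-1 (tau - t) * src j t)) @[n --> \oo] -->
    ze z0 j * tau + \int[time]_t (src j t * Num.max 0 (tau - t)).
  apply: cvgD => //; apply: cvgMl_tmp; have := @cvg_ramp _ tau.
  by rewrite max_r// ltW.
rewrite -(cvg_lim _ cl)// -(cvg_lim _ cz)//; congr (lim (_ @ \oo)).
by apply/funext => n; rewrite modes_ramp// invr_gt0.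
Qed.

(** The value of the [j]-th mode at time [T], read off its integral equation. *)
Definition final j := ze z0 j + \int[time]_t src j t.

(** The integrated form of [(z_j^2)' = 2 z_j z_j'], for a [z_j] known only as a primitive;
    [Rint_sqr_prim] stands for the chain rule. *)
Lemma energy_mode j : final j ^+ 2 = ze z0 j ^+ 2 + 2 * \int[time]_t (coef z j t * src j t).
Proof.
have b2 := sqint_muz; have Iz := c2 j z2; have Is := sqint_src j.
have Ip := intg_prim (sqint_intg Is).
have IM := intgM Iz Is.
have E : \int[time]_t (coef z j t * src j t) =
    ze z0 j * \int[time]_t src j t + \int[time]_t (src j t * prim time (src j) t).
  rewrite -RintegralZl//; last exact: sqint_intg.
  have Isp : intg time (fun t => src j t * prim time (src j) t).
    under eq_fun do rewrite mulrC.
    apply: (@intg_bddM _ X _ time (prim time (src j)) _ (\int[time]_s `|src j s|)).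
    - exact: intg_meas Ip.
    - by move=> t; apply: prim_bound; exact: sqint_intg.
    - exact: sqint_intg.
  rewrite -RintegralD//; last by apply: intgZ; exact: sqint_intg.
  apply: ae_eq_Rint; first exact: intg_meas IM.
    by apply: measurable_funD; [apply: measurable_funM => //; exact: sqint_meas Is|exact: intg_meas Isp].
  by apply: filterS (modes_eq j) => t ->; ring.
rewrite /final sqrrD (Rint_sqr_prim timeE (sqint_intg Is)) E; ring.
Qed.

(** Since the inverse of 0 is 0, modes with [lam j = 0] get weight 0 and sums over [j] need no side
    condition. *)
Definition wt j := (lam j)^-1.

(** By [resE] this is [2 \int z_j (mu z)_j] when [j] is not [c0]. The present form suits the tail of
    the series: everything carries the small factor [wt j], and the final value enters with a
    favourable sign. *)
Definition res j := wt j * ze z0 j ^+ 2 +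
  2 * (wt j * \int[time]_t (coef z j t * coef G j t)) - wt j * final j ^+ 2.

Definition rhs J := \sum_(j < J) res j + 2 * \int[time]_t (coef z c0 t * coef b c0 t).

Lemma coef_e0 (f : X * Y -> R) j : (forall y, e j y = 0) -> forall t, coef f j t = 0.
Proof.
move=> e0 t; rewrite /coef; under eq_Rintegral do rewrite e0 mulr0.
by rewrite Rintegral_cst// mul0r.
Qed.

Lemma Rint_coef_e0 (f g : X * Y -> R) j : (forall y, e j y = 0) -> \int[time]_t (coef f j t * coef g j t) = 0.
Proof.
move=> e0; under eq_Rintegral do rewrite coef_e0// mul0r.
by rewrite Rintegral_cst// mul0r.
Qed.

Lemma ze_e0 j : (forall y, e j y = 0) -> ze z0 j = 0.
Proof.
move=> e0; rewrite /ze; under eq_Rintegral do rewrite e0 mulr0.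
by rewrite Rintegral_cst// mul0r.
Qed.

(** The energy identity multiplied by [wt j]. The product [wt j * lam j] is 1 unless [lam j = 0],
    and then either [j] is [c0] or the mode vanishes identically. *)
Lemma resE j : res j = if j == c0 then 0 else 2 * \int[time]_t (coef z j t * coef b j t).
Proof.
have b2 := sqint_muz.
have E : \int[time]_t (coef z j t * src j t) = \int[time]_t (coef z j t * coef G j t)
    - lam j * \int[time]_t (coef z j t * coef b j t).
  rewrite /src; under eq_Rintegral do rewrite mulrBr.
  rewrite RintegralB//; [|exact: intgM (c2 j z2) (c2 j G2)|exact: intgM (c2 j z2) (sqintZ _ (c2 j b2))].
  under [X in _ - X = _]eq_Rintegral do rewrite mulrCA.
  by rewrite RintegralZl//; exact: intgM (c2 j z2) (c2 j b2).
have -> : res j = 2 * (wt j * lam j) * \int[time]_t (coef z j t * coef b j t).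
  rewrite /res energy_mode E; move: (\int[time]_t _) (\int[time]_t _) => a c; ring.
case: eqVneq => [->|jc]; first by rewrite lam_c0 !(mulr0, mul0r).
have [l0|l0] := eqVneq (lam j) 0; last by rewrite /wt mulVf// mulr1.
by rewrite !Rint_coef_e0 ?mulr0//; exact: lam_eq0.
Qed.

Lemma rhsE J : (c0 < J)%N -> rhs J = 2 * \sum_(j < J) \int[time]_t (coef z j t * coef b j t).
Proof.
move=> cJ; rewrite /rhs (bigD1 (Ordinal cJ))//= resE eqxx add0r.
rewrite [in RHS](bigD1 (Ordinal cJ))//= mulrDr addrC; congr (_ + _).
rewrite mulr_sumr; apply: eq_bigr => j jc; rewrite resE ifF//.
by apply/negbTE; move: jc; apply: contra => /eqP jc; apply/eqP/val_inj.
Qed.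

Lemma cvg_rhs : rhs J @[J --> \oo] --> 2 * \int[m]_p (mu p * z p ^+ 2).
Proof.
have -> : \int[m]_p (mu p * z p ^+ 2) = \int[m]_p (z p * b p).
  by apply: eq_Rintegral => p _; rewrite /b; ring.
have h : (2 * \sum_(j < J) \int[time]_t (coef z j t * coef b j t)) @[J --> \oo] -->
    2 * \int[m]_p (z p * b p).
  apply: cvgMl_tmp.
  exact: (parseval_prodM mE me eB e_ortho e_norm e_complete z2 sqint_muz).
apply: cvg_trans h; apply: near_eq_cvg; exists c0.+1 => // J cJ.
by rewrite /= rhsE.
Qed.

(** The bound of [res j / wt j] given by Young's inequality. The parameter will be [alpha] in the a
    priori estimate, so that [delta \int z^2] is at most the energy, and 1 in the tail estimate. *)
Definition mass j delta := ze z0 j ^+ 2 + delta * \int[time]_t (coef z j t ^+ 2) +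
   delta^-1 * \int[time]_t (coef G j t ^+ 2).

Lemma wt_ge0 j : 0 <= wt j.
Proof.
rewrite invr_ge0; have [->//|/lam_ge1] := eqVneq (lam j) 0.
by apply: le_trans; exact: ler01.
Qed.

Lemma wt_le1 j : wt j <= 1.
Proof.
rewrite /wt; have [->|l0] := eqVneq (lam j) 0; first by rewrite invr0.
by rewrite invf_le1 ?lam_ge1// (lt_le_trans ltr01)// lam_ge1.
Qed.

Lemma mass_ge0 j delta : 0 < delta -> 0 <= mass j delta.
Proof.
move=> d0; apply: addr_ge0; last by rewrite mulr_ge0 ?Rint_sqr_ge0// invr_ge0 ltW.
by apply: addr_ge0; rewrite ?sqr_ge0// mulr_ge0 ?Rint_sqr_ge0// ltW.
Qed.

Lemma sum_mass J delta : 0 < delta -> \sum_(j < J) mass j delta <=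
  \int[my]_y (z0 y ^+ 2) + delta * \int[m]_p (z p ^+ 2) + delta^-1 * \int[m]_p (G p ^+ 2).
Proof.
move=> d0; rewrite !big_split -!mulr_sumr /=.
apply: lerD; first apply: lerD.
- exact: (bessel_L2 me eB e_ortho e_norm J z02).
- by rewrite ler_wpM2l ?(ltW d0)//; exact: (bessel_prod mE me eB e_ortho e_norm J z2).
- by rewrite ler_wpM2l ?invr_ge0 ?(ltW d0)//; exact: (bessel_prod mE me eB e_ortho e_norm J G2).
Qed.

Lemma res_le j delta W : 0 < delta -> 0 <= W -> (wt j <= W \/ forall y, e j y = 0) ->
  res j <= W * mass j delta.
Proof.
move=> d0 W0 [wW|e0]; last first.
  rewrite /res ze_e0// Rint_coef_e0// expr0n/= !mulr0 !add0r.
  apply: (@le_trans _ _ 0); last by rewrite mulr_ge0// mass_ge0.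
  by rewrite oppr_le0 mulr_ge0 ?sqr_ge0// wt_ge0.
apply: (@le_trans _ _ (wt j * mass j delta)); last by rewrite ler_wpM2r// mass_ge0.
have -> : res j = wt j * (ze z0 j ^+ 2 + 2 * \int[time]_t (coef z j t * coef G j t) - final j ^+ 2).
  by rewrite /res; ring.
rewrite ler_wpM2l ?wt_ge0// /mass lerBlDr ler_wpDr ?sqr_ge0// -addrA lerD2l.
have cz := c2 j z2; have cG := c2 j G2.
rewrite -!RintegralZl//; [|exact: sqint_sqr|exact: sqint_sqr|exact: intgM].
rewrite -RintegralD//; [|exact: intgZ (sqint_sqr _)..].
apply: le_Rintegral => //; [exact: intgZ (intgM _ _)|by apply: intgD; exact: intgZ (sqint_sqr _)|].
move=> t _; move: (coef z j t) (coef G j t) => x y.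
rewrite -subr_ge0 (_ : _ - _ = delta^-1 * (delta * x - y) ^+ 2).
  by rewrite mulr_ge0 ?sqr_ge0// invr_ge0 ltW.
by field; rewrite gt_eqF.
Qed.

(** By Parseval the energy is the limit of [rhs]; beyond [J0] each [res j] is at most
    [W * mass j delta], and the masses sum to at most the norms of the data and of [z]. *)
Lemma energy_tail J0 delta W : 0 < delta -> 0 <= W ->
  (forall j, (J0 <= j)%N -> wt j <= W \/ forall y, e j y = 0) ->
  2 * \int[m]_p (mu p * z p ^+ 2) <= rhs J0 + W * (\int[my]_y (z0 y ^+ 2) +
    delta * \int[m]_p (z p ^+ 2) + delta^-1 * \int[m]_p (G p ^+ 2)).
Proof.
move=> d0 W0 wW; rewrite -(cvg_lim _ cvg_rhs)//.
apply: limr_le; first by apply/cvg_ex; eexists; exact: cvg_rhs.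
exists J0 => // J /= J0J.
(* From [J0] on, subtracting [W] times the masses makes the sequence nonincreasing. *)
have : rhs J - W * \sum_(j < J) mass j delta <= rhs J0 - W * \sum_(j < J0) mass j delta.
  rewrite -(subnKC J0J); elim: (J - J0)%N => [|k IH]; first by rewrite addn0.
  apply: le_trans IH; rewrite addnS /rhs !big_ord_recr/= mulrDr.
  have := res_le d0 W0 (wW (J0 + k)%N (leq_addr _ _)); lra.
have s0 : 0 <= W * \sum_(j < J0) mass j delta.
  by rewrite mulr_ge0// sumr_ge0// => j _; exact: mass_ge0.
have : W * \sum_(j < J) mass j delta <= W * (\int[my]_y (z0 y ^+ 2) +
    delta * \int[m]_p (z p ^+ 2) + delta^-1 * \int[m]_p (G p ^+ 2)).
  by rewrite ler_wpM2l// sum_mass.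
lra.
Qed.

(** As [lam c0 = 0], the mean of [z] is the primitive of the mean of [G], which contains no [mu]. *)
Definition bound0 := `|ze z0 c0| + \int[time]_t `|coef G c0 t|.

Lemma ae_coef0_le : {ae time, forall t, `|coef z c0 t| <= bound0}.
Proof.
apply: filterS (modes_eq c0) => t ->; apply: le_trans (ler_normD _ _) _.
rewrite lerD2l; apply: le_trans (prim_bound (sqint_intg (sqint_src c0)) t) _.
rewrite le_eqVlt; apply/orP; left; apply/eqP; apply: eq_Rintegral => s _.
by rewrite /src lam_c0 mul0r subr0.
Qed.

Lemma bound0_sqr : bound0 ^+ 2 <= 2 * \int[my]_y (z0 y ^+ 2) +
  2 * fine (time setT) * \int[m]_p (G p ^+ 2).
Proof.
have h1 : ze z0 c0 ^+ 2 <= \int[my]_y (z0 y ^+ 2).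
  have := bessel_L2 me eB e_ortho e_norm c0.+1 z02.
  rewrite big_ord_recr/=; apply: le_trans; rewrite lerDr sumr_ge0// => i _.
  exact: sqr_ge0.
have h2 : \int[time]_t (coef G c0 t ^+ 2) <= \int[m]_p (G p ^+ 2).
  have := bessel_prod mE me eB e_ortho e_norm c0.+1 G2.
  rewrite big_ord_recr/=; apply: le_trans; rewrite lerDr sumr_ge0// => i _.
  exact: Rint_sqr_ge0.
have cG := c2 c0 G2.
have aG : sqint time (fun t => `|coef G c0 t|).
  split; first by apply: measurableT_comp => //; exact: sqint_meas cG.
  by under eq_fun do rewrite real_normK ?num_real//; exact: sqint_sqr.
have := Rint_CS aG (sqint_cst time 1).
under eq_Rintegral do rewrite mulr1.
under [X in _ <= X * _ -> _]eq_Rintegral do rewrite real_normK ?num_real//.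
rewrite Rintegral_cst// expr1n mul1r => h3.
have t0 : 0 <= fine (time setT) by rewrite fine_ge0.
have h4 : \int[time]_t (coef G c0 t ^+ 2) * fine (time setT) <=
   \int[m]_p (G p ^+ 2) * fine (time setT) by rewrite ler_wpM2r.
rewrite /bound0; set x := `|ze z0 c0|; set y := \int[time]_t `|coef G c0 t| in h3 *.
have x2 : x ^+ 2 = ze z0 c0 ^+ 2 by rewrite /x real_normK ?num_real.
have := sqr_ge0 (x - y); rewrite sqrrB sqrrD x2 !mulr2n; lra.
Qed.

Variable alpha : R.
Hypothesis alpha_gt0 : 0 < alpha.
Hypothesis mu_ge : forall p, alpha <= mu p.

Lemma intg_mu : intg m mu.
Proof. exact: intg_bdd mmu muM. Qed.

Lemma intg_muz2 : intg m (fun p => mu p * z p ^+ 2).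
Proof. exact: intg_bddM mmu muM (sqint_sqr z2). Qed.

(** The bounded mean is brought inside the double integral and Young's inequality is applied with
    weight [mu]. The factor [1/2] leaves room for absorption, and [mu] enters through its integral
    and not through its supremum. *)
Lemma mean_mode_le : 2 * \int[time]_t (coef z c0 t * coef b c0 t) <=
  2^-1 * \int[m]_p (mu p * z p ^+ 2) + 2 * bound0 ^+ 2 * \int[m]_p mu p.
Proof.
have b2 := sqint_muz; have b0 : 0 <= bound0 by rewrite addr_ge0// Rintegral_ge0.
(* The mean obeys its bound almost everywhere; clamping makes it obey the bound everywhere. *)
pose a t := Num.max (- bound0) (Num.min bound0 (coef z c0 t)).
have ma : measurable_fun setT (a : X -> R).
  apply: measurable_maxr => //; apply: measurable_minr => //.
  exact: sqint_meas (c2 c0 z2).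
have aB t : `|a t| <= bound0.
  rewrite ler_norml /a le_max lexx/= ge_max ge_min lexx/= andbT; lra.
have -> : \int[time]_t (coef z c0 t * coef b c0 t) = \int[time]_t (a t * coef b c0 t).
  apply: ae_eq_Rint.
  - exact: intg_meas (intgM (c2 c0 z2) (c2 c0 b2)).
  - by apply: measurable_funM => //; exact: sqint_meas (c2 c0 b2).
  - apply: filterS ae_coef0_le => t; rewrite ler_norml => /andP[l1 l2].
    by rewrite /a (min_r l2) (max_r l1).
rewrite (Rint_coef_bdd mE me eB c0 b2 ma aB).
have ma1 : measurable_fun setT (fun p : (X * Y)%type => a p.1) by exact: measurableT_comp.
have Ib : intg m (fun p => a p.1 * b p).
  by apply: (@intg_bddM _ _ _ _ (fun p => a p.1) b bound0) => //; exact: sqint_intg.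
have -> : \int[m]_p (b p * (a p.1 * e c0 p.2)) = \int[m]_p (a p.1 * b p).
  by apply: eq_Rintegral => p _; rewrite e_c0; ring.
rewrite -!RintegralZl//; [|exact: intg_mu|exact: intg_muz2].
rewrite -RintegralD//; [|exact: intgZ intg_muz2|exact: intgZ intg_mu].
apply: le_Rintegral => //.
- exact: intgZ.
- by apply: intgD; [exact: intgZ intg_muz2|exact: intgZ intg_mu].
move=> p _; rewrite /b; have mu0 : 0 <= mu p by exact: le_trans (ltW alpha_gt0) (mu_ge p).
apply: (@le_trans _ _ (mu p * (2^-1 * z p ^+ 2 + 2 * a p.1 ^+ 2))).
  rewrite (_ : 2 * _ = mu p * (2 * a p.1 * z p)); last by ring.
  rewrite ler_wpM2l//; have := sqr_ge0 (2^-1 * z p - a p.1); nra.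
have -> : 2^-1 * (mu p * z p ^+ 2) + 2 * bound0 ^+ 2 * mu p =
  mu p * (2^-1 * z p ^+ 2 + 2 * bound0 ^+ 2) by ring.
rewrite ler_wpM2l// lerD2l ler_wpM2l//.
by rewrite -[X in X <= _]real_normK ?num_real// ler_sqr ?nnegrE.
Qed.

(** The bound depends on [mu] through [alpha] and [\int mu] only, and so is uniform along a sequence
    converging in L^1. *)
Lemma energy_apriori : \int[m]_p (mu p * z p ^+ 2) <=
  2 * \int[my]_y (z0 y ^+ 2) + 2 * alpha^-1 * \int[m]_p (G p ^+ 2) +
  4 * (2 * \int[my]_y (z0 y ^+ 2) + 2 * fine (time setT) * \int[m]_p (G p ^+ 2)) * \int[m]_p mu p.
Proof.
have h0 : 2 * \int[m]_p (mu p * z p ^+ 2) <= \int[my]_y (z0 y ^+ 2) + alpha * \int[m]_p (z p ^+ 2)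
    + alpha^-1 * \int[m]_p (G p ^+ 2) + 2 * \int[time]_t (coef z c0 t * coef b c0 t).
  (* All weights are at most 1, so the tail may start at rank 0. With [delta = alpha], the term in
     [z^2] is at most one energy, against two on the left; the mean mode takes another half. *)
  have := @energy_tail 0%N alpha 1 alpha_gt0 ler01 (fun j _ => or_introl (wt_le1 j)).
  by rewrite /rhs big_ord0 add0r mul1r; lra.
have h1 : alpha * \int[m]_p (z p ^+ 2) <= \int[m]_p (mu p * z p ^+ 2).
  rewrite -RintegralZl//; last exact: sqint_sqr.
  apply: le_Rintegral => //; [exact: intgZ (sqint_sqr z2)|exact: intg_muz2|].
  by move=> p _; rewrite ler_wpM2r ?sqr_ge0.
have h2 := mean_mode_le.
have h3 : bound0 ^+ 2 * \int[m]_p mu p <= (2 * \int[my]_y (z0 y ^+ 2) +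
    2 * fine (time setT) * \int[m]_p (G p ^+ 2)) * \int[m]_p mu p.
  rewrite ler_wpM2r ?bound0_sqr// Rintegral_ge0// => p _.
  exact: le_trans (ltW alpha_gt0) (mu_ge p).
lra.
Qed.

End modes.

Let c2 (f : X * Y -> R) j := @sqint_coef _ _ _ _ _ _ _ _ mE _ _ me eB e_ortho e_norm f j.


(** * Uniqueness, and density of the range of the adjoint operator *)

Section uniqueness.
Variables (mu : X * Y -> R) (M alpha : R).
Hypothesis mmu : measurable_fun setT mu.
Hypothesis muM : forall p, `|mu p| <= M.
Hypothesis alpha_gt0 : 0 < alpha.
Hypothesis mu_ge : forall p, alpha <= mu p.

Lemma sol_zero_data z : sqint m z -> sol mu (fun=> 0) (fun=> 0) z -> {ae m, forall p, z p = 0}.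
Proof.
move=> z2 zs; have := energy_apriori mmu muM (sqint_cst m 0) z2 (sqint_cst my 0) zs alpha_gt0 mu_ge.
rewrite expr0n/= !Rintegral_cst// !mul0r !mulr0 !addr0 mulr0 mul0r addr0 => h.
have Imz : intg m (fun p => mu p * z p ^+ 2) by exact: intg_bddM mmu muM (sqint_sqr z2).
apply: Rint_sqr_eq0 => //; apply/eqP; rewrite eq_le Rint_sqr_ge0 andbT.
rewrite -(pmulr_rle0 _ alpha_gt0) -RintegralZl//; last exact: sqint_sqr.
apply: le_trans h; apply: le_Rintegral => //; first exact: intgZ (sqint_sqr z2).
by move=> p _; rewrite ler_wpM2r ?sqr_ge0.
Qed.

Lemma sqint_tests i : P i -> [/\ sqint m (tphi i), sqint m (tdphi i), sqint m (tlphi i),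
  sqint my (tphi0 i) & sqint m (fun p => tdphi i p + mu p * tlphi i p)].
Proof.
move=> Pi; have [m1 m2 m3 m4] := tphi_meas Pi; have [C [b1 b2 b3 b4]] := tphi_bdd Pi.
have d2 := sqint_bdd m m2 b2; have l2 := sqint_bdd m m3 b3.
split; [exact: sqint_bdd m1 b1|by []|by []|exact: sqint_bdd m4 b4|].
by apply: sqintD => //; exact: sqint_bddM mmu muM l2.
Qed.

Lemma sol_unique G z0 z w : sqint m G -> sqint my z0 -> sqint m z -> sqint m w ->
  sol mu G z0 z -> sol mu G z0 w -> {ae m, forall p, w p = z p}.
Proof.
move=> G2 z02 z2 w2 zs ws.
have : {ae m, forall p, w p - z p = 0}.
  apply: sol_zero_data; first exact: sqintB.
  move=> i Pi; have [t1 t2 t3 t4 t5] := sqint_tests Pi.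
  under eq_Rintegral do rewrite mulrBl.
  under [X in _ = X + _]eq_Rintegral do rewrite mul0r.
  under [X in _ = _ + X]eq_Rintegral do rewrite mul0r.
  rewrite !Rintegral_cst// !mul0r addr0 RintegralB//; [|exact: intgM w2 t5|exact: intgM z2 t5].
  by rewrite opprB; apply/eqP; rewrite subr_eq0 -eqr_opp zs// ws.
by apply: filterS => p /subr0_eq.
Qed.

Definition test_range := [set S : X * Y -> R | exists2 i, P i &
  forall p, S p = tdphi i p + mu p * tlphi i p].

Lemma sqint_test_range S : test_range S -> sqint m S.
Proof. by move=> [i Pi /funext ->]; case: (sqint_tests Pi). Qed.

Lemma test_range_lin a S S' : test_range S -> test_range S' ->
  test_range (fun p => a * S p + S' p).
Proof.
move=> [i Pi Si] [j Pj Sj]; have [k Pk [k1 k2 k3 k4]] := tphi_lin a Pi Pj.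
by exists k => // p; rewrite Si Sj k2 k3; ring.
Qed.

Lemma test_range0 : test_range (fun=> 0).
Proof.
have T2 : 0 < T / 2 by rewrite divr_gt0.
have T2T : T / 2 < T by rewrite [ltRHS]splitr ltrDl.
have [i Pi _] := tphi_ramp 0%N ltr01 T2 T2T.
have [k Pk [k1 k2 k3 k4]] := tphi_lin (-1) Pi Pi.
by exists k => // p; rewrite k2 k3; ring.
Qed.

(** Let [v] be the Riesz representative of [S] on the range, which lies in its closure. Then [S - v]
    is orthogonal to the range, that is, it solves the problem with zero data, and so it
    vanishes. *)
Lemma test_range_dense S : sqint m S -> forall eps : R, 0 < eps ->
  exists2 S', test_range S' & \int[m]_p ((S p - S' p) ^+ 2) < eps.
Proof.
move=> S2; pose l (f : X * Y -> R) := \int[m]_p (S p * f p).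
have [||||v [v2 vD vl]] := @sqint_riesz _ _ _ m test_range l (\int[m]_p (S p ^+ 2)) test_range0.
- exact: sqint_test_range.
- exact: test_range_lin.
- move=> a f g Df Dg; have f2 := sqint_test_range Df; have g2 := sqint_test_range Dg.
  rewrite /l -RintegralZl//; last exact: intgM.
  rewrite -RintegralD//; [|exact: intgZ (intgM _ _)|exact: intgM].
  by apply: eq_Rintegral => p _; ring.
- by move=> f Df; apply: Rint_CS => //; exact: sqint_test_range.
have Sv : {ae m, forall p, S p - v p = 0}.
  apply: sol_zero_data; first exact: sqintB.
  move=> i Pi; have [t1 t2 t3 t4 t5] := sqint_tests Pi.
  under eq_Rintegral do rewrite mulrBl.
  under [X in _ = X + _]eq_Rintegral do rewrite mul0r.
  under [X in _ = _ + X]eq_Rintegral do rewrite mul0r.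
  rewrite !Rintegral_cst// !mul0r addr0 RintegralB//; [|exact: intgM S2 t5|exact: intgM v2 t5].
  have := vl (fun p => tdphi i p + mu p * tlphi i p); rewrite /l => -> //; last by exists i.
  by rewrite subrr oppr0.
move=> eps /vD[S' DS' hS]; exists S' => //; apply: le_lt_trans hS.
have S'2 := sqint_test_range DS'.
rewrite le_eqVlt; apply/orP; left; apply/eqP; apply: ae_eq_Rint.
- exact: intg_meas (sqint_sqr (sqintB S2 S'2)).
- exact: intg_meas (sqint_sqr (sqintB S'2 v2)).
- by apply: filterS Sv => p /subr0_eq ->; rewrite -sqrrN opprB.
Qed.

End uniqueness.

(** * Uniform bounds and the weak limit *)

Section limit.
Variables (mu_ G_ z_ : nat -> X * Y -> R) (z0_ : nat -> Y -> R) (M_ : nat -> R).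
Variables (mu G : X * Y -> R) (z0 : Y -> R) (M alpha : R).
Hypothesis mmu_ : forall n, measurable_fun setT (mu_ n).
Hypothesis mu_M : forall n p, `|mu_ n p| <= M_ n.
Hypothesis alpha_gt0 : 0 < alpha.
Hypothesis mu_ge : forall n p, alpha <= mu_ n p.
Hypothesis G_2 : forall n, sqint m (G_ n).
Hypothesis z_2 : forall n, sqint m (z_ n).
Hypothesis z0_2 : forall n, sqint my (z0_ n).
Hypothesis z_sol : forall n, sol (mu_ n) (G_ n) (z0_ n) (z_ n).
Hypothesis mmu : measurable_fun setT mu.
Hypothesis muM : forall p, `|mu p| <= M.
Hypothesis muge : forall p, alpha <= mu p.
Hypothesis G2 : sqint m G.
Hypothesis z02 : sqint my z0.
Hypothesis z0_cvg : forall g, sqint my g ->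
  \int[my]_y (z0_ n y * g y) @[n --> \oo] --> \int[my]_y (z0 y * g y).
Hypothesis G_cvg : forall g, sqint m g ->
  \int[m]_p (G_ n p * g p) @[n --> \oo] --> \int[m]_p (G p * g p).
Hypothesis mu_cvg : \int[m]_p `|mu_ n p - mu p| @[n --> \oo] --> 0.

Let mu_ge0 n p : 0 <= mu_ n p. Proof. exact: le_trans (ltW alpha_gt0) (mu_ge n p). Qed.
Let muge0 p : 0 <= mu p. Proof. exact: le_trans (ltW alpha_gt0) (muge p). Qed.
Let Imu_ n : intg m (mu_ n). Proof. exact: intg_bdd (mmu_ n) (mu_M n). Qed.
Let Imu : intg m mu. Proof. exact: intg_bdd mmu muM. Qed.
Let Idmu n : intg m (fun p => `|mu_ n p - mu p|).
Proof. by apply: intg_norm; exact: intgB. Qed.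

Let cvg_bounded (u : nat -> R) (l : R) : u n @[n --> \oo] --> l -> exists C, forall n, `|u n| <= C.
Proof.
move=> ul; have /cvg_seq_bounded[C [_ Cb]] : cvgn u by apply/cvg_ex; exists l.
by exists (C + 1) => n; apply: Cb => //; rewrite ltrDl.
Qed.

(** Weak convergence bounds [G_] and [z0_] by the uniform boundedness principle; for [mu_] only the
    integrals are bounded, by convergence in L^1. *)
Lemma data_bounded : exists2 C, 0 <= C & forall n,
  [/\ \int[m]_p (G_ n p ^+ 2) <= C, \int[my]_y (z0_ n y ^+ 2) <= C & \int[m]_p mu_ n p <= C].
Proof.
have [CG hG] : exists C, forall n, \int[m]_p (G_ n p ^+ 2) <= C.
  by apply: sqint_weakly_bounded => // g g2; exact: cvg_bounded (G_cvg g2).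
have [Cz hz] : exists C, forall n, \int[my]_y (z0_ n y ^+ 2) <= C.
  by apply: sqint_weakly_bounded => // g g2; exact: cvg_bounded (z0_cvg g2).
have [Cm hm] := cvg_bounded mu_cvg.
have Cm0 : 0 <= \int[m]_p mu p by apply: Rintegral_ge0 => p _; exact: muge0.
exists (`|CG| + `|Cz| + `|Cm| + \int[m]_p mu p); first by rewrite !addr_ge0.
move=> n; have := ler_norm CG; have := ler_norm Cz; have := ler_norm Cm.
have := normr_ge0 CG; have := normr_ge0 Cz; have := normr_ge0 Cm.
have := hG n; have := hz n; have h3 : \int[m]_p mu_ n p <= Cm + \int[m]_p mu p.
  apply: (@le_trans _ _ (\int[m]_p (`|mu_ n p - mu p| + mu p))).
    apply: le_Rintegral => //; [exact: Imu_|exact: (intgD (Idmu n) Imu)|].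
    by move=> p _; have := ler_norm (mu_ n p - mu p); lra.
  rewrite RintegralD//=; last exact: Idmu.
  by rewrite lerD2r; apply: le_trans (hm n); exact: ler_norm.
by split; lra.
Qed.

Lemma energy_bounded : exists2 C, 0 <= C & forall n,
  \int[m]_p (mu_ n p * z_ n p ^+ 2) <= C /\ \int[m]_p (z_ n p ^+ 2) <= C.
Proof.
have [C C0 hC] := data_bounded.
pose tt := fine (time setT); have t0 : 0 <= tt by rewrite fine_ge0.
have a0 : 0 <= alpha^-1 by rewrite invr_ge0 ltW.
pose E := 2 * C + 2 * alpha^-1 * C + 4 * (2 * C + 2 * tt * C) * C.
have E0 : 0 <= E by rewrite /E !(addr_ge0, mulr_ge0).
have h1 n : \int[m]_p (mu_ n p * z_ n p ^+ 2) <= E.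
  have [g1 g2 g3] := hC n; apply: le_trans.
    exact: (energy_apriori (mmu_ n) (mu_M n) (G_2 n) (z_2 n) (z0_2 n) (z_sol n) alpha_gt0 (mu_ge n)).
  have m0 : 0 <= \int[m]_p mu_ n p by apply: Rintegral_ge0 => p _; exact: mu_ge0.
  have G0 := Rint_sqr_ge0 m (G_ n); have z00 := Rint_sqr_ge0 my (z0_ n).
  apply: lerD; first apply: lerD.
  - by rewrite ler_wpM2l.
  - by rewrite ler_wpM2l// mulr_ge0.
  - apply: ler_pM => //; first by rewrite !(mulr_ge0, addr_ge0).
    by rewrite ler_wpM2l//; apply: lerD; rewrite ler_wpM2l// mulr_ge0.
exists (E + alpha^-1 * E); first by rewrite addr_ge0// mulr_ge0.
move=> n; split; first by apply: le_trans (h1 n) _; rewrite lerDl mulr_ge0.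
apply: (@le_trans _ _ (alpha^-1 * E)); last by rewrite lerDr.
rewrite ler_pdivlMl//; apply: le_trans (h1 n); rewrite -RintegralZl//; last exact: sqint_sqr.
apply: le_Rintegral => //; first exact: intgZ (sqint_sqr (z_2 n)).
  exact: intg_bddM (mmu_ n) (mu_M n) (sqint_sqr (z_2 n)).
by move=> p _; rewrite ler_wpM2r ?sqr_ge0.
Qed.

Let rt n p : R := Num.sqrt (mu_ n p).
Let rt0 p : R := Num.sqrt (mu p).
Let sd n p : R := rt n p - rt0 p.

Let mrt n : measurable_fun setT (rt n).
Proof. exact: measurable_sqrtr. Qed.

Let mrt0 : measurable_fun setT rt0.
Proof. exact: measurable_sqrtr. Qed.

Let msd n : measurable_fun setT (sd n). Proof. exact: measurable_funB. Qed.

Let rt_sqr n p : rt n p ^+ 2 = mu_ n p. Proof. by rewrite sqr_sqrtr. Qed.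
Let rt0_sqr p : rt0 p ^+ 2 = mu p. Proof. by rewrite sqr_sqrtr. Qed.

Let rt_bdd n p : `|rt n p| <= Num.sqrt (M_ n).
Proof.
rewrite ger0_norm ?sqrtr_ge0// ler_wsqrtr//; apply: le_trans (mu_M n p); exact: ler_norm.
Qed.

Let rt0_bdd p : `|rt0 p| <= Num.sqrt M.
Proof.
rewrite ger0_norm ?sqrtr_ge0// ler_wsqrtr//; apply: le_trans (muM p); exact: ler_norm.
Qed.

Let rt2 n : sqint m (rt n). Proof. exact: sqint_bdd (mrt n) (rt_bdd n). Qed.
Let rt02 : sqint m rt0. Proof. exact: sqint_bdd mrt0 rt0_bdd. Qed.
Let sd2 n : sqint m (sd n). Proof. exact: sqintB. Qed.

(** For nonnegative reals, [|a - b| <= a + b], so [(a - b)^2 <= |a^2 - b^2|], applied to the square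
    roots of [mu_ n] and [mu]. *)
Lemma cvg_root : \int[m]_p (sd n p ^+ 2) @[n --> \oo] --> 0.
Proof.
apply: (@squeeze_cvgr _ _ _ _ (cst 0) _ _ _ _ _ mu_cvg); last exact: cvg_cst.
apply: nearW => n; rewrite Rint_sqr_ge0/=; apply: le_Rintegral => //; [exact: sqint_sqr (sd2 n)|exact: Idmu|].
move=> p _; rewrite -rt_sqr -rt0_sqr /sd subr_sqr normrM -[leLHS]ger0_norm ?sqr_ge0//.
rewrite expr2 normrM ler_wpM2l// [leRHS]ger0_norm ?addr_ge0 ?sqrtr_ge0//.
apply: le_trans (ler_normB _ _) _; rewrite !ger0_norm// sqrtr_ge0//.
Qed.

Let uz n p : R := rt n p * z_ n p.

Let uz2 n : sqint m (uz n). Proof. exact: sqint_bddM (mrt n) (rt_bdd n) (z_2 n). Qed.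

Let uz_sqr n p : uz n p ^+ 2 = mu_ n p * z_ n p ^+ 2.
Proof. by rewrite exprMn rt_sqr. Qed.

(** [mu_ n - mu] is small in L^1 only and [z_ n] bounded in L^2 only, so neither Hölder nor
    Cauchy-Schwarz applies directly. Factoring the difference through square roots leaves [sd n],
    small in L^2, against [f n], bounded in L^2 by the energy. *)
Lemma cvg_coeff_pairing (psi : X * Y -> R) C : measurable_fun setT psi -> (forall p, `|psi p| <= C) ->
  \int[m]_p (z_ n p * ((mu_ n p - mu p) * psi p)) @[n --> \oo] --> 0.
Proof.
move=> mpsi psiC; have [E E0 hE] := energy_bounded.
pose f n p := psi p * (uz n p + rt0 p * z_ n p).
have rz2 n : sqint m (fun p => rt0 p * z_ n p) by exact: sqint_bddM mrt0 rt0_bdd (z_2 n).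
have f2 n : sqint m (f n) by apply: (sqint_bddM mpsi psiC); exact: sqintD.
have M0 : 0 <= M by apply: le_trans (muM (0, point)); exact: normr_ge0.
have -> : (fun n => \int[m]_p (z_ n p * ((mu_ n p - mu p) * psi p))) =
    (fun n => \int[m]_p (f n p * sd n p)).
  apply/funext => n; apply: eq_Rintegral => p _.
  by rewrite -rt_sqr -rt0_sqr /f /sd /uz; ring.
apply: (@cvg0_CS _ _ _ _ f sd (C ^+ 2 * (2 * E + 2 * (M * E)))) => //; last exact: cvg_root.
move=> n; apply: (@le_trans _ _ (\int[m]_p (C ^+ 2 * (2 * (uz n p ^+ 2) + 2 * (M * z_ n p ^+ 2))))).
  apply: le_Rintegral => //; first exact: sqint_sqr.
    by apply: intgZ; apply: intgD; apply: intgZ; [|apply: intgZ]; exact: sqint_sqr.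
  move=> p _; rewrite /f exprMn ler_pM ?sqr_ge0//.
    by rewrite -[leLHS]real_normK ?num_real// ler_sqr ?nnegrE// (le_trans _ (psiC p)).
  apply: (@le_trans _ _ (2 * (uz n p ^+ 2) + 2 * ((rt0 p * z_ n p) ^+ 2))).
    have := sqr_ge0 (uz n p - rt0 p * z_ n p); move: (uz n p) (rt0 p * z_ n p) => a b.
    by rewrite sqrrB sqrrD !mulr2n; lra.
  rewrite [(rt0 p * _) ^+ 2]exprMn rt0_sqr lerD2l ler_wpM2l// ler_wpM2r ?sqr_ge0//.
  by apply: le_trans (muM p); exact: ler_norm.
have I1 := sqint_sqr (uz2 n); have I2 := sqint_sqr (z_2 n).
rewrite RintegralZl//; last by apply: intgD; apply: intgZ; [|apply: intgZ].
rewrite ler_wpM2l ?sqr_ge0// RintegralD//; [|exact: intgZ|by do 2 apply: intgZ].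
rewrite !RintegralZl//; last exact: intgZ.
have [e1 e2] := hE n; under eq_Rintegral do rewrite uz_sqr.
by apply: lerD; rewrite ler_wpM2l// ler_wpM2l.
Qed.

Lemma cvg_test i : P i ->
  \int[m]_p (z_ n p * (tdphi i p + mu p * tlphi i p)) @[n --> \oo] -->
  - (\int[my]_y (z0 y * tphi0 i y) + \int[m]_p (G p * tphi i p)).
Proof.
move=> Pi; have [t1 t2 t3 t4 t5] := sqint_tests mmu muM Pi.
have [m1 m2 m3 m4] := tphi_meas Pi; have [C [b1 b2 b3 b4]] := tphi_bdd Pi.
have E n : \int[m]_p (z_ n p * (tdphi i p + mu p * tlphi i p)) =
  - (\int[my]_y (z0_ n y * tphi0 i y) + \int[m]_p (G_ n p * tphi i p)) -
  \int[m]_p (z_ n p * ((mu_ n p - mu p) * tlphi i p)).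
  rewrite -(z_sol n Pi) opprK.
  have [_ _ _ _ t5'] := sqint_tests (mmu_ n) (mu_M n) Pi.
  rewrite -RintegralB//; [|exact: intgM (z_2 n) t5'|]; last first.
    apply: (intgM (z_2 n)); apply: (@sqint_bddM _ _ _ _ (fun p => mu_ n p - mu p) _ (M_ n + M)) => //.
      exact: measurable_funB.
    by move=> p; apply: le_trans (ler_normB _ _) _; rewrite lerD.
  by apply: eq_Rintegral => p _; ring.
rewrite (_ : (fun n => _) = (fun n =>
  - (\int[my]_y (z0_ n y * tphi0 i y) + \int[m]_p (G_ n p * tphi i p)) -
  \int[m]_p (z_ n p * ((mu_ n p - mu p) * tlphi i p)))); last exact/funext.
rewrite -[- (_ + _)]subr0; apply: cvgB; last exact: cvg_coeff_pairing m3 b3.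
by apply: cvgN; apply: cvgD; [exact: z0_cvg|exact: G_cvg].
Qed.

(** On the range of the adjoint operator the pairings with [z_ n] converge to an expression in the
    data, so the limit functional exists along the whole sequence, and the uniform L^2 bound makes
    it continuous. *)
Lemma limit_exists : exists2 z, sqint m z & sol mu G z0 z /\
  forall S, test_range mu S -> \int[m]_p (z_ n p * S p) @[n --> \oo] --> \int[m]_p (z p * S p).
Proof.
have [E E0 hE] := energy_bounded.
pose l (S : X * Y -> R) := lim (\int[m]_p (z_ n p * S p) @[n --> \oo]).
have lcv S : test_range mu S -> \int[m]_p (z_ n p * S p) @[n --> \oo] --> l S.
  move=> [i Pi /funext ->]; apply/cvg_ex; eexists; exact: cvg_test Pi.
have S2 S : test_range mu S -> sqint m S by exact: sqint_test_range mmu muM S.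
have [||||z [z2 _ zl]] := @sqint_riesz _ _ _ m (test_range mu) l E (test_range0 mu).
- exact: S2.
- exact: test_range_lin.
- move=> a f g Df Dg; apply: cvg_lim => //.
  have h : (a * \int[m]_p (z_ n p * f p) + \int[m]_p (z_ n p * g p)) @[n --> \oo] --> a * l f + l g.
    by apply: cvgD; [apply: cvgMl_tmp|]; exact: lcv.
  apply: cvg_trans h; apply: near_eq_cvg; apply: nearW => n /=.
  have If := intgM (z_2 n) (S2 _ Df); have Ig := intgM (z_2 n) (S2 _ Dg).
  rewrite -RintegralZl// -RintegralD//; last exact: intgZ.
  by apply: eq_Rintegral => p _; ring.
- move=> f Df; have h := lcv f Df.
  have hs : (\int[m]_p (z_ n p * f p)) ^+ 2 @[n --> \oo] --> l f ^+ 2.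
    by under eq_fun do rewrite expr2; rewrite expr2; exact: cvgM.
  rewrite -(cvg_lim _ hs)//; apply: limr_le; first by apply/cvg_ex; eexists; exact: hs.
  apply: nearW => n; apply: le_trans (Rint_CS (z_2 n) (S2 _ Df)) _.
  by rewrite ler_wpM2r ?Rint_sqr_ge0//; case: (hE n).
exists z => //; split; last by move=> S DS; rewrite zl//; exact: lcv.
move=> i Pi; pose S p := tdphi i p + mu p * tlphi i p.
have DS : test_range mu S by exists i.
rewrite -[X in - X]/(\int[m]_p (z p * S p)) zl//.
by rewrite /l (cvg_lim _ (cvg_test Pi))// opprK.
Qed.

(** * From weak to strong convergence *)

Section strong.
Variable z : X * Y -> R.
Hypothesis z2 : sqint m z.
Hypothesis zs : sol mu G z0 z.
Hypothesis z_range : forall S, test_range mu S ->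
  \int[m]_p (z_ n p * S p) @[n --> \oo] --> \int[m]_p (z p * S p).

(** Convergence on the range extends to all of L^2, because the range is dense and the [z_ n] are
    bounded. *)
Lemma weak_cvg S : sqint m S -> \int[m]_p (z_ n p * S p) @[n --> \oo] --> \int[m]_p (z p * S p).
Proof.
move=> S2; have [E E0 hE] := energy_bounded.
apply/cvgrPdist_lt => eps eps0.
pose C := 2 * E + 2 * \int[m]_p (z p ^+ 2).
have C0 : 0 <= C by rewrite addr_ge0// mulr_ge0// Rint_sqr_ge0.
(* [C] bounds the squared norms of [z - z_ n]; the denominator [C + 1] is positive even if
   [C = 0]. *)
have d0 : 0 < (eps / 2) ^+ 2 / (C + 1).
  by rewrite divr_gt0// ?exprn_gt0 ?divr_gt0//; lra.
have [S' DS' hS] := test_range_dense mmu muM alpha_gt0 muge S2 d0.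
have S'2 := sqint_test_range mmu muM DS'.
have /cvgrPdist_lt /(_ (eps / 2)) := z_range DS'; case; first by rewrite divr_gt0.
move=> n0 _ n0P; exists n0 => // n nn; have := n0P n nn => /= h1.
have dz2 : sqint m (fun p => z p - z_ n p) by exact: sqintB.
have dS2 : sqint m (fun p => S p - S' p) by exact: sqintB.
have -> : \int[m]_p (z p * S p) - \int[m]_p (z_ n p * S p) =
  (\int[m]_p (z p * S' p) - \int[m]_p (z_ n p * S' p)) +
   \int[m]_p ((z p - z_ n p) * (S p - S' p)).
  rewrite -RintegralB//; [|exact: intgM z2 S2|exact: intgM (z_2 n) S2].
  rewrite -RintegralB//; [|exact: intgM z2 S'2|exact: intgM (z_2 n) S'2].
  rewrite -RintegralD//; last exact: intgM dz2 dS2.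
    by apply: eq_Rintegral => p _; ring.
  exact: intgB (intgM z2 S'2) (intgM (z_2 n) S'2).
apply: le_lt_trans (ler_normD _ _) _; rewrite [ltRHS]splitr; apply: ltr_leD => //.
rewrite -ler_sqr ?nnegrE ?divr_ge0 ?(ltW eps0)// real_normK ?num_real//.
apply: le_trans (Rint_CS dz2 dS2) _.
have hz : \int[m]_p ((z p - z_ n p) ^+ 2) <= C.
  have [_ e2] := hE n; have I1 := sqint_sqr z2; have I2 := sqint_sqr (z_2 n).
  apply: (@le_trans _ _ (\int[m]_p (2 * (z p ^+ 2) + 2 * (z_ n p ^+ 2)))).
    apply: le_Rintegral => //; [exact: sqint_sqr dz2|exact: intgD (intgZ _ I1) (intgZ _ I2)|].
    move=> p _; have := sqr_ge0 (z p + z_ n p); move: (z p) (z_ n p) => a b.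
    by rewrite sqrrB sqrrD !mulr2n; lra.
  rewrite RintegralD//; [|exact: intgZ..].
  by rewrite !RintegralZl// /C addrC lerD2r ler_wpM2l.
apply: (@le_trans _ _ (C * ((eps / 2) ^+ 2 / (C + 1)))).
  by apply: ler_pM => //; rewrite ?Rint_sqr_ge0// ltW.
rewrite mulrCA ler_piMr ?sqr_ge0// ler_pdivrMr ?mul1r; lra.
Qed.

Lemma weak_cvg_muz (psi : X * Y -> R) C : measurable_fun setT psi -> (forall p, `|psi p| <= C) ->
  \int[m]_p (mu_ n p * z_ n p * psi p) @[n --> \oo] --> \int[m]_p (mu p * z p * psi p).
Proof.
move=> mpsi psiC.
have s2 : sqint m (fun p => mu p * psi p).
  by apply: (sqint_bddM mmu muM); exact: sqint_bdd mpsi psiC.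
have h : (\int[m]_p (z_ n p * ((mu_ n p - mu p) * psi p)) + \int[m]_p (z_ n p * (mu p * psi p)))
   @[n --> \oo] --> 0 + \int[m]_p (z p * (mu p * psi p)).
  by apply: cvgD; [exact: cvg_coeff_pairing mpsi psiC|exact: weak_cvg].
have -> : \int[m]_p (mu p * z p * psi p) = 0 + \int[m]_p (z p * (mu p * psi p)).
  by rewrite add0r; apply: eq_Rintegral => p _; ring.
apply: cvg_trans h; apply: near_eq_cvg; apply: nearW => n /=.
rewrite -RintegralD//; last exact: intgM (z_2 n) s2.
  by apply: eq_Rintegral => p _; ring.
apply: (intgM (z_2 n)); apply: (@sqint_bddM _ _ _ _ (fun p => mu_ n p - mu p) _ (M_ n + M)).
- exact: measurable_funB.
- by move=> p; apply: le_trans (ler_normB _ _) _; rewrite lerD.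
- exact: sqint_bdd mpsi psiC.
Qed.

Let bn n p := mu_ n p * z_ n p.
Let b p := mu p * z p.
Let bn2 n : sqint m (bn n). Proof. exact: sqint_bddM (mmu_ n) (mu_M n) (z_2 n). Qed.
Let b2 : sqint m b. Proof. exact: sqint_bddM mmu muM z2. Qed.

(** Representatives of the modes defined at every [t]. They converge pointwise in time, a statement
    without meaning for [coef], which is determined only almost everywhere. *)
Let An n j t := ze (z0_ n) j + prim time (src (mu_ n) (G_ n) (z_ n) j) t.
Let A j t := ze z0 j + prim time (src mu G z j) t.

Let cut (q : X -> R) j (p : X * Y) : R := q p.1 * e j p.2.

Let mcut (q : X -> R) j : measurable_fun setT q -> measurable_fun setT (cut q j).
Proof.
move=> mq; apply: measurable_funM; first exact: measurableT_comp.
exact: measurable_snd_e.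
Qed.

Let cut_bdd (q : X -> R) (C : R) j : (forall t, `|q t| <= C) -> forall p, `|cut q j p| <= C * B.
Proof. by move=> qC p; rewrite normrM ler_pM. Qed.

(** Pairing the source of a mode with [q] in time is pairing [G'] and [mu' z'] with [q(t) e_j(y)],
    so the weak convergences in space-time apply to it. *)
Let Rint_src_gen (mu' G' z' : X * Y -> R) (q : X -> R) (C : R) j : sqint m G' -> sqint m (fun p => mu' p * z' p) ->
  measurable_fun setT q -> (forall t, `|q t| <= C) ->
  \int[time]_t (q t * src mu' G' z' j t) =
  \int[m]_p (G' p * cut q j p) - lam j * \int[m]_p (mu' p * z' p * cut q j p).
Proof.
move=> G'2 b'2 mq qC; rewrite -(Rint_coef_bdd mE me eB j G'2 mq qC).
rewrite -(Rint_coef_bdd mE me eB j b'2 mq qC).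
have q2 : sqint time q by exact: sqint_bdd mq qC.
have cG := intgM q2 (c2 j G'2); have cb := intgM q2 (c2 j b'2).
rewrite -RintegralZl// -RintegralB//; last exact: intgZ.
by apply: eq_Rintegral => t _; rewrite /src; ring.
Qed.

Let KC (t s : R) : `|K s t| <= 1. Proof. exact: normK. Qed.

Let mKt (t : R) : measurable_fun setT (fun s : X => K s t). Proof. exact: measurable_ltR. Qed.

Lemma cvg_ze j : ze (z0_ n) j @[n --> \oo] --> ze z0 j.
Proof. exact: z0_cvg (sqint_e my me eB j). Qed.

Let cvg_src (q : X -> R) (C : R) j : measurable_fun setT q -> (forall t, `|q t| <= C) ->
  \int[time]_t (q t * src (mu_ n) (G_ n) (z_ n) j t) @[n --> \oo] -->
  \int[time]_t (q t * src mu G z j t).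
Proof.
move=> mq qC; rewrite (Rint_src_gen j G2 b2 mq qC).
under eq_fun do rewrite (Rint_src_gen j (G_2 _) (bn2 _) mq qC).
have mc := mcut j mq; have cb := cut_bdd j qC.
apply: cvgB; first by apply: G_cvg; exact: sqint_bdd mc cb.
by apply: cvgMl_tmp; exact: weak_cvg_muz mc cb.
Qed.

Lemma cvg_An j t : An n j t @[n --> \oo] --> A j t.
Proof. by apply: cvgD; [exact: cvg_ze|exact: cvg_src (mKt t) (KC t)]. Qed.

Lemma cvg_final j : final (mu_ n) (G_ n) (z_ n) (z0_ n) j @[n --> \oo] --> final mu G z z0 j.
Proof.
have E (mu' G' z' : X * Y -> R) : \int[time]_t src mu' G' z' j t = \int[time]_t ((fun=> 1) t * src mu' G' z' j t).
  by apply: eq_Rintegral => t _; rewrite mul1r.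
rewrite /final; apply: cvgD; first exact: cvg_ze.
rewrite E; under eq_fun do rewrite E.
by apply: (@cvg_src (fun=> 1) 1) => // t; rewrite normr1.
Qed.

(** A mode is bounded in time by its initial value and the L^1 norms of [G_ n] and [mu_ n z_ n],
    which are uniform in [n]. *)
Let An_bounded j : exists C, forall n t, `|An n j t| <= C.
Proof.
have [E E0 hE] := energy_bounded; have [C C0 hC] := data_bounded.
have [C1 hC1] := cvg_bounded (cvg_ze (j := j)).
have B0 : 0 <= B by apply: le_trans (eB 0%N point).
have IG n : \int[m]_p `|G_ n p| <= fine (m setT) + C.
  have [g1 _ _] := hC n; have I2 := sqint_sqr (G_2 n).
  apply: (@le_trans _ _ (\int[m]_p (1 + G_ n p ^+ 2))).
    apply: le_Rintegral => //; first exact: intg_norm (sqint_intg (G_2 n)).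
      exact: intgD (intg_cst m 1) I2.
    move=> p _; have := sqr_ge0 (`|G_ n p| - 1); rewrite sqrrB real_normK ?num_real// mulr2n expr1n.
    have := sqr_ge0 (G_ n p); lra.
  rewrite RintegralD//; last exact: intg_cst.
  by rewrite Rintegral_cst// mul1r lerD2l.
have Ib n : \int[m]_p `|bn n p| <= C + E.
  have [_ _ g3] := hC n; have [e1 _] := hE n.
  have I2 : intg m (fun p => mu_ n p * z_ n p ^+ 2).
    exact: intg_bddM (mmu_ n) (mu_M n) (sqint_sqr (z_2 n)).
  (* [|z| <= 1 + z^2] with weight [mu_ n]: the L^1 norm of [mu_ n z_ n] is controlled by
     [\int mu_ n] and the energy. *)
  apply: (@le_trans _ _ (\int[m]_p (mu_ n p + mu_ n p * z_ n p ^+ 2))).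
    apply: le_Rintegral => //; first exact: intg_norm (sqint_intg (bn2 n)).
      exact: intgD.
    move=> p _; rewrite /bn normrM (ger0_norm (mu_ge0 n p)) -[X in X + _]mulr1 -mulrDr ler_wpM2l//.
    have := sqr_ge0 (`|z_ n p| - 1); rewrite sqrrB real_normK ?num_real// mulr2n expr1n.
    have := sqr_ge0 (z_ n p); lra.
  by rewrite RintegralD//; [exact: lerD|exact: Imu_].
have tst (f : X * Y -> R) (f2 : sqint m f) t : `|\int[m]_p (f p * cut (fun s => K s t) j p)| <= B * \int[m]_p `|f p|.
  have Is : intg m (fun p => f p * cut (fun s => K s t) j p).
    apply: (intgM f2); apply: sqint_bdd (mcut j (mKt t)) (cut_bdd j (KC t)).
  have If := intg_norm (sqint_intg f2).
  apply: le_trans; first by apply: le_normr_Rintegral => //; exact: Is.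
  rewrite -RintegralZl//; apply: le_Rintegral => //; [exact: intg_norm Is|exact: intgZ|].
  move=> p _; rewrite normrM mulrC ler_wpM2r//.
  by have := cut_bdd j (KC t) p; rewrite mul1r.
exists (C1 + (B * (fine (m setT) + C) + `|lam j| * (B * (C + E)))) => n t.
rewrite /An; apply: le_trans (ler_normD _ _) _; apply: lerD; first exact: hC1.
rewrite /prim (Rint_src_gen j (G_2 n) (bn2 n) (mKt t) (KC t)).
apply: le_trans (ler_normB _ _) _; apply: lerD.
  by apply: le_trans (tst _ (G_2 n) t) _; rewrite ler_wpM2l.
rewrite normrM ler_wpM2l//; apply: le_trans (tst _ (bn2 n) t) _.
by rewrite ler_wpM2l.
Qed.

Let mAn n j : measurable_fun setT (An n j : X -> R).
Proof.
apply: measurable_funD => //.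
have s2 := sqint_src (mmu_ n) (mu_M n) (G_2 n) (z_2 n) j.
exact: intg_meas (intg_prim (sqint_intg s2)).
Qed.

Let mA j : measurable_fun setT (A j : X -> R).
Proof.
apply: measurable_funD => //; have s2 := sqint_src mmu muM G2 z2 j.
exact: intg_meas (intg_prim (sqint_intg s2)).
Qed.

Let A_bdd j C : (forall n t, `|An n j t| <= C) -> forall t, `|A j t| <= C.
Proof.
move=> hC t; have h : `|An n j t| @[n --> \oo] --> `|A j t| by apply: cvg_norm; exact: cvg_An.
rewrite -(cvg_lim _ h)//; apply: limr_le; first by apply/cvg_ex; eexists; exact: h.
by apply: nearW => n; exact: hC.
Qed.

Let dA2 n j : sqint time (fun t => An n j t - A j t).
Proof.
have [C hC] := An_bounded j; apply: sqintB.
  exact: sqint_bdd (mAn n j) (hC n).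
exact: sqint_bdd (mA j) (A_bdd hC).
Qed.

Lemma cvg_An_L2 j : \int[time]_t ((An n j t - A j t) ^+ 2) @[n --> \oo] --> 0.
Proof.
have [C hC] := An_bounded j; have hA := A_bdd hC.
have -> : (0 : R) = \int[time]_t (0 : R) by rewrite Rintegral_cst// mul0r.
apply: (@Rint_DCT _ X _ time (fun n t => (An n j t - A j t) ^+ 2) (fun=> 0) (fun=> (C + C) ^+ 2)) => //.
- by move=> n; exact: intg_meas (sqint_sqr (dA2 n j)).
- apply: nearW => t; have h : (An n j t - A j t) @[n --> \oo] --> 0.
    by rewrite -(subrr (A j t)); apply: cvgB; [exact: cvg_An|exact: cvg_cst].
  have h2 : ((An n j t - A j t) * (An n j t - A j t)) @[n --> \oo] --> (0 : R) * 0 by exact: cvgM.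
  by rewrite mulr0 in h2.
- exact: (intg_cst time).
- apply: nearW => t n; rewrite normrX ler_sqr ?nnegrE//; last first.
    by rewrite addr_ge0// (le_trans _ (hA t)).
  by apply: le_trans (ler_normB _ _) _; exact: lerD.
Qed.

Let ae_An n j : {ae time, forall t, coef (z_ n) j t = An n j t}.
Proof. exact: (modes_eq (mmu_ n) (mu_M n) (G_2 n) (z_2 n) (z0_2 n) (z_sol n) j). Qed.

Let ae_A j : {ae time, forall t, coef z j t = A j t}.
Proof. exact: (modes_eq mmu muM G2 z2 z02 zs j). Qed.

(** A strong limit times a weak one: the modes of [z_ n] converge strongly in time by [cvg_An_L2],
    and those of [G_ n] weakly. *)
Lemma cvg_zG j : \int[time]_t (coef (z_ n) j t * coef (G_ n) j t) @[n --> \oo] -->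
  \int[time]_t (coef z j t * coef G j t).
Proof.
have [E E0 hE] := data_bounded; have [C hC] := An_bounded j; have hA := A_bdd hC.
have cG n := c2 j (G_2 n); have A2 := sqint_bdd time (mA j) hA.
have En n : \int[time]_t (coef (z_ n) j t * coef (G_ n) j t) =
    \int[time]_t (coef (G_ n) j t * (An n j t - A j t)) + \int[m]_p (G_ n p * cut (A j) j p).
  rewrite -(Rint_coef_bdd mE me eB j (G_2 n) (mA j) hA).
  rewrite -RintegralD//; [|exact: intgM (cG n) (dA2 n j)|exact: intgM A2 (cG n)].
  apply: ae_eq_Rint.
  - exact: intg_meas (intgM (c2 j (z_2 n)) (cG n)).
  - exact: intg_meas (intgD (intgM (cG n) (dA2 n j)) (intgM A2 (cG n))).
  - by apply: filterS (ae_An n j) => t ->; ring.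
have E1 : \int[time]_t (coef z j t * coef G j t) = 0 + \int[m]_p (G p * cut (A j) j p).
  rewrite add0r -(Rint_coef_bdd mE me eB j G2 (mA j) hA); apply: ae_eq_Rint.
  - exact: intg_meas (intgM (c2 j z2) (c2 j G2)).
  - exact: intg_meas (intgM A2 (c2 j G2)).
  - by apply: filterS (ae_A j) => t ->.
rewrite E1; under eq_fun do rewrite En.
apply: cvgD; last by apply: G_cvg; exact: sqint_bdd (mcut j (mA j)) (cut_bdd j hA).
apply: (@cvg0_CS _ X _ time (fun n => coef (G_ n) j) (fun n t => An n j t - A j t) E) => //.
  move=> n; have [g1 _ _] := hE n; apply: le_trans g1.
  have := bessel_prod mE me eB e_ortho e_norm j.+1 (G_2 n).
  rewrite big_ord_recr/=; apply: le_trans; rewrite lerDr sumr_ge0// => i _.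
  exact: Rint_sqr_ge0.
exact: cvg_An_L2.
Qed.

(** Unlike [G_ n], the factor [mu_ n z_ n] need not be bounded in L^2. A square root of [mu_ n] is
    moved onto the difference [d n] of the means, and [\int mu_ n d^2] tends to 0: replacing [mu_ n]
    by [mu] costs at most the L^1 distance times a uniform bound of [d^2], and [mu] is bounded. *)
Lemma cvg_zb : \int[time]_t (coef (z_ n) c0 t * coef (bn n) c0 t) @[n --> \oo] -->
  \int[time]_t (coef z c0 t * coef b c0 t).
Proof.
have [E E0 hE] := energy_bounded; have [C hC] := An_bounded c0; have hA := A_bdd hC.
have cb n := c2 c0 (bn2 n); have A2 := sqint_bdd time (mA c0) hA.
pose d n (t : X) := An n c0 t - A c0 t.
have md n : measurable_fun setT (d n) by exact: measurable_funB.
have dC n t : `|d n t| <= C + C by apply: le_trans (ler_normB _ _) _; exact: lerD.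
pose w n (p : X * Y) := rt n p * d n p.1.
have md1 n : measurable_fun setT (fun p : X * Y => d n p.1) by exact: measurableT_comp.
have d12 n : sqint m (fun p => d n p.1) by exact: (sqint_bdd m (md1 n) (fun p => dC n p.1)).
have w2 n : sqint m (w n) by exact: sqint_bddM (mrt n) (rt_bdd n) (d12 n).
have En n : \int[time]_t (coef (z_ n) c0 t * coef (bn n) c0 t) =
    \int[m]_p (uz n p * w n p) + \int[m]_p (bn n p * cut (A c0) c0 p).
  have -> : \int[m]_p (uz n p * w n p) = \int[m]_p (bn n p * (d n p.1 * e c0 p.2)).
    apply: eq_Rintegral => p _; rewrite e_c0 /uz /w /bn -rt_sqr; ring.
  rewrite -(Rint_coef_bdd mE me eB c0 (bn2 n) (md n) (dC n)).
  rewrite -(Rint_coef_bdd mE me eB c0 (bn2 n) (mA c0) hA).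
  rewrite -RintegralD//; [|exact: intgM (dA2 n c0) (cb n)|exact: intgM A2 (cb n)].
  apply: ae_eq_Rint.
  - exact: intg_meas (intgM (c2 c0 (z_2 n)) (cb n)).
  - exact: intg_meas (intgD (intgM (dA2 n c0) (cb n)) (intgM A2 (cb n))).
  - by apply: filterS (ae_An n c0) => t ->; rewrite /d; ring.
have E1 : \int[time]_t (coef z c0 t * coef b c0 t) = 0 + \int[m]_p (b p * cut (A c0) c0 p).
  rewrite add0r -(Rint_coef_bdd mE me eB c0 b2 (mA c0) hA); apply: ae_eq_Rint.
  - exact: intg_meas (intgM (c2 c0 z2) (c2 c0 b2)).
  - exact: intg_meas (intgM A2 (c2 c0 b2)).
  - by apply: filterS (ae_A c0) => t ->.
rewrite E1; under eq_fun do rewrite En.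
apply: cvgD; last exact: weak_cvg_muz (mcut c0 (mA c0)) (cut_bdd c0 hA).
apply: (@cvg0_CS _ _ _ m uz w E) => //.
  by move=> n; under eq_Rintegral do rewrite uz_sqr; case: (hE n).
have M0 : 0 <= M by apply: le_trans (muM (0, point)); exact: normr_ge0.
have hc : ((C + C) ^+ 2 * \int[m]_p `|mu_ n p - mu p| + M * \int[time]_t (d n t ^+ 2)) @[n --> \oo] --> (0 : R) + 0.
  apply: cvgD.
    by rewrite -(mulr0 ((C + C) ^+ 2)); exact: cvgMl_tmp.
  by rewrite -(mulr0 M); apply: cvgMl_tmp; exact: cvg_An_L2.
rewrite addr0 in hc; apply: (@squeeze_cvgr _ _ _ _ (cst 0) _ _ _ _ _ hc); last exact: cvg_cst.
apply: nearW => n; rewrite Rint_sqr_ge0/=.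
have Id := sqint_sqr (d12 n).
have -> : \int[time]_t (d n t ^+ 2) = \int[m]_p (d n p.1 ^+ 2).
  by rewrite (Rint_fst mE (sqint_sqr (dA2 n c0))) my1 mulr1.
rewrite -!RintegralZl//; last exact: Idmu.
rewrite -RintegralD//; [|exact: intgZ (Idmu n)|exact: intgZ Id].
apply: le_Rintegral => //; [exact: sqint_sqr|exact: intgD (intgZ _ (Idmu n)) (intgZ _ Id)|].
move=> p _; rewrite /w exprMn rt_sqr.
have h1 : d n p.1 ^+ 2 <= (C + C) ^+ 2.
  by rewrite -[leLHS]real_normK ?num_real// ler_sqr ?nnegrE ?dC// (le_trans _ (dC n p.1)).
apply: (@le_trans _ _ (`|mu_ n p - mu p| * d n p.1 ^+ 2 + mu p * d n p.1 ^+ 2)).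
  by rewrite -mulrDl ler_wpM2r ?sqr_ge0//; have := ler_norm (mu_ n p - mu p); lra.
apply: lerD; first by rewrite mulrC ler_wpM2r.
by rewrite ler_wpM2r ?sqr_ge0//; apply: le_trans (muM p); exact: ler_norm.
Qed.

Lemma cvg_rhs_n J : rhs (mu_ n) (G_ n) (z_ n) (z0_ n) J @[n --> \oo] --> rhs mu G z z0 J.
Proof.
rewrite /rhs; apply: cvgD; last by apply: cvgMl_tmp; exact: cvg_zb.
apply: (@cvg_sum_ord R (fun j n => res (mu_ n) (G_ n) (z_ n) (z0_ n) j) (res mu G z z0)) => j.
rewrite /res; apply: cvgB.
  apply: cvgD; last by do 2 apply: cvgMl_tmp; exact: cvg_zG.
  by apply: cvgMl_tmp; under eq_fun do rewrite expr2; rewrite expr2; apply: cvgM; exact: cvg_ze.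
by apply: cvgMl_tmp; under eq_fun do rewrite expr2; rewrite expr2; apply: cvgM; exact: cvg_final.
Qed.

(** The tail estimate has the same [W] and [J] for all [n], so that one finite sum, which converges
    by [cvg_rhs_n], carries the energies up to [eps]. *)
Lemma energy_limsup (eps : R) : 0 < eps -> \forall n \near \oo,
  \int[m]_p (mu_ n p * z_ n p ^+ 2) <= \int[m]_p (mu p * z p ^+ 2) + eps.
Proof.
have aux (i i' r r' w : R) : `|2 * i - r| < eps / 2 -> `|r - r'| < eps / 2 ->
    2 * i' <= r' + w -> w <= eps -> i' <= i + eps.
  by rewrite !ltr_norml => /andP[? _] /andP[? _] ? ?; lra.
move=> eps0; have [E E0 hE] := energy_bounded; have [C C0 hC] := data_bounded.
(* [D] bounds the bracket of [energy_tail] for [delta = 1], uniformly in [n]; the 1 makes it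
   positive. *)
pose D := C + E + C + 1; have D0 : 0 < D by rewrite /D; lra.
pose W := eps / D; have W0 : 0 < W by rewrite divr_gt0.
have [J1 hJ1] := lam_oo W^-1.
have e2 : 0 < eps / 2 by rewrite divr_gt0.
have /cvgrPdist_lt /(_ _ e2)[J2 _ hJ2] := cvg_rhs mmu muM G2 z2 z02 zs.
pose J := maxn J1 J2.
have /cvgrPdist_lt /(_ _ e2)[n0 _ hn0] := @cvg_rhs_n J.
exists n0 => // n /= nn.
have a1 := hJ2 J (leq_maxr _ _); have a2 := hn0 n nn; rewrite /= in a1 a2.
have wW j : (J <= j)%N -> wt j <= W \/ forall y, e j y = 0.
  move=> Jj; have [lW|] := hJ1 j (leq_trans (leq_maxl _ _) Jj); last by right.
  left; rewrite /wt -[leRHS]invrK lef_pV2// posrE ?invr_gt0//.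
  by apply: lt_le_trans lW; rewrite invr_gt0.
have t1 := energy_tail (mmu_ n) (mu_M n) (G_2 n) (z_2 n) (z0_2 n) (z_sol n) ltr01 (ltW W0) wW.
have [g1 g2 g3] := hC n; have [h1 h2] := hE n.
have t2 : W * (\int[my]_y (z0_ n y ^+ 2) + 1 * \int[m]_p (z_ n p ^+ 2) + 1^-1 * \int[m]_p (G_ n p ^+ 2)) <= eps.
  apply: (@le_trans _ _ (W * D)); last by rewrite /W divfK// gt_eqF.
  by rewrite ler_wpM2l ?(ltW W0)// mul1r invr1 mul1r /D ler_wpDr ?ler01// !lerD.
exact: aux a1 a2 t1 t2.
Qed.

Let u p := rt0 p * z p.
Let u2 : sqint m u. Proof. exact: sqint_bddM mrt0 rt0_bdd z2. Qed.

(** [uz n] is [mu^(1/2) z_ n], handled by [weak_cvg], plus [sd n * z_ n]. The latter is bounded in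
    L^2 and tends to 0 against bounded functions by [cvg_root], hence against [u], which is merely
    in L^2, by [weak0_bdd]. *)
Lemma cvg_cross : \int[m]_p (uz n p * u p) @[n --> \oo] --> \int[m]_p (mu p * z p ^+ 2).
Proof.
have [E E0 hE] := energy_bounded.
pose v n p := sd n p * z_ n p.
have sdC n p : `|sd n p| <= Num.sqrt (M_ n) + Num.sqrt M.
  by apply: le_trans (ler_normB _ _) _; exact: lerD (rt_bdd n p) (rt0_bdd p).
have v2 n : sqint m (v n) by exact: sqint_bddM (msd n) (sdC n) (z_2 n).
have M0 : 0 <= M by apply: le_trans (muM (0, point)); exact: normr_ge0.
have v0 : \int[m]_p (v n p * u p) @[n --> \oo] --> 0.
  apply: (@weak0_bdd _ _ _ m v (2 * E + 2 * (M * E))) => //.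
    move=> n; have I1 := sqint_sqr (uz2 n); have I2 := sqint_sqr (z_2 n).
    apply: (@le_trans _ _ (\int[m]_p (2 * (uz n p ^+ 2) + 2 * (M * z_ n p ^+ 2)))).
      apply: le_Rintegral => //; [exact: sqint_sqr|exact: intgD (intgZ _ I1) (intgZ _ (intgZ _ I2))|].
      move=> p _; have -> : v n p = uz n p - rt0 p * z_ n p by rewrite /v /sd /uz; ring.
      apply: (@le_trans _ _ (2 * (uz n p ^+ 2) + 2 * ((rt0 p * z_ n p) ^+ 2))).
        have := sqr_ge0 (uz n p + rt0 p * z_ n p); move: (uz n p) (rt0 p * z_ n p) => a c.
        by rewrite sqrrB sqrrD !mulr2n; lra.
      rewrite [(rt0 p * _) ^+ 2]exprMn rt0_sqr lerD2l ler_wpM2l// ler_wpM2r ?sqr_ge0//.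
      by apply: le_trans (muM p); exact: ler_norm.
    rewrite RintegralD//; [|exact: intgZ|exact: intgZ (intgZ _ I2)].
    rewrite !RintegralZl//; last exact: intgZ.
    have [e1 e2] := hE n; under eq_Rintegral do rewrite uz_sqr.
    by apply: lerD; rewrite ler_wpM2l// ler_wpM2l.
  move=> psi k mpsi psik.
  have -> : (fun n => \int[m]_p (v n p * psi p)) = (fun n => \int[m]_p (psi p * z_ n p * sd n p)).
    by apply/funext => n; apply: eq_Rintegral => p _; rewrite /v; ring.
  apply: (@cvg0_CS _ _ _ m (fun n p => psi p * z_ n p) sd (k ^+ 2 * E)) => //.
  - by move=> n; exact: sqint_bddM mpsi psik (z_2 n).
  - move=> n; apply: (@le_trans _ _ (\int[m]_p (k ^+ 2 * z_ n p ^+ 2))).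
      apply: le_Rintegral => //; first exact: sqint_sqr (sqint_bddM mpsi psik (z_2 n)).
        exact: intgZ (sqint_sqr (z_2 n)).
      move=> p _; rewrite exprMn ler_wpM2r ?sqr_ge0//.
      by rewrite -[leLHS]real_normK ?num_real// ler_sqr ?nnegrE// (le_trans _ (psik p)).
    rewrite RintegralZl//; last exact: sqint_sqr (z_2 n).
    by rewrite ler_wpM2l ?sqr_ge0//; case: (hE n).
  - exact: cvg_root.
have h : (\int[m]_p (v n p * u p) + \int[m]_p (z_ n p * b p)) @[n --> \oo] -->
    0 + \int[m]_p (z p * b p) by apply: cvgD => //; exact: weak_cvg.
have -> : \int[m]_p (mu p * z p ^+ 2) = 0 + \int[m]_p (z p * b p).
  by rewrite add0r; apply: eq_Rintegral => p _; rewrite /b; ring.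
apply: cvg_trans h; apply: near_eq_cvg; apply: nearW => n /=.
rewrite -RintegralD//; [|exact: intgM (v2 n) u2|exact: intgM (z_2 n) b2].
by apply: eq_Rintegral => p _; rewrite /v /sd /u /b -rt0_sqr /uz; ring.
Qed.

Lemma strong_cvg_uz : \int[m]_p ((Num.sqrt (mu_ n p) * z_ n p - Num.sqrt (mu p) * z p) ^+ 2)
  @[n --> \oo] --> 0.
Proof.
rewrite -[X in X @ _ --> _]/(fun n => \int[m]_p ((uz n p - u p) ^+ 2)).
have Eu : \int[m]_p (u p ^+ 2) = \int[m]_p (mu p * z p ^+ 2).
  by apply: eq_Rintegral => p _; rewrite /u exprMn rt0_sqr.
apply/cvgrPdist_le => eps eps0.
(* In the expanded square the energy costs one third of [eps], and the cross term, which is doubled,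
   costs two. *)
have e3 : 0 < eps / 3 by rewrite divr_gt0.
have [n1 _ hn1] := energy_limsup e3.
have /cvgrPdist_lt /(_ _ e3)[n2 _ hn2] := cvg_cross.
exists (maxn n1 n2) => // n /=; rewrite geq_max => /andP[/hn1 a1 /hn2 /= a2].
rewrite sub0r normrN ger0_norm ?Rint_sqr_ge0// Rint_sqrB// Eu.
under eq_Rintegral do rewrite uz_sqr.
by move: a1 a2; rewrite ltr_norml => a1 /andP[_ a2]; lra.
Qed.

(** [z_n - z = (uz_n - u) / mu_n^(1/2) - h_n z] with [h_n = 1 - (mu / mu_n)^(1/2)]. The lower bound
    [alpha] controls the first term and makes [h_n] uniformly bounded and convergent to 0 in L^2, as
    [cvg0_sqrM] requires. *)
Lemma strong_cvg_z : \int[m]_p ((z_ n p - z p) ^+ 2) @[n --> \oo] --> 0.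
Proof.
pose h n p := sd n p / rt n p.
have rtge n p : Num.sqrt alpha <= rt n p by rewrite ler_wsqrtr.
have sa0 : 0 < Num.sqrt alpha by rewrite sqrtr_gt0.
have rtgt n p : 0 < rt n p by exact: lt_le_trans sa0 (rtge n p).
have hb n p : `|h n p| <= 1 + Num.sqrt M / Num.sqrt alpha.
  have -> : h n p = 1 - rt0 p / rt n p.
    by have rtn := rtgt n p; rewrite /h /sd mulrBl divff// gt_eqF.
  apply: le_trans (ler_normB _ _) _; rewrite normr1 lerD2l normrM normfV ger0_norm ?sqrtr_ge0//.
  apply: ler_pM; rewrite ?sqrtr_ge0 ?invr_ge0 ?normr_ge0//.
    by apply: le_trans (rt0_bdd p); exact: ler_norm.
  by rewrite ger0_norm ?(ltW (rtgt n p))// lef_pV2// posrE.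
have mh n : measurable_fun setT (h n).
  apply: measurable_funM => //.
  have -> : (fun p => (rt n p)^-1) = (fun p => powR (rt n p) (-1)).
    by apply/funext => p; rewrite powR_inv1// ltW.
  by apply: (measurableT_comp (measurable_powR (-1))).
have hh : \int[m]_p (h n p ^+ 2) @[n --> \oo] --> 0.
  have c : (alpha^-1 * \int[m]_p (sd n p ^+ 2)) @[n --> \oo] --> 0.
    by rewrite -(mulr0 alpha^-1); apply: cvgMl_tmp; exact: cvg_root.
  apply: (@squeeze_cvgr _ _ _ _ (cst 0) _ _ _ _ _ c); last exact: cvg_cst.
  apply: nearW => n; rewrite Rint_sqr_ge0/= -RintegralZl//; last exact: sqint_sqr (sd2 n).
  apply: le_Rintegral => //; first exact: sqint_sqr (sqint_bdd m (mh n) (hb n)).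
    exact: intgZ (sqint_sqr (sd2 n)).
  move=> p _; rewrite /h exprMn mulrC ler_wpM2r ?sqr_ge0// exprVn rt_sqr lef_pV2// ?posrE//.
  exact: lt_le_trans alpha_gt0 (mu_ge n p).
have hz := cvg0_sqrM mh hb hh z2.
have c : (2 * alpha^-1 * \int[m]_p ((uz n p - u p) ^+ 2) + 2 * \int[m]_p ((h n p * z p) ^+ 2))
    @[n --> \oo] --> (0 : R) + 0.
  apply: cvgD.
    by rewrite -(mulr0 (2 * alpha^-1)); apply: cvgMl_tmp; exact: strong_cvg_uz.
  by rewrite -(mulr0 2); apply: cvgMl_tmp.
rewrite addr0 in c; apply: (@squeeze_cvgr _ _ _ _ (cst 0) _ _ _ _ _ c); last exact: cvg_cst.
apply: nearW => n; rewrite Rint_sqr_ge0/=.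
have I1 := sqint_sqr (sqintB (uz2 n) u2).
have I2 := sqint_sqr (sqint_bddM (mh n) (hb n) z2).
rewrite -!RintegralZl// -RintegralD//; [|exact: intgZ..].
apply: le_Rintegral => //; [exact: sqint_sqr (sqintB (z_2 n) z2)|exact: intgD (intgZ _ I1) (intgZ _ I2)|].
move=> p _; have -> : z_ n p - z p = (uz n p - u p) / rt n p - h n p * z p.
  have rtn0 : rt n p != 0 by rewrite gt_eqF.
  by rewrite /uz /u /h /sd; move: (rt n p) (rt0 p) (z_ n p) (z p) rtn0 => r s x y r0; field.
apply: (@le_trans _ _ (2 * ((uz n p - u p) / rt n p) ^+ 2 + 2 * (h n p * z p) ^+ 2)).
  move: ((uz n p - u p) / rt n p) (h n p * z p) => a c'.
  by have := sqr_ge0 (a + c'); rewrite sqrrB sqrrD !mulr2n; lra.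
rewrite lerD2r -mulrA ler_wpM2l// exprMn mulrC ler_wpM2r ?sqr_ge0// exprVn rt_sqr.
rewrite lef_pV2// posrE; exact: lt_le_trans alpha_gt0 (mu_ge n p).
Qed.

End strong.

Theorem abstract_stability : exists2 z, sqint m z & [/\ sol mu G z0 z,
  forall w, sqint m w -> sol mu G z0 w -> {ae m, forall p, w p = z p},
  \int[m]_p ((Num.sqrt (mu_ n p) * z_ n p - Num.sqrt (mu p) * z p) ^+ 2) @[n --> \oo] --> 0 &
  \int[m]_p ((z_ n p - z p) ^+ 2) @[n --> \oo] --> 0].
Proof.
have [z z2 [zs zr]] := limit_exists; exists z => //; split => //.
- by move=> w w2 ws; exact: (sol_unique mmu muM alpha_gt0 muge G2 z02 z2 w2 zs ws).
- exact: strong_cvg_uz z2 zs zr.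
- exact: strong_cvg_z z2 zs zr.
Qed.

End limit.

End evolution.

(** * Smooth test functions *)

Section Ck_algebra.
Context {R : realType} (V : normedModType R).
Implicit Types f g : V -> R.

Lemma Ck_le k f : Ck k.+1 f -> Ck k f.
Proof.
elim: k f => [|k IH] f [df Df]; first by move=> x; exact: differentiable_continuous.
by split => // v; exact: IH.
Qed.

Lemma Ck_cst k (a : R) : Ck k (fun _ : V => a).
Proof.
elim: k a => [|k IH] a; first by move=> x; exact: cvg_cst.
split=> [x|v]; first exact: differentiable_cst.
have -> : (fun x => 'D_v (fun _ : V => a) x) = (fun _ : V => 0) by apply/funext => x; exact: derive_cst.
exact: IH.
Qed.

Lemma CkD k f g : Ck k f -> Ck k g -> Ck k (fun x => f x + g x).
Proof.
elim: k f g => [|k IH] f g; first by move=> cf cg x; apply: cvgD; [exact: cf|exact: cg].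
move=> [df Df] [dg Dg]; split=> [x|v]; first exact: differentiableD.
rewrite (_ : (fun x => 'D_v _ x) = fun x => 'D_v f x + 'D_v g x); first by apply: IH; [exact: Df|exact: Dg].
by apply/funext => x; rewrite (@deriveD _ _ _ f g)//; exact: diff_derivable.
Qed.

Lemma CkM k f g : Ck k f -> Ck k g -> Ck k (fun x => f x * g x).
Proof.
elim: k f g => [|k IH] f g; first by move=> cf cg x; apply: cvgM; [exact: cf|exact: cg].
move=> Cf Cg; have [df Df] := Cf; have [dg Dg] := Cg; split=> [x|v]; first exact: differentiableM.
rewrite (_ : (fun x => 'D_v _ x) = fun x => f x * 'D_v g x + g x * 'D_v f x).
  by apply: CkD; apply: IH; [exact: Ck_le Cf|exact: Dg|exact: Ck_le Cg|exact: Df].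
by apply/funext => x; rewrite (@deriveM _ _ f g)//; exact: diff_derivable.
Qed.

Lemma Ck_prod k n (f : 'I_n -> V -> R) : (forall i, Ck k (f i)) -> Ck k (fun x => \prod_(i < n) f i x).
Proof.
elim: n f => [|n IH] f Cf.
  by under eq_fun do rewrite big_ord0; exact: Ck_cst.
by under eq_fun do rewrite big_ord_recl; apply: CkM => //; exact: IH.
Qed.

Lemma Ck_sum k n (f : 'I_n -> V -> R) : (forall i, Ck k (f i)) -> Ck k (fun x => \sum_(i < n) f i x).
Proof.
elim: n f => [|n IH] f Cf.
  by under eq_fun do rewrite big_ord0; exact: Ck_cst.
by under eq_fun do rewrite big_ord_recl; apply: CkD => //; exact: IH.
Qed.

(** A family [G] closed under differentiation yields every order by one induction: along an affine
    map with linear part [c], a derivative of [u (l p)] is a constant times another member of [G] at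
    [l p]. *)
Lemma Ck_comp_affine (G : set (R -> R)) (l c : V -> R) :
  (forall u : R -> R, G u -> exists2 u', G u' & forall x, is_derive x (1 : R) u (u' x)) ->
  (forall p, differentiable l p) -> (forall p v h, l (h *: v + p) = h * c v + l p) ->
  forall k (u : R -> R), G u -> Ck k (fun p => u (l p)).
Proof.
move=> GG dl lE; elim=> [|k IH] g Gg; have [g' Gg' gg'] := GG _ Gg.
  move=> x; apply: continuous_comp; first exact: differentiable_continuous.
  by apply/differentiable_continuous/derivable1_diffP; case: (gg' (l x)).
have dg x : differentiable g x by apply/derivable1_diffP; case: (gg' x).
split=> [x|v]; first exact: differentiable_comp.
rewrite (_ : (fun x => 'D_v _ x) = fun x => c v * g' (l x)).
  by apply: CkM; [exact: Ck_cst|exact: IH].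
apply/funext => x; transitivity ('D_(c v) g (l x)).
  by rewrite /derive; under eq_fun do rewrite /= lE.
by rewrite deriveE// diff1E// derive1E; case: (gg' (l x)) => _ ->.
Qed.

End Ck_algebra.

Section flat.
Context {R : realType} (eps : R).
Hypothesis eps_gt0 : 0 < eps.

(* Closed under differentiation: the derivative of [p(1/x) exp(-eps/x)] is [q(1/x) exp(-eps/x)]
   with [q = X^2 (eps p - p')]. *)
Definition flat (p : {poly R}) (x : R) : R := if 0 < x then p.[x^-1] * expR (- eps / x) else 0.

Lemma pow_le_expR m : exists2 C, 0 <= C & forall y, 0 <= y -> y ^+ m <= C * expR (eps * y).
Proof.
case: m => [|m].
  by exists 1 => // y y0; rewrite mul1r expr0 -expR0 ler_expR mulr_ge0 ?(ltW eps_gt0).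
exists (m.+1`!%:R / eps ^+ m.+1) => [|y y0]; first by rewrite divr_ge0// exprn_ge0// ltW.
have := expR_ge1Dxn m (mulr_ge0 (ltW eps_gt0) y0).
have e0 : eps ^+ m.+1 != 0 by rewrite expf_neq0// gt_eqF.
have m0 : m.+1`!%:R != 0 :> R by rewrite pnatr_eq0 -lt0n fact_gt0.
rewrite exprMn => h.
have -> : y ^+ m.+1 = m.+1`!%:R / eps ^+ m.+1 * (eps ^+ m.+1 * y ^+ m.+1 / m.+1`!%:R).
  by move: (eps ^+ m.+1) (m.+1`!%:R) (y ^+ m.+1) e0 m0 => a b c a0 b0; field; rewrite a0 b0.
rewrite ler_wpM2l ?divr_ge0 ?exprn_ge0 ?(ltW eps_gt0)//.
by apply: le_trans h; rewrite lerDr.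
Qed.

Lemma poly_le_expR (p : {poly R}) : exists2 C, 0 <= C & forall y, 0 <= y -> `|p.[y]| <= C * expR (eps * y).
Proof.
have /choice[C hC] m : exists C, 0 <= C /\ forall y, 0 <= y -> y ^+ m <= C * expR (eps * y).
  by have [C] := pow_le_expR m; exists C.
exists (\sum_(i < size p) `|p`_i| * C i) => [|y y0].
  by apply: sumr_ge0 => i _; rewrite mulr_ge0//; case: (hC i).
rewrite horner_coef mulr_suml; apply: le_trans (ler_norm_sum _ _ _) _.
apply: ler_sum => i _; rewrite normrM -mulrA ler_wpM2l//.
by rewrite normrX ger0_norm//; have [_ ->] := hC i.
Qed.

(** The exponential beats every polynomial in [1/x]. Applying this to ['X^2 * p] gains the factor
    [x^2], which makes the difference quotient at 0 vanish. *)
Lemma flat_bound p : exists2 C, 0 <= C & forall x, `|flat p x| <= C * x ^+ 2.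
Proof.
have [C C0 hC] := poly_le_expR ('X^2 * p); exists C => // x; rewrite /flat; case: ifPn => [x0|_]; last first.
  by rewrite normr0 mulr_ge0// sqr_ge0.
have y0 : 0 <= x^-1 by rewrite invr_ge0 ltW.
have := hC _ y0; rewrite hornerM hornerXn normrM (ger0_norm (exprn_ge0 2 y0)).
rewrite [`|_ * expR _|]normrM [`|expR _|]ger0_norm ?expR_ge0// mulNr expRN => h.
rewrite ler_pdivrMr ?expR_gt0// mulrAC -ler_pdivrMr ?exprn_gt0//.
by rewrite mulrC -exprVn.
Qed.

Lemma is_derive_flat p x : is_derive x (1 : R) (flat p) (flat ('X^2 * (eps *: p - p^`())) x).
Proof.
have [x0|x0|->] := ltgtP x 0.
- rewrite {2}/flat ltNge (ltW x0)/=.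
  apply: (near_eq_is_derive (f := cst (0 : R))).
  near=> y; rewrite /flat ltNge (_ : y <= 0)//.
  by near: y; apply: filterS (lt_nbhsl x0) => y; exact: ltW.
- rewrite {2}/flat x0.
  apply: (@near_eq_is_derive R R R (fun y => p.[y^-1] * expR (- eps / y)) (flat p) x 1).
    near=> y; rewrite /flat (_ : 0 < y)//.
    by near: y; exact: lt_nbhsr.
  have xn : x != 0 by rewrite gt_eqF.
  have dV : is_derive x (1 : R) (fun y => y^-1) (- x ^- 2).
    by split; [exact: derivableV|rewrite deriveV// derive_id [_ *: 1]mulr1].
  have dp := @is_derive1_comp _ (horner p) (fun y => y^-1) x _ _ (is_derive_poly p x^-1) dV.
  have dE := @is_derive1_comp _ expR (fun y => - eps * y^-1) x _ _ (is_derive_expR _)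
    (is_deriveZ (- eps) dV).
  apply: is_derive_eq (is_deriveM dp dE) _; rewrite !hornerE /=.
  rewrite /GRing.scale/= exprVn.
  by move: (expR _) (p.[_]) (p^`().[_]) (x ^- 2) => a b c y; ring.
(* At 0 the quotient is at most [C |h|] by [flat_bound]. *)
- rewrite {2}/flat ltxx; have [C C0 hC] := flat_bound p.
  suff h : (fun h : R => h^-1 *: (flat p (h *: (1 : R) + 0) - flat p 0)) @ 0^' --> (0 : R).
    split; first by apply/cvg_ex; exists 0.
    exact: cvg_lim h.
  apply/cvgrPdist_lt => e e0; have C1 : 0 < C + 1 by rewrite ltr_wpDl.
  near=> h; rewrite /= sub0r normrN addr0 [h *: 1]mulr1 {2}/flat ltxx subr0.
  have hn : h != 0 by near: h; exact: nbhs_dnbhs_neq.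
  have hl : `|h| < e / (C + 1) by near: h; apply: dnbhs0_lt; rewrite divr_gt0.
  have h0 : 0 < `|h| by rewrite normr_gt0.
  rewrite [_ *: _]/(_ * _) normrM normfV mulrC ltr_pdivrMr//.
  apply: le_lt_trans (hC h) _; rewrite -real_normK ?num_real// expr2 mulrA ltr_pM2r//.
  move: hl; rewrite ltr_pdivlMr// => hl; apply: le_lt_trans hl.
  by rewrite mulrC ler_wpM2l// lerDl.
Unshelve. all: by end_near.
Qed.

End flat.

Section cutoff_derivatives.
Context {R : realType}.

Lemma is_derive_ramp (eps x : R) : 0 < eps -> is_derive x (1 : R) (ramp eps) (dramp eps x).
Proof.
move=> e0; have -> : ramp eps = (fun y => y) * flat eps 1.
  apply/funext => y; transitivity (y * flat eps 1 y) => //.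
  by rewrite /ramp /flat; case: ifP => _; rewrite ?mulr0// hornerC mul1r.
apply: is_derive_eq (is_deriveM (is_derive_id x 1) (is_derive_flat e0 1 x)) _.
rewrite /flat /dramp /GRing.scale/=; case: ifP => [x0|_]; last by rewrite mulr0 mul0r addr0.
have xn : x != 0 by rewrite gt_eqF.
rewrite derivC hornerM hornerXn hornerD hornerN hornerZ !hornerC.
by move: (expR _) => E; field.
Qed.

Lemma dramp_flat (eps : R) : dramp eps = flat eps (1 + eps *: 'X).
Proof.
by apply/funext => x; rewrite /dramp /flat; case: ifP => // _; rewrite !hornerE.
Qed.

Definition dtrig1 (k : bool * nat) (x : R) : R :=
  (if k.2 == 0%N then 1 else Num.sqrt 2) * (2 * pi * k.2%:R) *
  (if k.1 then cos (2 * pi * k.2%:R * x) else - sin (2 * pi * k.2%:R * x)).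

Lemma is_derive_trig1 k x : is_derive x (1 : R) (trig1 k) (dtrig1 k x).
Proof.
case: k => [b m]; rewrite /dtrig1 /=; set c := (if _ then _ else _ : R).
have -> : trig1 (b, m) = c \*o (fun y => if b then sin (2 * pi * m%:R * y) else cos (2 * pi * m%:R * y)).
  by [].
case: b.
  apply: is_derive_eq (is_deriveZ c (is_derive_sinM (2 * pi * m%:R) x)) _.
  by rewrite /GRing.scale/=; ring.
apply: is_derive_eq (is_deriveZ c (is_derive_cosM (2 * pi * m%:R) x)) _.
by rewrite /GRing.scale/=; ring.
Qed.

Lemma is_derive_dtrig1 k x : is_derive x (1 : R) (dtrig1 k) (- (2 * pi * k.2%:R) ^+ 2 * trig1 k x).
Proof.
case: k => [b m]; rewrite /trig1 /=; set c := (if _ then _ else _ : R).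
case: b.
  have -> : dtrig1 (true, m) = (c * (2 * pi * m%:R)) \*o (fun y => cos (2 * pi * m%:R * y)) by [].
  apply: is_derive_eq (is_deriveZ _ (is_derive_cosM (2 * pi * m%:R) x)) _.
  by rewrite /GRing.scale/=; ring.
have -> : dtrig1 (false, m) = (- (c * (2 * pi * m%:R))) \*o (fun y => sin (2 * pi * m%:R * y)).
  by apply/funext => y; rewrite /dtrig1/= mulrN mulNr.
apply: is_derive_eq (is_deriveZ _ (is_derive_sinM (2 * pi * m%:R) x)) _.
by rewrite /GRing.scale/=; ring.
Qed.

Lemma trig1_period k (x : R) : trig1 k (x + 1) = trig1 k x.
Proof.
by rewrite /trig1 mulrDr mulr1 sinD cosD sin2pin cos2pin !mulr0 !mulr1 addr0 subr0.
Qed.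

Lemma derive_along (V : normedModType R) (f : V -> R) (p v : V) (u : R -> R) (a b : R) :
  (forall h, f (h *: v + p) = u (h + a)) -> is_derive a (1 : R) u b -> 'D_v f p = b.
Proof.
move=> fu [_ <-]; rewrite /derive.
have -> : f p = u a by rewrite -[a]add0r -fu scale0r add0r.
by under eq_fun do rewrite /= fu; under [in RHS]eq_fun do rewrite /= [_ *: 1]mulr1.
Qed.

End cutoff_derivatives.

(** * Ramps times trigonometric modes as test functions *)

Section modes_on_rows.
Context {R : realType} {N : nat}.
Local Notation V := (R * 'rV[R]_N)%type.

Lemma differentiable_time (p : V) : differentiable (fun q : V => q.1) p.
Proof. by apply: (@linear_differentiable _ _ _ fst); by move=> q; exact: cvg_fst. Qed.

Lemma differentiable_coordinate (i : 'I_N) (p : V) : differentiable (fun q : V => q.2 0 i) p.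
Proof.
apply: (@differentiable_comp _ _ _ _ snd (fun x : 'rV[R]_N => x 0 i)); last exact: differentiable_coord.
by apply: linear_differentiable; by move=> q; exact: cvg_snd.
Qed.

Lemma Ck_ramp_time (eps tau : R) k : 0 < eps -> Ck k (fun p : V => ramp eps (tau - p.1)).
Proof.
(* [ramp] itself is not one of the [flat] functions, but its derivative is. *)
move=> e0; apply: (@Ck_comp_affine _ _ [set g | g = ramp eps \/ exists p, g = flat eps p]
  (fun p : V => tau - p.1) (fun v => - v.1)); last by left.
- move=> g [->|[p ->]].
    exists (dramp eps); last by move=> x; exact: is_derive_ramp.
    by right; exists (1 + eps *: 'X); exact: dramp_flat.
  exists (flat eps ('X^2 * (eps *: p - p^`()))); last by move=> x; exact: is_derive_flat.
  by right; eexists.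
- move=> p; apply: differentiableB => //; exact: differentiable_time.
- by move=> p v h; rewrite /= /GRing.scale/=; ring.
Qed.

Lemma Ck_trig1_coord (f : bool * nat) (i : 'I_N) k : Ck k (fun p : V => trig1 f (p.2 0 i)).
Proof.
(* Combinations of a sine and a cosine of the same frequency are closed under differentiation. *)
apply: (@Ck_comp_affine _ _ [set g | exists a b c : R, g = fun x => a * cos (c * x) + b * sin (c * x)]
  (fun p : V => p.2 0 i) (fun v => v.2 0 i)).
- move=> g [a [b [c ->]]]; exists (fun x => (b * c) * cos (c * x) + (- (a * c)) * sin (c * x)).
    by exists (b * c), (- (a * c)), c.
  move=> x; apply: is_derive_eq (is_deriveD (is_deriveZ a (is_derive_cosM c x)) (is_deriveZ b (is_derive_sinM c x))) _.
  by rewrite /GRing.scale/=; ring.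
- exact: differentiable_coordinate.
- by move=> p v h; rewrite !mxE.
- case: f => [[] m]; rewrite /trig1/=; set c := (if _ then _ else _ : R).
    by exists 0, c, (2 * pi * m%:R); apply/funext => x; rewrite mul0r add0r.
  by exists c, 0, (2 * pi * m%:R); apply/funext => x; rewrite mul0r addr0.
Qed.

Lemma derive_space_dir (F : R -> R) (f : 'I_N -> R -> R) (u u' : R -> R) (i : 'I_N) :
  (forall x, is_derive x (1 : R) u (u' x)) -> forall p,
  'D_(space_dir i) (fun p : V => F p.1 * ((\prod_(j < N | j != i) f j (p.2 0 j)) * u (p.2 0 i))) p =
  F p.1 * ((\prod_(j < N | j != i) f j (p.2 0 j)) * u' (p.2 0 i)).
Proof.
move=> uu' p; set A := \prod_(j < N | j != i) _.
apply: (@derive_along _ _ _ _ _ (fun s => F p.1 * (A * u s)) (p.2 0 i)).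
  move=> h; rewrite /= scaler0 add0r !mxE !eqxx mulr1; congr (_ * (_ * _)).
  by apply: eq_bigr => j ji; rewrite !mxE (negbTE ji) andbF mulr0 add0r.
Qed.

Definition ramp_mode (eps tau : R) (k : N.-tuple (bool * nat)) (p : V) : R :=
  ramp eps (tau - p.1) * \prod_(i < N) trig1 (tnth k i) (p.2 0 i).

Lemma dt_ramp_mode eps tau k p : 0 < eps -> dt (ramp_mode eps tau k) p =
  - dramp eps (tau - p.1) * \prod_(i < N) trig1 (tnth k i) (p.2 0 i).
Proof.
move=> e0; set A := \prod_(i < N) _.
apply: (@derive_along _ _ _ _ _ (fun s => A * ramp eps (tau - s)) p.1).
  by move=> h; rewrite /ramp_mode /= scaler0 add0r [h *: 1]mulr1 mulrC.
have dl : is_derive p.1 (1 : R) (fun s : R => tau - s) (0 - 1).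
  exact: is_deriveB (is_derive_cst tau p.1 1) (is_derive_id p.1 1).
have := @is_derive1_comp _ (ramp eps) (fun s => tau - s) p.1 _ _ (is_derive_ramp _ e0) dl.
move=> h; apply: is_derive_eq (is_deriveZ A h) _.
by rewrite /GRing.scale/=; ring.
Qed.

Lemma lap_ramp_mode eps tau k p : lap (ramp_mode eps tau k) p =
  - ((2 * pi) ^+ 2 * (\sum_(i < N) (tnth k i : bool * nat).2 ^ 2)%:R) * ramp_mode eps tau k p.
Proof.
rewrite /lap natr_sum mulr_sumr -sumrN mulr_suml; apply: eq_bigr => i _.
pose F t := ramp eps (tau - t); pose f j : R -> R := trig1 (tnth k j).
have E : ramp_mode eps tau k = (fun q : V => F q.1 *
    ((\prod_(j < N | j != i) f j (q.2 0 j)) * f i (q.2 0 i))).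
  by apply/funext => q; rewrite /ramp_mode (bigD1 i)//= [X in _ * X]mulrC.
rewrite E; under eq_fun do rewrite (derive_space_dir F f i (is_derive_trig1 (tnth k i))).
rewrite (derive_space_dir F f i (is_derive_dtrig1 (tnth k i))) /f natrX; ring.
Qed.

Lemma test_ramp_mode (T eps tau : R) k : 0 < eps -> tau < T -> test_function T (ramp_mode eps tau k).
Proof.
move=> e0 tT; split.
- move=> j; apply: CkM; first exact: Ck_ramp_time.
  by apply: (@Ck_prod R V j N (fun i p => trig1 (tnth k i) (p.2 0 i))) => i; exact: Ck_trig1_coord.
- move=> i p; rewrite /ramp_mode /= addr0; congr (_ * _); apply: eq_bigr => j _.
  by rewrite !mxE eqxx/=; case: (j == i); rewrite ?addr0// trig1_period.
- exists tau => // t x tt; rewrite /ramp_mode /ramp /= subr_gt0 ltNge tt/=.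
  by rewrite mul0r.
Qed.

End modes_on_rows.

Section ae_product.
Context dX dY (X : measurableType dX) (Y : measurableType dY) {R : realType}.
Variables (mx : {finite_measure set X -> \bar R}) (my : {finite_measure set Y -> \bar R}).

Lemma ae_prod_fst (Q : set X) : {ae mx, forall x, Q x} -> {ae (mx \x my)%E, forall p, Q p.1}.
Proof.
move=> [A [mA A0 QA]]; exists (A `*` setT); split; first exact: measurableX.
  transitivity (mx A * my setT)%E; first exact: product_measure1E.
  by rewrite [X in (X * _)%E]A0 mul0e.
by move=> p /= Qp; split => //; exact: QA.
Qed.

Lemma ae_prod_snd (Q : set Y) : {ae my, forall x, Q x} -> {ae (mx \x my)%E, forall p, Q p.2}.
Proof.
move=> [A [mA A0 QA]]; exists (setT `*` A); split; first exact: measurableX.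
  transitivity (mx setT * my A)%E; first exact: product_measure1E.
  by rewrite [X in (_ * X)%E]A0 mule0.
by move=> p /= Qp; split => //; exact: QA.
Qed.

End ae_product.

(** * Measurability and boundedness of continuous functions read on tuples *)

Section continuous_on_tuples.
Context {R : realType} {N : nat}.
Local Notation V := (R * 'rV[R]_N)%type.
Local Notation ST := (spacetime R N).
Implicit Types f g : V -> R.

Definition tround (n : nat) (t : R) : R := (Num.floor (n.+1%:R * t))%:~R / n.+1%:R.

Lemma tround_dist n t : `|tround n t - t| <= n.+1%:R^-1.
Proof.
have n0 : 0 < n.+1%:R :> R by [].
have -> : tround n t - t = ((Num.floor (n.+1%:R * t))%:~R - n.+1%:R * t) / n.+1%:R.
  by rewrite mulrBl mulrAC divff ?mul1r// gt_eqF.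
rewrite normrM [`|_^-1|]ger0_norm ?invr_ge0// -[leRHS]mul1r ler_wpM2r ?invr_ge0//.
rewrite distrC ger0_norm ?subr_ge0 ?floor_le//.
  by rewrite lerBlDr addrC; apply: ltW; rewrite -intrD1 floorD1_gt.
Qed.

Definition round_pt n (p : V) : V := (tround n p.1, \row_i tround n (p.2 0 i)).

Lemma cvg_round_pt p : round_pt n p @[n --> \oo] --> p.
Proof.
apply/cvg_ballP => e e0.
have /cvgrPdist_lt /(_ _ e0)[n0 _ h] := @cvg_harmonic R.
exists n0 => // n /h; rewrite /= sub0r normrN ger0_norm ?invr_ge0// => ne.
have tn t : ball t e (tround n t).
  by rewrite -ball_normE/= distrC; exact: le_lt_trans (tround_dist n t) ne.
by split => //=; split=> // i j; rewrite (ord1 i) mxE.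
Qed.

(** Continuity refers to the topology of row vectors, measurability to the product sigma-algebra of
    tuples. Rounding the coordinates to a grid bridges the two: [f] is the pointwise limit of
    functions of finitely many integers, which take countably many values. *)
Lemma measurable_on_tuples f : continuous f -> measurable_fun setT (on_tuples f : ST -> R).
Proof.
move=> cf; pose fn n (p : ST) := on_tuples (fun q => f (round_pt n q)) p.
apply: (@measurable_fun_cvg _ _ _ setT fn); last first.
  by move=> p _; apply: continuous_cvg; [exact: cf|exact: cvg_round_pt].
move=> n _ A mA; rewrite setTI.
pose rho (p : ST) : int * N.-tuple int := (Num.floor (n.+1%:R * p.1), [tuple Num.floor (n.+1%:R * tnth p.2 i) | i < N]).
pose F (c : int * N.-tuple int) : R := f (c.1%:~R / n.+1%:R, \row_i ((tnth c.2 i)%:~R / n.+1%:R)).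
have fE p : fn n p = F (rho p).
  rewrite /fn /on_tuples /F /round_pt /rho /=; congr (f (_, _)); apply/rowP => i; rewrite !mxE.
  by rewrite tnth_mktuple.
(* The preimage of [A] is a union over the codes of grid points, each contributing one grid cell or
   nothing. *)
pose H k := if unpickle k is Some c then
  (if `[< A (F c) >] then rho @^-1` [set c] else set0) else set0.
have -> : fn n @^-1` A = \bigcup_k H k.
  apply/seteqP; split => p /=.
    rewrite fE => Ap; exists (pickle (rho p)); first exact: I.
    by rewrite /H pickleK (asboolT Ap); exact: erefl.
  case=> k _; rewrite /H; case: unpickle => // c; case: asboolP => // Ac.
  by rewrite fE => /= ->.
apply: bigcupT_measurable => k; rewrite /H; case: unpickle => // c; case: asboolP => // _.
have mfl z : measurable [set t : measurableTypeR R | Num.floor (n.+1%:R * t) = z].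
  rewrite (_ : [set t | _] = `[z%:~R / n.+1%:R, (z + 1)%:~R / n.+1%:R[%classic); first exact: measurable_itv.
  apply/seteqP; split => t /=; rewrite in_itv/= ler_pdivrMr// ltr_pdivlMr// mulrC.
    by move=> <-; rewrite floor_le floorD1_gt.
  by move=> h; apply/floor_def; rewrite h.
have -> : rho @^-1` [set c] = [set p : ST | Num.floor (n.+1%:R * p.1) = c.1] `&`
    \bigcap_(i : 'I_N) [set p : ST | Num.floor (n.+1%:R * tnth p.2 i) = tnth c.2 i].
  apply/seteqP; split => p; rewrite /rho /=.
    by move=> <-; split => // i _ /=; rewrite tnth_mktuple.
  case: c => c1 c2 /= [-> h]; congr (_, _); apply: eq_from_tnth => i.
  by rewrite tnth_mktuple h.
apply: measurableI.
  have := @measurable_fst _ _ (measurableTypeR R) (torus R N) measurableT _ (mfl c.1).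
  by rewrite setTI.
apply: fin_bigcap_measurable => [|i _]; first exact: finite_finset.
have m2 : measurable_fun setT (fun p : ST => tnth p.2 i : measurableTypeR R).
  by apply: (measurableT_comp (measurable_tnthR i)); exact: measurable_snd.
by have := m2 measurableT _ (mfl (tnth c.2 i)); rewrite setTI.
Qed.

Variable T : R.

(** Closed on all sides, hence compact, so that continuous functions are bounded on it. *)
Definition box : set ST := [set p | 0 <= p.1 <= T /\ forall i, 0 <= tnth p.2 i <= 1].

Lemma measurable_box : measurable box.
Proof.
have mI (a b : R) : measurable (`[a, b]%classic : set (measurableTypeR R)) by exact: measurable_itv.
have -> : box = [set p : ST | p.1 \in `[0, T]] `&`
    \bigcap_(i : 'I_N) [set p : ST | tnth p.2 i \in `[0, 1]].
  by apply/seteqP; split => p; rewrite /box /= ?in_itv/= => -[h1 h2]; split => // i;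
    have := h2 i; rewrite /= in_itv/= => // ->.
apply: measurableI.
  have := @measurable_fst _ _ (measurableTypeR R) (torus R N) measurableT _ (mI 0 T).
  by rewrite setTI.
apply: fin_bigcap_measurable => [|i _]; first exact: finite_finset.
have m2 : measurable_fun setT (fun p : ST => tnth p.2 i : measurableTypeR R).
  by apply: (measurableT_comp (measurable_tnthR i)); exact: measurable_snd.
by have := m2 measurableT _ (mI 0 1); rewrite setTI.
Qed.

Lemma bounded_on_box f : continuous f -> exists C, 0 <= C /\ forall p, box p -> `|on_tuples f p| <= C.
Proof.
move=> cf.
have cr : compact [set v : 'rV[R]_N | forall i, (`[0, 1]%classic : set R) (v ord0 i)].
  by apply: (@rV_compact _ N (fun=> `[0, 1]%classic : set R)) => i; exact: segment_compact.
have cK := compact_setX (@segment_compact R 0 T) cr.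
have := compact_bounded (continuous_compact (continuous_subspaceT cf) cK).
move=> [C [_ hC]]; exists (`|C| + 1); split=> [|p [p1 p2]]; first by rewrite addr_ge0.
apply: hC; first by rewrite (le_lt_trans (ler_norm C))// ltrDl.
exists (p.1, row_of_tuple p.2) => //; split => /=; first by rewrite in_itv.
by move=> i; rewrite mxE in_itv/=.
Qed.

(* Bounded everywhere, and almost everywhere equal to [on_tuples f]. *)
Definition boxed f : ST -> R := on_tuples f \_ box.

Lemma measurable_boxed f : continuous f -> measurable_fun setT (boxed f).
Proof.
move=> cf; apply/(measurable_restrictT _ measurable_box).
by apply: measurable_funTS; exact: measurable_on_tuples.
Qed.

Lemma boxed_bound f : continuous f -> exists C, forall p, `|boxed f p| <= C.
Proof.
move=> cf; have [C [C0 hC]] := bounded_on_box cf; exists C => p.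
by rewrite /boxed patchE; case: ifPn => [/set_mem/hC//|_]; rewrite normr0.
Qed.

Lemma boxed_lin a f g p : boxed (fun q => a * f q + g q) p = a * boxed f p + boxed g p.
Proof. by rewrite /boxed !patchE; case: ifPn => // _; rewrite mulr0 add0r. Qed.

#[local] Instance ae_QT_filter : Filter (nbhs (almost_everywhere (QT_measure T N))).
Proof. exact: ae_filter_ringOfSetsType. Qed.

Lemma ae_box : {ae QT_measure T N, forall p, box p}.
Proof.
have a1 : {ae QT_measure T N, forall p, 0 <= p.1 <= T}.
  apply: (@ae_prod_fst _ _ _ _ _ (time_measure T) (torus_measure N) [set t | 0 <= t <= T]).
  have [A [mA A0 hA]] := @ae_time _ T (time_measure T) (fun A => erefl).
  exists A; split => // t /= h; apply: hA => /= /andP[t0 tT].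
  by apply: h; rewrite t0 ltW.
have a2 : {ae QT_measure T N, forall p, forall i, 0 <= tnth p.2 i <= 1}.
  apply: filter_forall => i.
  apply: (@ae_prod_snd _ _ _ _ _ (time_measure T) (torus_measure N) [set x | 0 <= tnth x i <= 1]).
  have [A [mA A0 hA]] := @ae_unit_interval R N 0 i.
  exists A; split => // x /= h; apply: hA => /= /and3P[x0 x1 _].
  by apply: h; rewrite !ltW.
by apply: filterS2 a1 a2 => p; split.
Qed.

End continuous_on_tuples.

Section test_functions.
Context {R : realType} {N : nat} (T : R).
Local Notation V := (R * 'rV[R]_N)%type.
Implicit Types f g : V -> R.

Lemma smooth_derive f v : smooth f -> smooth (fun q => 'D_v f q).
Proof. by move=> sf k; have [_ h] := sf k.+1; exact: h. Qed.

Lemma smooth_differentiable f p : smooth f -> differentiable f p.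
Proof. by move=> sf; have [h _] := sf 1%N; exact: h. Qed.

Lemma smooth_derive_lin a f g v : smooth f -> smooth g ->
  (fun q => 'D_v (fun p => a * f p + g p) q) = (fun q => a * 'D_v f q + 'D_v g q).
Proof.
move=> sf sg; apply/funext => q.
have df : derivable f q v by apply: diff_derivable; exact: smooth_differentiable.
have dg : derivable g q v by apply: diff_derivable; exact: smooth_differentiable.
have da : derivable (a \*o f) q v by exact: derivableZ.
by rewrite (deriveD da dg) deriveMl.
Qed.

Lemma dt_lin a f g : smooth f -> smooth g ->
  dt (fun q => a * f q + g q) = (fun q => a * dt f q + dt g q).
Proof. by move=> sf sg; exact: smooth_derive_lin. Qed.

Lemma lap_lin a f g : smooth f -> smooth g ->
  lap (fun q => a * f q + g q) = (fun q => a * lap f q + lap g q).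
Proof.
move=> sf sg; apply/funext => q; rewrite /lap mulr_sumr -big_split/=.
apply: eq_bigr => i _; rewrite smooth_derive_lin//.
have := @smooth_derive_lin a _ _ (space_dir i) (smooth_derive (space_dir i) sf) (smooth_derive (space_dir i) sg).
by move/(congr1 (@^~ q)).
Qed.

Lemma continuous_dt f : smooth f -> continuous (dt f).
Proof. by move=> sf; exact: (smooth_derive _ sf 0%N). Qed.

Lemma continuous_lap f : smooth f -> continuous (lap f).
Proof.
move=> sf; apply: (@Ck_sum _ _ 0 N (fun i q => 'D_(space_dir i) (fun p => 'D_(space_dir i) f p) q)) => i.
exact: (smooth_derive _ (smooth_derive _ sf) 0%N).
Qed.

Lemma test_function_lin a f g : test_function T f -> test_function T g ->
  test_function T (fun q => a * f q + g q).
Proof.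
move=> [sf pf [s sT fs]] [sg pg [t tT gt]]; split.
- by move=> k; apply: CkD => //; apply: CkM => //; exact: Ck_cst.
- by move=> i p; rewrite pf pg.
- exists (Num.max s t) => [|u x]; first by rewrite gt_max sT.
  by rewrite ge_max => /andP[su tu]; rewrite fs// gt// mulr0 addr0.
Qed.

Lemma test_function0 : 0 < T -> test_function T (fun _ : V => 0).
Proof. by move=> T0; split => //; [move=> k; exact: Ck_cst|exists 0]. Qed.

End test_functions.

(** * The torus problem *)

Section Lnorm_convergence.
Context d (X : measurableType d) {R : realType} (m : {finite_measure set X -> \bar R}).
Implicit Types f g : X -> R.

Lemma Lfun_oo f : f \in Lfun m +oo%E ->
  measurable_fun setT f /\ exists M, {ae m, forall x, `|f x| <= M}.
Proof.
move=> ff; have mf : measurable_fun setT f by have := sub_Lfun_mfun ff; rewrite inE.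
split=> //; have := sub_Lfun_finLfun ff; rewrite inE/= /finite_norm unlock.
case: ifPn => [m0|]; last first.
  rewrite -leNgt => m0 _; exists 0; exists setT; split => //.
  by apply/eqP; rewrite eq_le m0 measure_ge0.
have := @ess_sup_ge _ _ _ m (abse \o (EFin \o f)).
case: ess_sup => [M||] h //= _.
  by exists M; apply: filterS h => x /=; rewrite lee_fin.
by exists 0; apply: filterS h.
Qed.

Lemma Lcvg1_Rint (f_ : nat -> X -> R) f : (forall n, intg m (f_ n)) -> intg m f ->
  Lcvg m 1%E f_ f -> \int[m]_x `|f_ n x - f x| @[n --> \oo] --> 0.
Proof.
move=> I_ I; rewrite /Lcvg; have -> : (fun n => 'N[m]_1[EFin \o (fun x => (f_ n x - f x)%R)])%E =
    EFin \o (fun n => \int[m]_x `|f_ n x - f x|).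
  apply/funext => n; rewrite Lnorm1 /= /Rintegral fineK//.
  by apply: integrable_fin_num => //; exact: intg_norm (intgB (I_ n) I).
by move/fine_cvgP => [_].
Qed.

Lemma Rint_Lcvg2 (f_ : nat -> X -> R) f : (forall n, sqint m (f_ n)) -> sqint m f ->
  \int[m]_x ((f_ n x - f x) ^+ 2) @[n --> \oo] --> 0 -> Lcvg m 2%:E f_ f.
Proof.
move=> f2_ f2 h; rewrite /Lcvg; have -> : (fun n => 'N[m]_2%:E[EFin \o (fun x => (f_ n x - f x)%R)])%E =
    EFin \o (fun n => Num.sqrt (\int[m]_x ((f_ n x - f x) ^+ 2))).
  apply/funext => n; rewrite unlock /= -powR12_sqrt ?Rint_sqr_ge0// -poweR_EFin.
  congr (_ `^ _)%E; rewrite /Rintegral fineK; last first.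
    by apply: integrable_fin_num => //; exact: sqint_sqr (sqintB (f2_ n) f2).
  by apply: eq_integral => x _ /=; rewrite powR_mulrn// -normrX ger0_norm// sqr_ge0.
apply/fine_cvgP; split; first exact: nearW.
by apply: sqrt_cvg0 => // n; exact: Rint_sqr_ge0.
Qed.

End Lnorm_convergence.

(** * Coefficients bounded everywhere, and the lower bound of the limit *)

Section clipping.
Context d (X : measurableType d) {R : realType} (m : {finite_measure set X -> \bar R}).
Implicit Types f g : X -> R.

Definition clip (a M x : R) := Num.max a (Num.min x M).

Lemma clip_ge a M x : a <= clip a M x.
Proof. by rewrite le_max lexx. Qed.

Lemma clip_bound a M x : 0 < a -> a <= M -> `|clip a M x| <= M.
Proof.
move=> a0 aM; rewrite ger0_norm; last by rewrite (le_trans (ltW a0))// clip_ge.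
by rewrite ge_max aM ge_min lexx orbT.
Qed.

Lemma clip_id a M x : a <= x -> x <= M -> clip a M x = x.
Proof. by move=> ax xM; rewrite /clip min_l// max_r. Qed.

Lemma measurable_clip a M f : measurable_fun setT f -> measurable_fun setT (fun x => clip a M (f x)).
Proof. by move=> mf; apply: measurable_maxr => //; exact: measurable_minr. Qed.

#[local] Instance ae_m_filter : Filter (nbhs (almost_everywhere m)).
Proof. exact: ae_filter_ringOfSetsType. Qed.

Lemma clip_version (alpha : R) f : 0 < alpha -> f \in Lfun m +oo%E ->
  {ae m, forall x, alpha <= f x} -> exists M (g : X -> R),
  [/\ measurable_fun setT g, forall x, `|g x| <= M, forall x, alpha <= g x & {ae m, forall x, g x = f x}].
Proof.
move=> a0 /Lfun_oo[mf [M fM]] af.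
exists (Num.max alpha M), (fun x => clip alpha (Num.max alpha M) (f x)); split.
- exact: measurable_clip.
- by move=> x; apply: clip_bound => //; rewrite le_max lexx.
- by move=> x; exact: clip_ge.
- apply: filterS2 fM af => x xM ax; apply: clip_id => //.
  by rewrite le_max (le_trans (ler_norm _) xM) orbT.
Qed.

Lemma sqint_sqrtM (mu g z : X -> R) M : measurable_fun setT g -> (forall x, `|g x| <= M) ->
  measurable_fun setT mu -> {ae m, forall x, g x = mu x} -> sqint m z ->
  sqint m (fun x => Num.sqrt (mu x) * z x).
Proof.
move=> mg gM mmu gmu z2; apply: (ae_eq_sqint (f := fun x => Num.sqrt (g x) * z x)).
- by apply: measurable_funM; [exact: measurable_sqrtr|exact: sqint_meas z2].
- by apply: filterS gmu => x ->.
- apply: (@sqint_bddM _ _ _ _ (fun x => Num.sqrt (g x)) _ (Num.sqrt M)) => //.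
    exact: measurable_sqrtr.
  by move=> x; rewrite ger0_norm ?sqrtr_ge0// ler_wsqrtr// (le_trans (ler_norm _)).
Qed.

(** The positive part of [alpha - f] is at most [|f_ n - f|] almost everywhere, so its integral
    vanishes. This supplies the lower bound of the limit coefficient, which is not part of the
    hypotheses. *)
Lemma limit_ge (alpha : R) (f_ : nat -> X -> R) f : (forall n, intg m (f_ n)) -> intg m f ->
  (forall n, {ae m, forall x, alpha <= f_ n x}) ->
  \int[m]_x `|f_ n x - f x| @[n --> \oo] --> 0 -> {ae m, forall x, alpha <= f x}.
Proof.
move=> I_ I af h; have mf := intg_meas I.
pose g x := Num.max 0 (alpha - f x).
have Ig : intg m g.
  apply: (@le_intg _ _ _ _ g (fun x => `|alpha - f x|)).
  - by apply: measurable_maxr => //; exact: measurable_funB.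
  - by move=> x; rewrite /g ger0_norm ?le_max ?lexx// ge_max normr_ge0 ler_norm.
  - by apply: intg_norm; apply: intgB => //; exact: intg_cst.
have g0 x : 0 <= g x by rewrite le_max lexx.
suff : {ae m, forall x, g x = 0}.
  by apply: filterS => x gx; rewrite -subr_le0 -gx /g le_max lexx orbT.
apply: Rint_eq0_ae => //; apply/eqP; rewrite eq_le Rintegral_ge0// andbT.
rewrite -(cvg_lim _ h)//; apply: limr_ge; first by apply/cvg_ex; exists 0.
apply: nearW => n; apply: ae_le_Rint => //; first exact: intg_norm (intgB (I_ n) I).
apply: filterS (af n) => x ax; rewrite /g ge_max normr_ge0/=.
by apply: le_trans (ler_norm _); rewrite lerB.
Qed.

End clipping.

Section torus_problem.
Context {R : realType} (T : R) {N : nat}.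
Hypothesis T_gt0 : 0 < T.
Local Notation V := (R * 'rV[R]_N)%type.
Local Notation m := (QT_measure T N).
Local Notation mt := (torus_measure N : probability (torus R N) R).

#[local] Instance ae_QT_filter' : Filter (nbhs (almost_everywhere m)).
Proof. exact: ae_filter_ringOfSetsType. Qed.
#[local] Instance ae_torus_filter' : Filter (nbhs (almost_everywhere mt)).
Proof. exact: ae_filter_ringOfSetsType. Qed.

Lemma ae_box0 : {ae mt, forall x, box T (0, x)}.
Proof.
have : {ae mt, forall x, forall i : 'I_N, 0 <= tnth x i <= 1}.
  apply: filter_forall => i; apply: filterS (ae_unit_interval 0 i) => x /and3P[x0 x1 _].
  by rewrite !ltW.
by apply: filterS => x hx; split => //=; rewrite lexx ltW.
Qed.

Lemma boxedE (f : V -> R) p : box T p -> boxed T f p = on_tuples f p.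
Proof. by move=> bp; rewrite /boxed patchE mem_set. Qed.

Lemma on_tuples_ramp_mode (eps tau : R) (k : N.-tuple (bool * nat)) (p : spacetime R N) :
  on_tuples (ramp_mode eps tau k) p = ramp eps (tau - p.1) * mode k p.2.
Proof. by rewrite /on_tuples /ramp_mode; congr (_ * _); apply: eq_bigr => i _; rewrite mxE. Qed.

Local Notation tsol := (sol mt m (test_function T) (boxed T) (fun f => boxed T (dt f))
  (fun f => boxed T (lap f)) (fun f x => boxed T f (0, x))).

Lemma measurable_boxed0 (f : V -> R) : continuous f ->
  measurable_fun setT (fun x : torus R N => boxed T f (0, x)).
Proof. by move=> cf; apply: measurableT_comp; [exact: measurable_boxed|exact: measurable_pair1]. Qed.

(** Boxing the test functions and changing [mu] to [mu'] alter the integrands on null sets only. The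
    initial term lives on the slice [t = 0], itself a null set of space-time, and so relies on
    [ae_box0] instead of [ae_box]. *)
Lemma dual_sol (mu mu' G z : spacetime R N -> R) (z0 : torus R N -> R) :
  measurable_fun setT mu -> measurable_fun setT mu' -> {ae m, forall p, mu' p = mu p} ->
  sqint m G -> sqint mt z0 -> sqint m z ->
  dual_solution T mu G z0 z <-> tsol mu' G z0 z.
Proof.
move=> mmu mmu' mumu' G2 z02 z2.
have mz := sqint_meas z2; have mG := sqint_meas G2; have mz0 := sqint_meas z02.
have mo (f : V -> R) : continuous f -> measurable_fun setT (on_tuples f : spacetime R N -> R).
  exact: measurable_on_tuples.
have E1 phi : test_function T phi -> \int[m]_p (z p * (boxed T (dt phi) p + mu' p * boxed T (lap phi) p)) =
    \int[m]_p (z p * (on_tuples (dt phi) p + mu p * on_tuples (lap phi) p)).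
  move=> [sphi _ _]; have cd := continuous_dt sphi; have cl := continuous_lap sphi.
  apply: ae_eq_Rint.
  - apply: measurable_funM => //; apply: measurable_funD; first exact: measurable_boxed.
    by apply: measurable_funM => //; exact: measurable_boxed.
  - apply: measurable_funM => //; apply: measurable_funD; first exact: mo.
    by apply: measurable_funM => //; exact: mo.
  - by apply: filterS2 (@ae_box R N T) mumu' => p bp ->; rewrite !boxedE.
have E2 phi : test_function T phi -> \int[m]_p (G p * boxed T phi p) = \int[m]_p (G p * on_tuples phi p).
  move=> [sphi _ _]; have c := sphi 0%N; apply: ae_eq_Rint.
  - by apply: measurable_funM => //; exact: measurable_boxed.
  - by apply: measurable_funM => //; exact: mo.
  - by apply: filterS (@ae_box R N T) => p bp; rewrite boxedE.
have E3 phi : test_function T phi ->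
    \int[mt]_x (z0 x * boxed T phi (0, x)) = \int[mt]_x (z0 x * on_tuples phi (0, x)).
  move=> [sphi _ _]; have c := sphi 0%N; apply: ae_eq_Rint.
  - by apply: measurable_funM => //; exact: measurable_boxed0.
  - apply: measurable_funM => //; apply: measurableT_comp; first exact: mo.
    exact: measurable_pair1.
  - by apply: filterS ae_box0 => p bp; rewrite boxedE.
split=> [[_ h] phi tp|h]; first by rewrite E1// E2// E3//; exact: h.
split; first exact/sqintP.
by move=> phi tp; rewrite -E1// -E2// -E3//; exact: h.
Qed.

Let tphi_meas (f : V -> R) : test_function T f -> [/\ measurable_fun setT (boxed T f),
  measurable_fun setT (boxed T (dt f)), measurable_fun setT (boxed T (lap f)) &
  measurable_fun setT (fun x : torus R N => boxed T f (0, x))].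
Proof.
move=> [sf _ _]; split.
- exact: measurable_boxed (sf 0%N).
- exact: measurable_boxed (continuous_dt sf).
- exact: measurable_boxed (continuous_lap sf).
- exact: measurable_boxed0 (sf 0%N).
Qed.

Let tphi_bdd (f : V -> R) : test_function T f -> exists C, [/\ forall p, `|boxed T f p| <= C,
  forall p, `|boxed T (dt f) p| <= C, forall p, `|boxed T (lap f) p| <= C &
  forall x : torus R N, `|boxed T f (0, x)| <= C].
Proof.
move=> [sf _ _]; have [C0 h0] := boxed_bound T (sf 0%N : continuous f).
have [C1 h1] := boxed_bound T (continuous_dt sf); have [C2 h2] := boxed_bound T (continuous_lap sf).
exists (Num.max C0 (Num.max C1 C2)).
by split => p; rewrite !le_max ?h0 ?h1 ?h2 ?orbT.
Qed.

Let tphi_lin a (f g : V -> R) : test_function T f -> test_function T g -> exists2 k, test_function T k &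
  [/\ forall p, boxed T k p = a * boxed T f p + boxed T g p,
      forall p, boxed T (dt k) p = a * boxed T (dt f) p + boxed T (dt g) p,
      forall p, boxed T (lap k) p = a * boxed T (lap f) p + boxed T (lap g) p &
      forall x : torus R N, boxed T k (0, x) = a * boxed T f (0, x) + boxed T g (0, x)].
Proof.
move=> tf tg; exists (fun q => a * f q + g q); first exact: test_function_lin.
have [sf _ _] := tf; have [sg _ _] := tg.
by rewrite dt_lin// lap_lin//; split => p; exact: boxed_lin.
Qed.

Let tphi_ramp eps tau j : 0 < eps -> 0 < tau -> tau < T -> exists2 f : V -> R, test_function T f &
  [/\ {ae m, forall p, boxed T f p = ramp eps (tau - p.1) * fourier j p.2},
      {ae m, forall p, boxed T (dt f) p = - dramp eps (tau - p.1) * fourier j p.2},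
      {ae m, forall p, boxed T (lap f) p = - @lam R N j * (ramp eps (tau - p.1) * fourier j p.2)} &
      {ae mt, forall x, boxed T f (0, x) = ramp eps tau * fourier j x}].
Proof.
move=> e0 t0 tT; rewrite /fourier /lam; case: pickle_inv => [k|].
  exists (ramp_mode eps tau k); first exact: test_ramp_mode.
  split; [apply: filterS (@ae_box R N T) => p bp..|apply: filterS ae_box0 => p bp]; rewrite boxedE//.
  - exact: on_tuples_ramp_mode.
  - rewrite {1}/on_tuples dt_ramp_mode//; congr (_ * _).
    by apply: eq_bigr => i _; rewrite mxE.
  - by rewrite {1}/on_tuples lap_ramp_mode -on_tuples_ramp_mode.
  - by rewrite on_tuples_ramp_mode/= subr0.
(* When [j] encodes no frequency, [fourier j] is zero and the zero test function will do. *)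
exists (fun=> 0); first exact: test_function0.
have d0 (v : V) : (fun q => 'D_v (fun _ : V => 0 : R) q) = (fun=> 0).
  by apply/funext => q; exact: derive_cst.
have b0 p : boxed T (fun _ : V => 0) p = 0 by rewrite /boxed patchE; case: ifP.
have dt0 : dt (fun _ : V => 0 : R) = (fun=> 0) by exact: d0.
have lap0 : lap (fun _ : V => 0 : R) = (fun=> 0).
  by apply/funext => q; rewrite /lap big1// => i _; rewrite d0; exact: derive_cst.
by rewrite dt0 lap0; split; apply: nearW => p; rewrite b0 ?mulr0.
Qed.

Definition torus_stability := @abstract_stability R T _ (torus R N) (time_measure T) mt m T_gt0
  (fun A => erefl) (probability_setT mt) (fun A _ => erefl) (@fourier R N) (2 ^+ N)
  (@measurable_fourier R N) (@fourier_bound R N) (@fourier_ortho R N) (@fourier_norm R N)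
  (@torus_complete R N) (@lam R N) (@const_index N) (@fourier_const R N) (@lam_const R N)
  (@fourier_lam0 R N) (@lam_ge1 R N) (@lam_cvg R N) (V -> R) (test_function T) (boxed T)
  (fun f => boxed T (dt f)) (fun f => boxed T (lap f)) (fun f x => boxed T f (0, x))
  tphi_meas tphi_bdd tphi_lin tphi_ramp.

End torus_problem.

Theorem proposition3 (R : realType) (T : R) (N : nat)
  (T_gt0 : 0 < T) (N_ge1 : (1 <= N)%N)
  (mu_ G_ z_ : nat -> spacetime R N -> R) (z0_ : nat -> torus R N -> R)
  (mu_Loo : forall n, mu_ n \in Lfun (QT_measure T N) +oo%E)
  (G_L2 : forall n, G_ n \in Lfun (QT_measure T N) 2%:E)
  (z0_L2 : forall n, z0_ n \in Lfun (torus_measure N) 2%:E)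
  (alpha : R) (alpha_gt0 : 0 < alpha)
  (mu_ge : forall n, {ae QT_measure T N, forall p, alpha <= mu_ n p})
  (z_dual : forall n, dual_solution T (mu_ n) (G_ n) (z0_ n) (z_ n))
  (z0 : torus R N -> R) (G mu : spacetime R N -> R)
  (z0L2 : z0 \in Lfun (torus_measure N) 2%:E)
  (GL2 : G \in Lfun (QT_measure T N) 2%:E)
  (muLoo : mu \in Lfun (QT_measure T N) +oo%E)
  (z0_cvg : weak_L2cvg (torus_measure N) z0_ z0)
  (G_cvg : weak_L2cvg (QT_measure T N) G_ G)
  (mu_cvg : Lcvg (QT_measure T N) 1%E mu_ mu) :
  exists z : spacetime R N -> R,
    [/\ dual_solution T mu G z0 z,
        forall w, dual_solution T mu G z0 w ->
          {ae QT_measure T N, forall p, w p = z p},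
        Lcvg (QT_measure T N) 2%:E
          (fun n p => Num.sqrt (mu_ n p) * z_ n p)
          (fun p => Num.sqrt (mu p) * z p) &
        Lcvg (QT_measure T N) 2%:E z_ z].
Proof.
have ae_QT : Filter (nbhs (almost_everywhere (QT_measure T N))) by exact: ae_filter_ringOfSetsType.
have m_meas n : measurable_fun setT (mu_ n) by case: (Lfun_oo (mu_Loo n)).
have mmeas : measurable_fun setT mu by case: (Lfun_oo muLoo).
have G_2 n : sqint (QT_measure T N) (G_ n) by exact/sqintP.
have G2 : sqint (QT_measure T N) G by exact/sqintP.
have z0_2 n : sqint (torus_measure N) (z0_ n) by exact/sqintP.
have z02 : sqint (torus_measure N) z0 by exact/sqintP.
have z_2 n : sqint (QT_measure T N) (z_ n) by apply/sqintP; case: (z_dual n).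
(* The coefficients are replaced by versions satisfying their bounds at every point; the conclusions
   are carried back along the almost everywhere equalities. *)
have /choice[M_ /choice[nu_ hnu_]] n := clip_version alpha_gt0 (mu_Loo n) (mu_ge n).
have nu_meas n : measurable_fun setT (nu_ n) by case: (hnu_ n).
have nu_M n p : `|nu_ n p| <= M_ n by case: (hnu_ n).
have nu_ge n p : alpha <= nu_ n p by case: (hnu_ n).
have nu_E n : {ae QT_measure T N, forall p, nu_ n p = mu_ n p} by case: (hnu_ n).
have Inu_ n : intg (QT_measure T N) (nu_ n) by exact: intg_bdd (nu_meas n) (nu_M n).
have Imu_ n : intg (QT_measure T N) (mu_ n).
  by apply: ae_eq_intg (Inu_ n) => //; apply: filterS (nu_E n) => p ->.
have Imu : intg (QT_measure T N) mu.
  have [_ [M0 muM0]] := Lfun_oo muLoo.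
  exact: ae_le_intg mmeas muM0 (intg_cst _ M0).
have L1 := Lcvg1_Rint Imu_ Imu mu_cvg.
have muge := limit_ge Imu_ Imu mu_ge L1.
have [M [nu [nu_m nuM nuge nuE]]] := clip_version alpha_gt0 muLoo muge.
have nu_cvg : \int[QT_measure T N]_p `|nu_ n p - nu p| @[n --> \oo] --> 0.
  apply: cvg_trans L1; apply: near_eq_cvg; apply: nearW => n.
  apply: ae_eq_Rint.
  - by apply: measurableT_comp => //; exact: measurable_funB.
  - by apply: measurableT_comp => //; exact: measurable_funB.
  - by apply: filterS2 (nu_E n) nuE => p -> ->.
have z_sol n := proj1 (dual_sol T_gt0 (m_meas n) (nu_meas n) (nu_E n) (G_2 n) (z0_2 n) (z_2 n)) (z_dual n).
have c1 g : sqint (torus_measure N) g ->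
    \int[torus_measure N]_y (z0_ n y * g y) @[n --> \oo] --> \int[torus_measure N]_y (z0 y * g y).
  by move=> g2; apply: z0_cvg; exact/sqintP.
have c2 g : sqint (QT_measure T N) g ->
    \int[QT_measure T N]_y (G_ n y * g y) @[n --> \oo] --> \int[QT_measure T N]_y (G y * g y).
  by move=> g2; apply: G_cvg; exact/sqintP.
have [z z2 [zs zu cuz cz]] := torus_stability T_gt0 nu_meas nu_M alpha_gt0 nu_ge G_2 z_2 z0_2 z_sol
  nu_m nuM nuge G2 z02 c1 c2 nu_cvg.
exists z; split.
- exact/(dual_sol T_gt0 mmeas nu_m nuE G2 z02 z2).
- move=> w wd; have w2 : sqint (QT_measure T N) w by apply/sqintP; case: wd.
  by apply: zu => //; apply/(dual_sol T_gt0 mmeas nu_m nuE G2 z02 w2).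
- have s_ n := sqint_sqrtM (nu_meas n) (nu_M n) (m_meas n) (nu_E n) (z_2 n).
  have s := sqint_sqrtM nu_m nuM mmeas nuE z2.
  apply: Rint_Lcvg2 => //.
  apply: cvg_trans cuz; apply: near_eq_cvg; apply: nearW => n.
  apply: ae_eq_Rint.
  + apply: measurable_funX; apply: measurable_funB.
      by apply: measurable_funM; [exact: measurable_sqrtr|exact: sqint_meas (z_2 n)].
    by apply: measurable_funM; [exact: measurable_sqrtr|exact: sqint_meas z2].
  + by apply: measurable_funX; apply: measurable_funB; [exact: sqint_meas (s_ n)|exact: sqint_meas s].
  + by apply: filterS2 (nu_E n) nuE => p -> ->.
- exact: Rint_Lcvg2 cz.
Qed.
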